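(* Let $(\mathcal M,g,A)$ be a Weyl geometry on a 4-dimensional real oriented manifold and let $\Lambda,F,F',E,E'$ be the canonical 1-forms on the associated twistor bundle $\mathcal{PP}'$. (a) $(\mathcal M,g,A)$ is anti-self-dual and satisfies the Einstein-Weyl equations if and only if the forms $(\Lambda,F,E,E')$ form a closed differential ideal on $\mathcal{PP}'$, i.e. if and only if on $\mathcal{PP}'$ $$d\Lambda\wedge E\wedge\Lambda\wedge F=0,\quad dF\wedge E\wedge\Lambda\wedge F=0,\quad dE\wedge E\wedge\Lambda\wedge F=0,\quad dE'\wedge E'\wedge\Lambda\wedge F=0.$$ (b) $(\mathcal M,g,A)$ is self-dual and satisfies the Einstein-Weyl equations if and only if on $\mathcal{PP}'$ $$d\Lambda\wedge E'\wedge\Lambda\wedge F'=0,\quad dF'\wedge E'\wedge\Lambda\wedge F'=0,\quad dE'\wedge E'\wedge\Lambda\wedge F'=0,\quad dE\wedge E\wedge\Lambda\wedge F'=0,$$ i.e. if and only if $(\Lambda,F',E,E')$ form a closed differential ideal on $\mathcal{PP}'$.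
   Context: Closed differential ideal: 1-forms $(A_1,\dots,A_s)$ form (generate) a closed differential ideal iff $dA_a\wedge A_1\wedge\dots\wedge A_s=0$ for all $a=1,\dots,s$. Weyl geometry. A metric on $\mathcal M$ is a nondegenerate symmetric bilinear complex-valued form. A Weyl geometry $(g,A)$ consists of a metric $g$ and a complex-valued 1-form $A$. In a coframe $(\theta^i)$ of complex-valued 1-forms, $g=g_{ij}\theta^i\theta^j$, the Weyl connection 1-forms $\Gamma^i_{\ j}$ are uniquely determined by $dg_{ij}-g_{ik}\Gamma^k_{\ j}-g_{jk}\Gamma^k_{\ i}=-A\,g_{ij}$ and $d\theta^i=-\Gamma^i_{\ j}\wedge\theta^j$. Curvature: $\frac12R_{ijkl}\theta^k\wedge\theta^l=g_{ih}(d\Gamma^h_{\ j}+\Gamma^h_{\ k}\wedge\Gamma^k_{\ j})$, $R_{jl}=g^{ik}R_{ijkl}$, $R=g^{ij}R_{ij}$, $S_{ij}=R_{(ij)}-\frac14Rg_{ij}$. The Einstein-Weyl equations are $S_{ij}=0$. Let $w_{ijkl}$ be the Weyl tensor of the Levi-Civita connection of $g$ and $w_{ij}=\frac12w_{ijkl}\theta^k\wedge\theta^l$. A null cotetrad is a coframe $(\theta^1,\dots,\theta^4)=(M,P,N,K)$ with $g=MP-NK$, where $\alpha\beta=\frac12(\alpha\otimes\beta+\beta\otimes\alpha)$, and compatible with the orientation in the sense that the volume form is $\eta=M\wedge P\wedge N\wedge K$. The dual frame is $(m,p,n,k)$. Self-dual 2-forms are spanned by $P\wedge K,\ N\wedge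 K-M\wedge P,\ N\wedge M$; anti-self-dual ones by $M\wedge K,\ N\wedge K+M\wedge P,\ N\wedge P$. $(g,A)$ is anti-self-dual (self-dual) if all 2-forms $w_{ij}$ are anti-self-dual (self-dual) on $\mathcal M$. Twistor bundle. Totally null 2-planes of $T_x\mathcal M^{\mathbb C}$ form two disjoint 2-spheres: self-dual ones $s=\mathrm{Span}\{zm-k,zn-p\}$ and anti-self-dual ones $s'=\mathrm{Span}\{z'p-k,z'n-m\}$, with $z,z'\in\mathbb C\cup\{\infty\}$. $\mathcal P$ (resp. $\mathcal P'$) is the $S^2$-bundle over $\mathcal M$ of all self-dual (resp. anti-self-dual) such planes, and $\mathcal{PP}'$ is their fibre product (real dimension 8), with local coordinates $(x,z,\bar z,z',\bar z')$. On $\mathcal{PP}'$ (pullbacks not written) $$E=dz-\Gamma^3_{\ 2}+z(\Gamma^1_{\ 1}-\Gamma^4_{\ 4})+z^2\Gamma^2_{\ 3},\quad E'=dz'-\Gamma^3_{\ 1}+z'(\Gamma^2_{\ 2}-\Gamma^4_{\ 4})+z'^2\Gamma^1_{\ 3},$$ $$\Lambda=-N-zz'K-zP-z'M,\quad F=M+zK,\quad F'=P+z'K.$$ Intrinsically $E,E',\Lambda$ are defined up to multiplication by nonvanishing functions, $F$ up to $F\to\alpha F+\beta\Lambda$ and $F'$ up to $F'\to\alpha^{-1}F'+\gamma\Lambda$, $\alpha\neq0$; the conditions do not depend on these choices. Standing assumption: $\mathcal M$ is such that $E,E'$ can be chosen globally (e.g. an open subset of $\mathbb R^4$). *)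

(* Defs.v *)
From mathcomp Require Import all_boot all_order all_algebra.
From mathcomp Require Import all_classical all_reals all_analysis.
From mathcomp Require Import complex.

Set Implicit Arguments.
Unset Strict Implicit.
Unset Printing Implicit Defensive.

Import Order.TTheory GRing.Theory Num.Theory.
Import numFieldNormedType.Exports.

Local Open Scope complex_scope.
Local Open Scope ring_scope.

Definition partial (R : realType) (n : nat) (k : 'I_n) (f : 'rV[R]_n -> R)
    (x : 'rV[R]_n) : R :=
  'D_(delta_mx 0 k) f x.

Fixpoint class_C (R : realType) (n : nat) (r : nat) (V : set 'rV[R]_n)
    (f : 'rV[R]_n -> R) : Prop :=
  (forall x, V x -> {for x, continuous f}) /\
  match r with
  | 0 => True
  | r'.+1 => forall k : 'I_n,
      (forall x, V x -> derivable f x (delta_mx 0 k)) /\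
      class_C r' V (partial k f)
  end.

Definition smooth (R : realType) (n : nat) (V : set 'rV[R]_n)
    (f : 'rV[R]_n -> R) : Prop :=
  forall r, class_C r V f.

(* Complex-valued functions of real variables are differentiated through
   their real and imaginary parts. *)
Definition csmooth (R : realType) (n : nat) (V : set 'rV[R]_n)
    (f : 'rV[R]_n -> R[i]) : Prop :=
  smooth V (fun x => complex.Re (f x)) /\ smooth V (fun x => complex.Im (f x)).

Definition cpartial (R : realType) (n : nat) (k : 'I_n) (f : 'rV[R]_n -> R[i])
    (x : 'rV[R]_n) : R[i] :=
  partial k (fun y => complex.Re (f y)) x
    +i* partial k (fun y => complex.Im (f y)) x.

Definition csmooth_mx (R : realType) (n p q : nat) (V : set 'rV[R]_n)
    (B : 'rV[R]_n -> 'M[R[i]]_(p, q)) : Prop :=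
  forall i j, csmooth V (fun x => B x i j).

(* The exterior algebra of the complexified cotangent space of R^n:
   w S is the coefficient of dx_{i_1} /\ ... /\ dx_{i_k} in w, where
   S = {i_1 < ... < i_k}.  The regular module R[i]^o is used so that w can be
   multiplied by complex scalars with *:. *)
Notation ext R n := {ffun {set 'I_n} -> R[i]^o}.

(* dx_S /\ dx_T = (-1)^(inversions S T) dx_(S u T) for disjoint S and T. *)
Definition inversions (n : nat) (S T : {set 'I_n}) : nat :=
  #|[set ij : 'I_n * 'I_n | [&& ij.1 \in S, ij.2 \in T & (ij.2 < ij.1)%N]]%SET|.

Definition wedge (R : realType) (n : nat) (v w : ext R n) : ext R n :=
  [ffun S : {set 'I_n} => \sum_(T : {set 'I_n} | T \subset S)
     (-1) ^+ inversions T (S :\: T) * v T * w (S :\: T)].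

Notation "v ∧ w" := (wedge v w) (at level 39, left associativity).

Definition ext1 (R : realType) (n : nat) : ext R n :=
  [ffun S : {set 'I_n} => (S == finset.set0)%:R].

Definition cov (R : realType) (n : nat) (a : 'rV[R[i]]_n) : ext R n :=
  [ffun S : {set 'I_n} => \sum_(k < n | S == [set k]%SET) a 0 k].

Definition ext_d (R : realType) (n : nat) (w : 'rV[R]_n -> ext R n)
    (x : 'rV[R]_n) : ext R n :=
  \sum_(k < n) cov (delta_mx 0 k)
     ∧ [ffun S : {set 'I_n} => cpartial k (fun y => w y S) x].

Definition d_fun (R : realType) (n : nat) (f : 'rV[R]_n -> R[i])
    (x : 'rV[R]_n) : 'rV[R[i]]_n :=
  \row_k cpartial k f x.

Definition d_cov (R : realType) (n : nat) (a : 'rV[R]_n -> 'rV[R[i]]_n) :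
    'rV[R]_n -> ext R n :=
  ext_d (fun x => cov (a x)).

(* Value of a 2-form on two vectors, with
   (a /\ b)(u, v) = a(u) b(v) - a(v) b(u). *)
Definition eval2 (R : realType) (n : nat) (w : ext R n) (u v : 'rV[R[i]]_n) :
    R[i] :=
  \sum_(k < n) \sum_(l < n | (k < l)%N)
     w [set k; l]%SET * (u 0 k * v 0 l - u 0 l * v 0 k).

Definition closed_ideal (R : realType) (n s : nat) (U : set 'rV[R]_n)
    (a : 'I_s -> 'rV[R]_n -> 'rV[R[i]]_n) : Prop :=
  forall k x, U x ->
    d_cov (a k) x ∧ \big[@wedge R n/ext1 R n]_(l < s) cov (a l x) = 0.

(* Tensors given by their components in a coframe with metric matrix G. *)

Definition tensor4 (R : realType) : Type :=
  'I_4 -> 'I_4 -> 'I_4 -> 'I_4 -> R[i].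

Definition ricci (R : realType) (G : 'M[R[i]]_4) (T : tensor4 R) :
    'M[R[i]]_4 :=
  \matrix_(j, l) \sum_i \sum_k invmx G i k * T i j k l.

Definition scalar_curv (R : realType) (G : 'M[R[i]]_4) (T : tensor4 R) : R[i] :=
  \sum_i \sum_j invmx G i j * ricci G T i j.

Definition tracefree_ricci (R : realType) (G : 'M[R[i]]_4) (T : tensor4 R) :
    'M[R[i]]_4 :=
  2^-1 *: (ricci G T + (ricci G T)^T) - (4^-1 * scalar_curv G T) *: G.

Definition weyl_tensor (R : realType) (G : 'M[R[i]]_4) (T : tensor4 R) :
    tensor4 R :=
  fun i j k l =>
    let r := ricci G T in
    T i j k l
    - 2^-1 * (G i k * r j l - G i l * r j k - G j k * r i l + G j l * r i k)
    + 6^-1 * scalar_curv G T * (G i k * G j l - G i l * G j k).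

(* A coframe th is encoded by the matrix whose i-th row is theta^i in
   coordinates; the rows of frame th x are then the dual vectors. *)

Definition coframe (R : realType) (V : set 'rV[R]_4)
    (th : 'rV[R]_4 -> 'M[R[i]]_4) : Prop :=
  csmooth_mx V th /\ forall x, V x -> th x \in unitmx.

Definition frame (R : realType) (th : 'rV[R]_4 -> 'M[R[i]]_4) (x : 'rV[R]_4) :
    'M[R[i]]_4 :=
  (invmx (th x))^T.

(* g_ij = g(e_i, e_j), from the matrix g of the metric in coordinates. *)
Definition frame_metric (R : realType) (g th : 'rV[R]_4 -> 'M[R[i]]_4)
    (x : 'rV[R]_4) : 'M[R[i]]_4 :=
  frame th x *m g x *m (frame th x)^T.

(* Gam x i j is the 1-form Gamma^i_j at x. *)
Definition connection (R : realType) : Type :=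
  'rV[R]_4 -> 'I_4 -> 'I_4 -> 'rV[R[i]]_4.

Definition weyl_connection (R : realType) (V : set 'rV[R]_4)
    (g : 'rV[R]_4 -> 'M[R[i]]_4) (A : 'rV[R]_4 -> 'rV[R[i]]_4)
    (th : 'rV[R]_4 -> 'M[R[i]]_4) (Gam : connection R) : Prop :=
  let G := frame_metric g th in
  [/\ forall i j, csmooth_mx V (fun x => Gam x i j),
      forall i j x, V x ->
        d_fun (fun y => G y i j) x - \sum_k G x i k *: Gam x k j
          - \sum_k G x j k *: Gam x k i = - (G x i j *: A x)
    & forall i x, V x ->
        d_cov (fun y => row i (th y)) x
        = - \sum_j (cov (Gam x i j) ∧ cov (row j (th x)))].

Definition levi_civita_connection (R : realType) (V : set 'rV[R]_4)
    (g th : 'rV[R]_4 -> 'M[R[i]]_4) (Gam : connection R) : Prop :=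
  weyl_connection V g (fun _ => 0) th Gam.

Definition curvature_form (R : realType) (Gam : connection R) (h j : 'I_4)
    (x : 'rV[R]_4) : ext R 4 :=
  d_cov (fun y => Gam y h j) x
  + \sum_k (cov (Gam x h k) ∧ cov (Gam x k j)).

(* R_ijkl, i.e. 1/2 R_ijkl theta^k /\ theta^l = g_ih (curvature_form h j). *)
Definition curvature (R : realType) (g th : 'rV[R]_4 -> 'M[R[i]]_4)
    (Gam : connection R) (x : 'rV[R]_4) : tensor4 R :=
  fun i j k l => \sum_h frame_metric g th x i h *
    eval2 (curvature_form Gam h j x) (row k (frame th x)) (row l (frame th x)).

Definition weyl_form (R : realType) (g th : 'rV[R]_4 -> 'M[R[i]]_4)
    (Gam : connection R) (i j : 'I_4) (x : 'rV[R]_4) : ext R 4 :=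
  2^-1 *: \sum_k \sum_l
    weyl_tensor (frame_metric g th x) (curvature g th Gam x) i j k l
      *: (cov (row k (th x)) ∧ cov (row l (th x))).

(* 1-based frame indices: for a null cotetrad, theta^1, ..., theta^4 are
   M, P, N, K. *)
Definition i1 : 'I_4 := @Ordinal 4 0 isT.
Definition i2 : 'I_4 := @Ordinal 4 1 isT.
Definition i3 : 'I_4 := @Ordinal 4 2 isT.
Definition i4 : 'I_4 := @Ordinal 4 3 isT.

Definition sym_prod (R : realType) (a b : 'rV[R[i]]_4) : 'M[R[i]]_4 :=
  2^-1 *: (a^T *m b + b^T *m a).

(* vol is the coefficient of the volume form in coordinates, so that
   \det (th x) = vol x says that it is M /\ P /\ N /\ K. *)
Definition null_cotetrad (R : realType) (V : set 'rV[R]_4)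
    (g : 'rV[R]_4 -> 'M[R[i]]_4) (vol : 'rV[R]_4 -> R[i])
    (th : 'rV[R]_4 -> 'M[R[i]]_4) : Prop :=
  [/\ coframe V th,
      forall x, V x ->
        g x = sym_prod (row i1 (th x)) (row i2 (th x))
              - sym_prod (row i3 (th x)) (row i4 (th x))
    & forall x, V x -> \det (th x) = vol x].

Definition self_dual_form (R : realType) (th : 'M[R[i]]_4) (w : ext R 4) :
    Prop :=
  let M := cov (row i1 th) in let P := cov (row i2 th) in
  let N := cov (row i3 th) in let K := cov (row i4 th) in
  exists a b c : R[i],
    w = a *: (P ∧ K) + b *: ((N ∧ K) - (M ∧ P)) + c *: (N ∧ M).

Definition anti_self_dual_form (R : realType) (th : 'M[R[i]]_4) (w : ext R 4) :
    Prop :=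
  let M := cov (row i1 th) in let P := cov (row i2 th) in
  let N := cov (row i3 th) in let K := cov (row i4 th) in
  exists a b c : R[i],
    w = a *: (M ∧ K) + b *: ((N ∧ K) + (M ∧ P)) + c *: (N ∧ P).

(* Jacobian of a map R^4 -> R^4: row m holds the m-th partial derivatives. *)
Definition jacobian4 (R : realType) (f : 'rV[R]_4 -> 'rV[R]_4)
    (x : 'rV[R]_4) : 'M[R]_4 :=
  \matrix_(m, n) partial m (fun y => f y 0 n) x.

(* A 4-dimensional oriented manifold, given by an oriented atlas.  The charts
   are chart c : dom c -> R^4, with inverses param c. *)
Record oriented_manifold4 (R : realType) := OrientedManifold4 {
  manifold_point : topologicalType;
  point_hausdorff : hausdorff_space manifold_point;
  point_second_countable : @second_countable manifold_point;
  chart_index : Type;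
  dom : chart_index -> set manifold_point;
  chart : chart_index -> manifold_point -> 'rV[R]_4;
  param : chart_index -> 'rV[R]_4 -> manifold_point;
  img := fun c => (chart c @` dom c)%classic;
  overlap := fun c c' => (chart c @` (dom c `&` dom c'))%classic;
  transition := fun c c' x => chart c' (param c x);
  dom_cover : forall p, exists c, dom c p;
  dom_open : forall c, open (dom c);
  img_open : forall c, open (img c);
  chartK : forall c p, dom c p -> param c (chart c p) = p;
  chart_continuous : forall c p, dom c p -> {for p, continuous (chart c)};
  param_continuous : forall c x, img c x -> {for x, continuous (param c)};
  transition_smooth : forall c c' n,
    smooth (overlap c c') (fun x => transition c c' x 0 n);
  transition_oriented : forall c c' x, overlap c c' x ->
    0 < \det (jacobian4 (transition c c') x)
}.

Definition cjacobian (R : realType) (X : oriented_manifold4 R) (c c' : chart_index X)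
    (x : 'rV[R]_4) : 'M[R[i]]_4 :=
  map_mx (real_complex R) (jacobian4 (transition c c') x).

(* Components of the metric and of the 1-form in each chart. *)
Record weyl_geometry (R : realType) (X : oriented_manifold4 R) :=
    WeylGeometry {
  metric : chart_index X -> 'rV[R]_4 -> 'M[R[i]]_4;
  wform : chart_index X -> 'rV[R]_4 -> 'rV[R[i]]_4;
  metric_smooth : forall c, csmooth_mx (img c) (metric c);
  metric_sym : forall c x, img c x -> (metric c x)^T = metric c x;
  metric_nondegenerate : forall c x, img c x -> metric c x \in unitmx;
  metric_change : forall c c' x, overlap c c' x ->
    metric c x = cjacobian c c' x *m metric c' (transition c c' x)
                   *m (cjacobian c c' x)^T;
  wform_smooth : forall c, csmooth_mx (img c) (wform c);
  wform_change : forall c c' x, overlap c c' x ->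
    wform c x = wform c' (transition c c' x) *m (cjacobian c c' x)^T
}.

(* The volume form of the oriented metric: a 4-form which is M /\ P /\ N /\ K
   up to sign for every cotetrad with g = MP - NK, equivalently whose square is
   16 det g.  For a complex-valued metric the orientation of the real manifold
   does not fix the sign of a square root of det g, so the choice of this
   4-form is what orients (X, g). *)
Record volume_form (R : realType) (X : oriented_manifold4 R)
    (W : weyl_geometry X) := VolumeForm {
  vol : chart_index X -> 'rV[R]_4 -> R[i];
  vol_smooth : forall c, csmooth (img c) (vol c);
  vol_square : forall c x, img c x ->
    vol c x ^+ 2 = 16%:R * \det (metric W c x);
  vol_change : forall c c' x, overlap c c' x ->
    vol c x = vol c' (transition c c' x) * \det (cjacobian c c' x)
}.

Definition local_coframe (R : realType) (X : oriented_manifold4 R)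
    (c : chart_index X) (V : set 'rV[R]_4) (th : 'rV[R]_4 -> 'M[R[i]]_4) : Prop :=
  [/\ open V, (V `<=` img c)%classic & coframe V th].

Definition local_null_cotetrad (R : realType) (X : oriented_manifold4 R)
    (W : weyl_geometry X) (eta : volume_form W) (c : chart_index X)
    (V : set 'rV[R]_4) (th : 'rV[R]_4 -> 'M[R[i]]_4) : Prop :=
  [/\ open V, (V `<=` img c)%classic & null_cotetrad V (metric W c) (vol eta c) th].

Definition einstein_weyl (R : realType) (X : oriented_manifold4 R)
    (W : weyl_geometry X) : Prop :=
  forall c V th Gam, local_coframe c V th ->
    weyl_connection V (metric W c) (wform W c) th Gam ->
    forall x, V x ->
      tracefree_ricci (frame_metric (metric W c) th x)
        (curvature (metric W c) th Gam x) = 0.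

Definition self_dual (R : realType) (X : oriented_manifold4 R)
    (W : weyl_geometry X) (eta : volume_form W) : Prop :=
  forall c V th Gam, local_null_cotetrad eta c V th ->
    levi_civita_connection V (metric W c) th Gam ->
    forall i j x, V x ->
      self_dual_form (th x) (weyl_form (metric W c) th Gam i j x).

Definition anti_self_dual (R : realType) (X : oriented_manifold4 R)
    (W : weyl_geometry X) (eta : volume_form W) : Prop :=
  forall c V th Gam, local_null_cotetrad eta c V th ->
    levi_civita_connection V (metric W c) th Gam ->
    forall i j x, V x ->
      anti_self_dual_form (th x) (weyl_form (metric W c) th Gam i j x).

(* Coordinates on the twistor bundle PP': a null cotetrad on V, with dual frame
   (m, p, n, k), identifies the point (x, Re z, Im z, Re z', Im z') of
   V x R^4 with the pair of planes Span{zm - k, zn - p}, Span{z'p - k, z'n - m}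
   over x.  The planes with z or z' infinite are covered as well, by other null
   cotetrads on V: replacing (M, P, N, K) by (K, -N, -P, M) changes (z, z') to
   (1/z, -z'), and replacing it by (-N, K, -M, P) changes (z, z') to
   (-z, 1/z'). *)

Definition tw_base (R : realType) (y : 'rV[R]_(4 + 4)) : 'rV[R]_4 := lsubmx y.
Definition tw_z (R : realType) (y : 'rV[R]_(4 + 4)) : R[i] :=
  rsubmx y 0 i1 +i* rsubmx y 0 i2.
Definition tw_z' (R : realType) (y : 'rV[R]_(4 + 4)) : R[i] :=
  rsubmx y 0 i3 +i* rsubmx y 0 i4.

Definition pull (R : realType) (a : 'rV[R[i]]_4) : 'rV[R[i]]_(4 + 4) :=
  row_mx a 0.
Definition tw_dz (R : realType) : 'rV[R[i]]_(4 + 4) :=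
  row_mx 0 (delta_mx 0 i1 + (0 +i* 1) *: delta_mx 0 i2).
Definition tw_dz' (R : realType) : 'rV[R[i]]_(4 + 4) :=
  row_mx 0 (delta_mx 0 i3 + (0 +i* 1) *: delta_mx 0 i4).

Definition tw_E (R : realType) (Gam : connection R) (y : 'rV[R]_(4 + 4)) :
    'rV[R[i]]_(4 + 4) :=
  let x := tw_base y in let z := tw_z y in
  tw_dz R - pull (Gam x i3 i2)
  + z *: (pull (Gam x i1 i1) - pull (Gam x i4 i4))
  + z ^+ 2 *: pull (Gam x i2 i3).

Definition tw_E' (R : realType) (Gam : connection R) (y : 'rV[R]_(4 + 4)) :
    'rV[R[i]]_(4 + 4) :=
  let x := tw_base y in let z' := tw_z' y in
  tw_dz' R - pull (Gam x i3 i1)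
  + z' *: (pull (Gam x i2 i2) - pull (Gam x i4 i4))
  + z' ^+ 2 *: pull (Gam x i1 i3).

Definition tw_M (R : realType) (th : 'rV[R]_4 -> 'M[R[i]]_4)
    (y : 'rV[R]_(4 + 4)) : 'rV[R[i]]_(4 + 4) := pull (row i1 (th (tw_base y))).
Definition tw_P (R : realType) (th : 'rV[R]_4 -> 'M[R[i]]_4)
    (y : 'rV[R]_(4 + 4)) : 'rV[R[i]]_(4 + 4) := pull (row i2 (th (tw_base y))).
Definition tw_N (R : realType) (th : 'rV[R]_4 -> 'M[R[i]]_4)
    (y : 'rV[R]_(4 + 4)) : 'rV[R[i]]_(4 + 4) := pull (row i3 (th (tw_base y))).
Definition tw_K (R : realType) (th : 'rV[R]_4 -> 'M[R[i]]_4)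
    (y : 'rV[R]_(4 + 4)) : 'rV[R[i]]_(4 + 4) := pull (row i4 (th (tw_base y))).

Definition tw_L (R : realType) (th : 'rV[R]_4 -> 'M[R[i]]_4)
    (y : 'rV[R]_(4 + 4)) : 'rV[R[i]]_(4 + 4) :=
  - tw_N th y - (tw_z y * tw_z' y) *: tw_K th y
  - tw_z y *: tw_P th y - tw_z' y *: tw_M th y.

Definition tw_F (R : realType) (th : 'rV[R]_4 -> 'M[R[i]]_4)
    (y : 'rV[R]_(4 + 4)) : 'rV[R[i]]_(4 + 4) :=
  tw_M th y + tw_z y *: tw_K th y.

Definition tw_F' (R : realType) (th : 'rV[R]_4 -> 'M[R[i]]_4)
    (y : 'rV[R]_(4 + 4)) : 'rV[R[i]]_(4 + 4) :=
  tw_P th y + tw_z' y *: tw_K th y.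

(* A condition on the canonical forms holds on PP' if it does in all the
   coordinate systems above, U being the coordinate domain V x R^4. *)
Definition on_twistor_bundle (R : realType) (X : oriented_manifold4 R)
    (W : weyl_geometry X) (eta : volume_form W)
    (Q : set 'rV[R]_(4 + 4) -> ('rV[R]_4 -> 'M[R[i]]_4) -> connection R ->
         Prop) : Prop :=
  forall c V th Gam, local_null_cotetrad eta c V th ->
    weyl_connection V (metric W c) (wform W c) th Gam ->
    Q (@tw_base R @^-1` V)%classic th Gam.

(* Main.v *)
Require Import Defs.
From mathcomp Require Import all_boot all_order all_algebra.
From mathcomp Require Import all_classical all_reals all_analysis.
From mathcomp Require Import complex perm.
From mathcomp Require Import ring lra.

Set Implicit Arguments.
Unset Strict Implicit.
Unset Printing Implicit Defensive.

Import Order.TTheory GRing.Theory Num.Theory.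
Import numFieldNormedType.Exports.

Local Open Scope complex_scope.
Local Open Scope ring_scope.

(* Restricted to z = const, E is e_z = - Gamma^3_2 + z (Gamma^1_1 - Gamma^4_4)
   + z^2 Gamma^2_3, and modulo E, L, F its differential is the combination
   - Omega^3_2 + z (Omega^1_1 - Omega^4_4) + z^2 Omega^2_3 of curvature forms.
   A 2-form of the base reduces modulo L and F to a multiple of P /\ K, with
   coefficient sd_part z, so dE /\ E /\ L /\ F = q(z) P /\ K /\ E /\ L /\ F, and
   dE' /\ E' /\ L /\ F = q'(z, z') P /\ K /\ E' /\ L /\ F likewise; the conditions
   on dL and dF hold identically, by the first structure equation.

   Comparing coefficients of z and z' and using the Bianchi identity, q' = 0
   says that the trace-free Ricci tensor vanishes, and, for the Levi-Civita
   connection, q = 0 says that the Weyl tensor is anti-self-dual.  As q depends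
   only on the conformal structure, it may be computed with either connection.
   The Einstein-Weyl equations are stated in arbitrary coframes, so one also needs
   that null cotetrads exist locally and that the equations are tensorial.  Part
   (b) is part (a) after exchanging M and P, which reverses the orientation. *)

(** * Exterior algebra *)

(** Wedging with L and F restricts a 2-form to the self-dual null plane spanned by zm - k and zn -
    p, on which both forms vanish; [sd_part z] is minus the value on these two vectors. Counting
    components explains the equivalences: q' is quadratic in each of z and z', and its nine
    coefficients match a trace-free symmetric tensor; q is a quartic in z, and its five coefficients
    match the self-dual half of the Weyl tensor. A change of A moves e_z only by multiples of L and
    F, which is why q does not see the connection.

    The threefold products in the displayed conditions give the fourfold ones of the ideal by plain
    algebra. The way back leads through curvature: L, F, E, E', P, K are independent, so the
    fourfold conditions already force q = q' = 0.

    The metric alone fixes the volume M /\ P /\ N /\ K of a cotetrad only up to sign. The sign is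
    arranged at one point by exchanging M and P, and it persists nearby by continuity. *)

Lemma eq_oppr0 (F : numFieldType) (U : lmodType F) (u : U) : u = - u -> u = 0.
Proof.
by move/eqP; rewrite -addr_eq0 -mulr2n -scaler_nat scaler_eq0 pnatr_eq0 => /eqP.
Qed.

Section ExteriorAlgebra.
Variables (R : realType) (n : nat).
Implicit Types (u v w : ext R n) (a b : 'rV[R[i]]_n) (S T U : {set 'I_n}).

Lemma inversions_setU S T U : [disjoint S & T] ->
  inversions (S :|: T) U = (inversions S U + inversions T U)%N.
Proof.
move=> dST; rewrite /inversions -cardsUI.
rewrite [X in (_ = _ + X)%N](_ : _ = 0%N) ?addn0.
  apply: eq_card => -[i j]; rewrite !inE /=.
  by case: (i \in S); case: (i \in T) => //=; rewrite ?orbF ?orbb.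
apply/eqP; rewrite cards_eq0; apply/eqP/setP => -[i j]; rewrite !inE /=.
case: (boolP (i \in S)) => //= iS; rewrite (disjointFr dST iS).
by rewrite andbF.
Qed.

Lemma inversions_setUr S T U : [disjoint T & U] ->
  inversions S (T :|: U) = (inversions S T + inversions S U)%N.
Proof.
move=> dTU; rewrite /inversions -cardsUI.
rewrite [X in (_ = _ + X)%N](_ : _ = 0%N) ?addn0.
  apply: eq_card => -[i j]; rewrite !inE /=.
  by case: (i \in S); case: (j \in T); case: (j \in U) => //=; rewrite ?orbF ?orbb.
apply/eqP; rewrite cards_eq0; apply/eqP/setP => -[i j]; rewrite !inE /=.
case: (boolP (j \in T)) => //= jT; last by rewrite !andbF.
by rewrite (disjointFr dTU jT) !andbF.
Qed.

(** Both sides are sums over chains U, T, S of nested sets. Writing T as the union of U and a set V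
    disjoint from U matches them term by term, and the signs agree because inversions are additive
    over disjoint unions in either argument. *)
Lemma wedge_assoc u v w : u ∧ v ∧ w = u ∧ (v ∧ w).
Proof.
apply/ffunP => S; rewrite !ffunE.
transitivity (\sum_(T : {set 'I_n} | T \subset S) \sum_(U : {set 'I_n} | U \subset T)
   (-1) ^+ (inversions T (S :\: T) + inversions U (T :\: U)) *
     u U * v (T :\: U) * w (S :\: T)).
  apply: eq_bigr => T TS; rewrite ffunE mulr_sumr mulr_suml.
  by apply: eq_bigr => U UT; rewrite exprD !mulrA.
rewrite (exchange_big_dep [pred U : {set 'I_n} | U \subset S]) /=; last first.
  by move=> T U TS UT; apply: fintype.subset_trans TS.
apply: eq_bigr => U US; rewrite ffunE mulr_sumr.
rewrite (reindex_onto (fun V => U :|: V) (fun T => T :\: U)) /=; last first.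
  move=> T /andP [_ UT]; rewrite -[RHS](finset.setID T U) finset.setIC.
  by rewrite (finset.setIidPl UT).
have dUE (V : {set 'I_n}) : ((U :|: V) :\: U == V) = [disjoint U & V].
  rewrite finset.setDUl finset.setDv finset.set0U disjoint_sym.
  by apply/eqP/idP => /finset.setDidPl.
apply: eq_big => [V|V].
  rewrite dUE finset.subUset finset.subsetUl US andbT /= finset.subsetD.
  by rewrite disjoint_sym.
move=> /andP [/andP [UVS _] UVE]; have dUV := UVE; rewrite dUE in dUV.
rewrite (eqP UVE) -finset.setDDl.
have VS : V \subset S :\: U.
  rewrite finset.subsetD disjoint_sym dUV andbT.
  by apply: fintype.subset_trans UVS; apply: finset.subsetUr.
have -> : inversions U (S :\: U) =
    (inversions U V + inversions U ((S :\: U) :\: V))%N.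
  rewrite -inversions_setUr.
    by rewrite -[in LHS](finset.setID (S :\: U) V) finset.setIC (finset.setIidPl VS).
  by rewrite disjoint_sym finset.disjoints_subset finset.subDset finset.setUCr finset.subsetT.
rewrite inversions_setU // !exprD; ring.
Qed.

Lemma wedge_ext1 u : u ∧ ext1 R n = u.
Proof.
apply/ffunP => S; rewrite !ffunE (bigD1 S) //= big1.
  rewrite ffunE finset.setDv eqxx mulr1 addr0.
  suff -> : inversions S finset.set0 = 0%N by rewrite expr0 !mul1r.
  apply/eqP; rewrite cards_eq0; apply/eqP/setP => -[i j].
  by rewrite !inE /= andbF.
move=> T /andP [TS /negbTE T0]; rewrite ffunE finset.setD_eq0.
suff -> : (S \subset T) = false by rewrite mulr0.
by apply: contraFF T0 => ST; rewrite finset.eqEsubset TS.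
Qed.

Lemma wedgeDl u v w : (u + v) ∧ w = u ∧ w + v ∧ w.
Proof.
apply/ffunP => S; rewrite !ffunE -big_split; apply: eq_bigr => T _ /=.
by rewrite ffunE mulrDr mulrDl.
Qed.

Lemma wedgeDr u v w : u ∧ (v + w) = u ∧ v + u ∧ w.
Proof.
apply/ffunP => S; rewrite !ffunE -big_split; apply: eq_bigr => T _ /=.
by rewrite ffunE mulrDr.
Qed.

Lemma wedgeZl c u w : (c *: u) ∧ w = c *: (u ∧ w).
Proof.
apply/ffunP => S; rewrite !ffunE scaler_sumr; apply: eq_bigr => T _ /=.
by rewrite ffunE /GRing.scale /=; ring.
Qed.

Lemma wedgeZr c u w : u ∧ (c *: w) = c *: (u ∧ w).
Proof.
apply/ffunP => S; rewrite !ffunE scaler_sumr; apply: eq_bigr => T _ /=.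
by rewrite ffunE /GRing.scale /=; ring.
Qed.

Lemma wedge0l u : 0 ∧ u = 0.
Proof. by rewrite -(scale0r u) wedgeZl !scale0r. Qed.

Lemma wedge0r u : u ∧ 0 = 0.
Proof. by rewrite -(scale0r u) wedgeZr !scale0r. Qed.

Lemma wedgeNl u v : (- u) ∧ v = - (u ∧ v).
Proof. by rewrite -scaleN1r wedgeZl scaleN1r. Qed.

Lemma wedgeNr u v : u ∧ (- v) = - (u ∧ v).
Proof. by rewrite -scaleN1r wedgeZr scaleN1r. Qed.

Lemma wedge_suml I (r : seq I) (P : pred I) (F : I -> ext R n) u :
  (\sum_(i <- r | P i) F i) ∧ u = \sum_(i <- r | P i) (F i ∧ u).
Proof.
by apply: (big_morph (fun v => v ∧ u)) => [v w|]; rewrite ?wedgeDl ?wedge0l.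
Qed.

Lemma wedge_sumr I (r : seq I) (P : pred I) (F : I -> ext R n) u :
  u ∧ (\sum_(i <- r | P i) F i) = \sum_(i <- r | P i) (u ∧ F i).
Proof.
by apply: (big_morph (fun v => u ∧ v)) => [v w|]; rewrite ?wedgeDr ?wedge0r.
Qed.

Lemma covD a b : cov (a + b) = cov a + cov b.
Proof.
apply/ffunP => S; rewrite !ffunE -big_split.
by apply: eq_bigr => k _; rewrite mxE.
Qed.

Lemma covZ c a : cov (c *: a) = c *: cov a.
Proof.
apply/ffunP => S; rewrite !ffunE scaler_sumr.
by apply: eq_bigr => k _; rewrite mxE.
Qed.

Lemma cov0 : cov 0 = 0 :> ext R n.
Proof. by rewrite -(scale0r 0) covZ !scale0r. Qed.

Lemma covN a : cov (- a) = - cov a.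
Proof. by rewrite -scaleN1r covZ scaleN1r. Qed.

Lemma covB a b : cov (a - b) = cov a - cov b.
Proof. by rewrite covD covN. Qed.

Lemma cov_sum I (r : seq I) (P : pred I) (F : I -> 'rV[R[i]]_n) :
  cov (\sum_(i <- r | P i) F i) = \sum_(i <- r | P i) cov (F i).
Proof. by apply: (big_morph (@cov R n)) => [v w|]; rewrite ?covD ?cov0. Qed.

(** Exponent of the sign that moves dx_k from the front to its place in dx_S. *)
Definition before (k : 'I_n) S : nat := #|[set j in S | (j < k)%N]%SET|.

Lemma inversions1 (k : 'I_n) S : inversions [set k]%SET S = before k S.
Proof.
rewrite /inversions /before -[RHS](card_imset _ (f := fun j => (k, j))).
  apply: eq_card => -[i j]; rewrite !inE /=; apply/and3P/imsetP.
    by move=> [/eqP -> jS jk]; exists j => //; rewrite inE jS.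
  by case=> j'; rewrite inE => /andP [jS jk] [-> ->].
by move=> j j' [].
Qed.

Lemma before_setD1 (k : 'I_n) S : before k (S :\ k)%SET = before k S.
Proof.
by apply: eq_card => j; rewrite !inE; case: eqP => //= ->; rewrite ltnn andbF.
Qed.

Lemma cov_wedgeE a w S : (cov a ∧ w) S =
  \sum_(k in S) (-1) ^+ before k S * a 0 k * w (S :\ k)%SET.
Proof.
rewrite ffunE.
under eq_bigr => T TS do rewrite ffunE mulr_sumr mulr_suml.
rewrite (exchange_big_dep xpredT) //= [RHS]big_mkcond /=.
apply: eq_bigr => k _; case: (boolP (k \in S)) => kS.
  rewrite (bigD1 [set k]%SET) /=; last by rewrite eqxx finset.sub1set kS.
  rewrite big1 ?addr0; last by move=> T /andP [/andP [_ ->]].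
  by rewrite inversions1 before_setD1.
rewrite big1 // => T /andP [TS /eqP TE]; move: TS.
by rewrite TE finset.sub1set (negPf kS).
Qed.

(** Interior product with the vector e. It extracts coefficients of wedge products relative to any
    frame, without a change of coordinates. *)
Definition iota_v (e : 'rV[R[i]]_n) w : ext R n :=
  [ffun S : {set 'I_n} =>
     \sum_(k | k \notin S) (-1) ^+ before k S * e 0 k * w (k |: S)%SET].

Lemma before_setU1 (k l : 'I_n) S : l \notin S ->
  before k (l |: S)%SET = ((l < k) + before k S)%N.
Proof.
move=> lS; rewrite /before.
rewrite (_ : [set j in l |: S | (j < k)%N] = if (l < k)%N then l |: [set j in S | (j < k)%N] else [set j in S | (j < k)%N])%SET.
  by case: ifP => lk //; rewrite cardsU1 !inE (negPf lS).
apply/setP => j; rewrite !inE; case: ifP => lk; rewrite !inE.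
  by case: eqP => //= ->.
by case: eqP => //= ->; rewrite lk (negPf lS).
Qed.

(** The interior product is an antiderivation. In the double sums over an inserted index k and a
    removed index l, the diagonal terms over S and over its complement together make up the full
    pairing of a and e; the terms with k different from l occur on both sides with opposite
    signs. *)
Lemma iota_v_cov e a w :
  iota_v e (cov a ∧ w) = (\sum_k a 0 k * e 0 k) *: w - cov a ∧ iota_v e w.
Proof.
have sq m : (-1) ^+ m * (-1) ^+ m = 1 :> R[i] by rewrite -expr2 sqrr_sign.
apply/ffunP => S.
rewrite [LHS]ffunE [RHS]ffunE [X in X + _]ffunE [X in _ + X]ffunE cov_wedgeE.
have -> : \sum_(k in S) (-1) ^+ before k S * a 0 k * iota_v e w (S :\ k)%SET =
    \sum_(k in S) a 0 k * e 0 k * w S + \sum_(l in S) \sum_(k | k \notin S)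
      (-1) ^+ (before l S + before k (S :\ l)%SET) * a 0 l * e 0 k
        * w (k |: (S :\ l))%SET.
  rewrite -big_split; apply: eq_bigr => l lS /=.
  rewrite ffunE (bigD1 l) ?inE ?eqxx //= before_setD1 finset.setD1K // mulrDr.
  congr (_ + _).
    by rewrite -[RHS]mul1r -[X in _ = X * _](sq (before l S)); ring.
  rewrite mulr_sumr; apply: eq_big => [k|k _]; last by rewrite exprD; ring.
  by rewrite !inE negb_and negbK; case: (eqVneq k l) => [->|]; rewrite ?lS // andbT.
have -> : \sum_(k | k \notin S) (-1) ^+ before k S * e 0 k * (cov a ∧ w) (k |: S)%SET =
    \sum_(k | k \notin S) a 0 k * e 0 k * w S + \sum_(l in S) \sum_(k | k \notin S)
      (-1) ^+ (before k S + before l (k |: S)%SET) * a 0 l * e 0 k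
        * w ((k |: S) :\ l)%SET.
  rewrite exchange_big -big_split; apply: eq_bigr => k kS /=.
  rewrite cov_wedgeE big_setU1 //= mulrDr finset.setU1K //; congr (_ + _).
    rewrite before_setU1 // ltnn add0n.
    by rewrite -[RHS]mul1r -[X in _ = X * _](sq (before k S)); ring.
  by rewrite mulr_sumr; apply: eq_bigr => l _; rewrite exprD; ring.
rewrite opprD addrA; congr (_ + _).
  rewrite [X in _ = X *: _ - _](bigID (mem S)) /= {1}/GRing.scale /=.
  rewrite mulrDl addrAC !mulr_suml subrr add0r.
  by apply: eq_bigr.
rewrite -sumrN; apply: eq_bigr => l lS; rewrite -sumrN; apply: eq_bigr => k kS.
have kl : k != l by apply: contraNneq kS => ->.
have -> : ((k |: S) :\ l = k |: (S :\ l))%SET.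
  by apply/setP => j; rewrite !inE; case: (eqVneq j k) => [->|]//=; rewrite kl.
(* Inserting k shifts the position of l by (k < l), removing l shifts that of k by (l < k); exactly
   one of these is 1, hence the relative sign. *)
rewrite before_setU1 // -!mulNr; congr (_ * _ * _ * _).
have -> : before k S = ((l < k) + before k (S :\ l)%SET)%N.
  by rewrite -before_setU1 ?inE ?eqxx // finset.setD1K.
rewrite !exprD; move: kl; rewrite -(inj_eq val_inj) neq_ltn.
by case: ltngtP => // _ _; rewrite ?expr0 ?expr1; ring.
Qed.

Lemma iota_v0 e : iota_v e 0 = 0.
Proof. by apply/ffunP => S; rewrite !ffunE big1 // => k _; rewrite ffunE mulr0. Qed.

Lemma iota_vZ e c w : iota_v e (c *: w) = c *: iota_v e w.
Proof.
apply/ffunP => S; rewrite !ffunE scaler_sumr; apply: eq_bigr => k _.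
by rewrite ffunE /GRing.scale /=; ring.
Qed.

Lemma cov_wedge_covE a b S : (cov a ∧ cov b) S =
  \sum_k \sum_(l | (k != l) && (S == [set k; l]%SET))
     (-1) ^+ (l < k)%N * (a 0 k * b 0 l).
Proof.
rewrite cov_wedgeE big_mkcond /=; apply: eq_bigr => k _.
have SE l : (k != l) && (S == [set k; l]%SET) =
    (k \in S) && (S :\ k == [set l])%SET.
  apply/andP/andP => [[kl /eqP ->]|[kS /eqP Sl]].
    rewrite finset.set21 finset.setU1K ?inE //; by rewrite eq_sym in kl; rewrite eq_sym.
  have : l \in (S :\ k)%SET by rewrite Sl finset.set11.
  rewrite !inE eq_sym => /andP [-> _]; split => //.
  by rewrite -Sl finset.setD1K.
under [RHS]eq_bigl => l do rewrite SE.
case: ifP => kS /=; last by rewrite big_pred0_eq.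
rewrite ffunE mulr_sumr; apply: eq_bigr => l /eqP Sl.
rewrite -before_setD1 Sl /before mulrA; congr ((-1) ^+ _ * _ * _).
case: (boolP (l < k)%N) => lk /=.
  apply/eqP/cards1P; exists l; apply/setP => j; rewrite !inE.
  by case: eqP => // ->; rewrite lk.
apply/eqP; rewrite cards_eq0; apply/eqP/setP => j; rewrite !inE.
by case: eqP => // ->; rewrite (negPf lk).
Qed.

Lemma cov_wedge_anti a b : cov a ∧ cov b = - (cov b ∧ cov a).
Proof.
apply/ffunP => S; rewrite [RHS]ffunE !cov_wedge_covE -sumrN.
under [RHS]eq_bigr => k _ do rewrite -sumrN.
rewrite [RHS](exchange_big_dep xpredT) //=; apply: eq_bigr => k _.
apply: eq_big => [l|l /andP [kl _]]; first by rewrite eq_sym finset.setUC.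
move: kl; rewrite -(inj_eq val_inj) neq_ltn.
by case: ltngtP => // _ _; rewrite ?expr0 ?expr1; ring.
Qed.

Lemma cov_wedge_cov a : cov a ∧ cov a = 0.
Proof. exact: eq_oppr0 (cov_wedge_anti a a). Qed.

Lemma eval2D u v (e f : 'rV[R[i]]_n) :
  eval2 (u + v) e f = eval2 u e f + eval2 v e f.
Proof.
rewrite /eval2 -big_split; apply: eq_bigr => k _ /=.
by rewrite -big_split; apply: eq_bigr => l _ /=; rewrite ffunE mulrDl.
Qed.

Lemma eval2Z c u (e f : 'rV[R[i]]_n) : eval2 (c *: u) e f = c * eval2 u e f.
Proof.
rewrite /eval2 mulr_sumr; apply: eq_bigr => k _.
by rewrite mulr_sumr; apply: eq_bigr => l _; rewrite ffunE mulrA.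
Qed.

Lemma eval2_sum I (r : seq I) (P : pred I) (F : I -> ext R n) (e f : 'rV[R[i]]_n) :
  eval2 (\sum_(i <- r | P i) F i) e f = \sum_(i <- r | P i) eval2 (F i) e f.
Proof.
apply: (big_morph (fun w => eval2 w e f)) => [u v|]; rewrite ?eval2D //.
by rewrite -(scale0r 0) eval2Z mul0r.
Qed.

Lemma eval2_anti u (e f : 'rV[R[i]]_n) : eval2 u e f = - eval2 u f e.
Proof.
rewrite /eval2 -sumrN; apply: eq_bigr => k _; rewrite -sumrN.
by apply: eq_bigr => l _; ring.
Qed.

Definition pairing a (e : 'rV[R[i]]_n) : R[i] := \sum_k a 0 k * e 0 k.

(** The right side is a sum over all pairs of indices, [eval2] one over increasing pairs: the
    diagonal cancels and decreasing pairs are folded onto increasing ones. *)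
Lemma eval2_cov a b (e f : 'rV[R[i]]_n) : eval2 (cov a ∧ cov b) e f =
  pairing a e * pairing b f - pairing a f * pairing b e.
Proof.
have coef (k l : 'I_n) : (k < l)%N ->
    (cov a ∧ cov b) [set k; l]%SET = a 0 k * b 0 l - a 0 l * b 0 k.
  move=> kl; have nkl : k != l by rewrite -(inj_eq val_inj) neq_ltn kl.
  have kE : ([set k; l] :\ k = [set l])%SET by rewrite finset.setU1K // inE.
  have lE : ([set k; l] :\ l = [set k])%SET.
    by rewrite finset.setUC finset.setU1K // inE eq_sym.
  have covE c (j : 'I_n) : cov c [set j]%SET = c 0 j.
    rewrite ffunE (big_pred1 j) // => i; apply/eqP/eqP => [/finset.set1_inj //|->//].
  rewrite cov_wedgeE big_setU1 ?inE //= big_set1 -(before_setD1 k) -(before_setD1 l).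
  rewrite kE lE !covE.
  have -> : before k [set l]%SET = 0%N.
    apply/eqP; rewrite cards_eq0; apply/eqP/setP => j; rewrite !inE.
    by case: eqP => // ->; rewrite ltnNge (ltnW kl).
  have -> : before l [set k]%SET = 1%N.
    apply/eqP/cards1P; exists k; apply/setP => j; rewrite !inE.
    by case: eqP => // ->.
  by rewrite expr0 expr1; ring.
pose F k l := a 0 k * b 0 l * (e 0 k * f 0 l - e 0 l * f 0 k).
have -> : pairing a e * pairing b f - pairing a f * pairing b e =
    \sum_k \sum_l F k l.
  rewrite /pairing !mulr_suml -sumrB; apply: eq_bigr => k _.
  rewrite !mulr_sumr -sumrB; apply: eq_bigr => l _; rewrite /F; ring.
rewrite pair_big /= (bigID (fun p : 'I_n * 'I_n => (p.1 < p.2)%N)) /=.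
rewrite [X in _ + X](bigID (fun p : 'I_n * 'I_n => p.1 == p.2)) /=.
rewrite [X in _ + (X + _)]big1 ?add0r; last first.
  by move=> [k l] /= /andP [_ /eqP ->]; rewrite /F; ring.
rewrite [X in _ + X](reindex_inj (h := fun p : 'I_n * 'I_n => (p.2, p.1))) /=; last first.
  by move=> [? ?] [? ?] [-> ->].
rewrite (eq_bigl (fun p : 'I_n * 'I_n => (p.1 < p.2)%N) (fun p => F p.2 p.1)); last first.
  by move=> [k l] /=; rewrite -leqNgt -(inj_eq val_inj) /= eq_sym ltn_neqAle andbC.
rewrite -big_split /= /eval2 pair_big_dep /=; apply: eq_bigr => -[k l] /= kl.
by rewrite coef // /F; ring.
Qed.

End ExteriorAlgebra.

(** * Smooth functions and exterior derivative *)

Section RealCalculus.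
Variables (R : realType) (n : nat).
Implicit Types (V : set 'rV[R]_n) (f g : 'rV[R]_n -> R) (x : 'rV[R]_n).

Lemma partial_eq V f g k x : open V -> V x -> (forall y, V y -> f y = g y) ->
  partial k f x = partial k g x.
Proof.
move=> oV Vx fg; apply: near_eq_derive.
by apply: filterS (open_nbhs_nbhs (conj oV Vx)) => y /fg.
Qed.

Lemma class_CS r V U f : (U `<=` V)%classic -> class_C r V f -> class_C r U f.
Proof.
elim: r f => [|r IH] f UV /= [cf df]; split => //; try by move=> x /UV /cf.
by move=> k; have [d1 d2] := df k; split; [move=> x /UV /d1|exact: IH].
Qed.

Lemma continuous_eq_in V f g x : open V -> V x -> (forall y, V y -> f y = g y) ->
  {for x, continuous f} -> {for x, continuous g}.
Proof.
move=> oV Vx fg; rewrite /prop_for /continuous_at => cf.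
have nfg : \forall y \near x, f y = g y.
  by apply: filterS (open_nbhs_nbhs (conj oV Vx)) => y /fg.
rewrite -(fg x Vx); exact: cvg_trans (near_eq_cvg nfg) cf.
Qed.

Lemma class_C_eq r V f g : open V -> (forall y, V y -> f y = g y) ->
  class_C r V f -> class_C r V g.
Proof.
move=> oV; elim: r f g => [|r IH] f g fg /= [cf df]; split => //.
- by move=> x Vx; apply: continuous_eq_in Vx fg (cf x Vx).
- by move=> x Vx; apply: continuous_eq_in Vx fg (cf x Vx).
- move=> k; have [d1 d2] := df k; split.
    move=> x Vx; apply: near_eq_derivable (d1 x Vx).
    by apply: filterS (open_nbhs_nbhs (conj oV Vx)) => y /fg.
  by apply: IH d2 => y Vy; apply: partial_eq Vy fg.
Qed.

Lemma class_CW r V f : class_C r.+1 V f -> class_C r V f.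
Proof.
elim: r f => [|r IH] f [cf df]; split => // k.
by have [d1 d2] := df k; split => //; apply: IH.
Qed.

Lemma class_C_continuous r V f x : class_C r V f -> V x -> {for x, continuous f}.
Proof. by case: r => [|r] [cf _] /cf. Qed.

Lemma partial_cst k (c : R) x : partial k (cst c) x = 0.
Proof. exact: derive_cst. Qed.

Lemma class_C_cst r V (c : R) : class_C r V (cst c).
Proof.
elim: r c => [|r IH] c; split => //; try by move=> x _; apply: cst_continuous.
move=> k; split; first by move=> x _; exact: derivable_cst.
by rewrite (_ : partial k (cst c) = cst 0) //; apply/funext => x; rewrite partial_cst.
Qed.

Lemma partialD k f g x : derivable f x (delta_mx 0 k) ->
  derivable g x (delta_mx 0 k) ->
  partial k (fun y => f y + g y) x = partial k f x + partial k g x.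
Proof. exact: deriveD. Qed.

Lemma partialM k f g x : derivable f x (delta_mx 0 k) ->
  derivable g x (delta_mx 0 k) ->
  partial k (fun y => f y * g y) x = f x * partial k g x + g x * partial k f x.
Proof. exact: deriveM. Qed.

Lemma class_CD r V f g : open V -> class_C r V f -> class_C r V g ->
  class_C r V (fun y => f y + g y).
Proof.
move=> oV; elim: r f g => [|r IH] f g [cf df] [cg dg]; split => //;
  try by move=> x Vx; exact: (cvgD (cf x Vx) (cg x Vx)).
move=> k; have [d1 d2] := df k; have [e1 e2] := dg k; split.
  by move=> x Vx; apply: derivableD; [exact: d1|exact: e1].
apply: class_C_eq (IH _ _ d2 e2) => // x Vx.
by rewrite partialD //; [exact: d1|exact: e1].
Qed.

Lemma class_CM r V f g : open V -> class_C r V f -> class_C r V g ->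
  class_C r V (fun y => f y * g y).
Proof.
move=> oV; elim: r f g => [|r IH] f g Cf Cg; split => //;
  try by move=> x Vx; exact: (cvgM (class_C_continuous Cf Vx) (class_C_continuous Cg Vx)).
move=> k; have [_ /(_ k) [d1 d2]] := Cf; have [_ /(_ k) [e1 e2]] := Cg; split.
  by move=> x Vx; apply: derivableM; [exact: d1|exact: e1].
apply: (@class_C_eq _ _ (fun x => f x * partial k g x + g x * partial k f x)) => //.
  by move=> x Vx; rewrite partialM //; [exact: d1|exact: e1].
by apply: class_CD => //; apply: IH => //; apply: class_CW.
Qed.

(** The derivative of 1/f contains 1/f again, but only to one order less, so induction on the order
    applies. *)
Lemma class_CV r V f : open V -> (forall x, V x -> f x != 0) ->
  class_C r V f -> class_C r V (fun y => (f y)^-1).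
Proof.
move=> oV f0; elim: r => [|r IH] Cf; split => //;
  try by move=> x Vx; exact: (cvgV (f0 x Vx) (class_C_continuous Cf Vx)).
move=> k; have [_ /(_ k) [d1 d2]] := Cf; split.
  by move=> x Vx; apply: derivableV; [exact: f0|exact: d1].
apply: (@class_C_eq _ _ (fun x => -1 * ((f x)^-1 * (f x)^-1) * partial k f x)) => //.
  move=> x Vx; rewrite /partial deriveV; [|exact: f0|exact: d1].
  by rewrite /GRing.scale /= expr2 invfM mulN1r.
have If := IH (class_CW Cf).
by do ?apply: class_CM => //; exact: class_C_cst.
Qed.

(** Restriction to the line through x in direction k reduces this to the chain rule in one variable;
    f x > 0 avoids the singular point of the root. *)
Lemma is_partial_sqrt k f x : 0 < f x -> derivable f x (delta_mx 0 k) ->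
  is_derive x (delta_mx 0 k) (fun y => Num.sqrt (f y))
    ((2 * Num.sqrt (f x))^-1 * partial k f x).
Proof.
move=> f0 df; pose v : 'rV[R]_n := delta_mx 0 k.
pose h (t : R) := f (t *: v + x).
have h0 : h 0 = f x by rewrite /h scale0r add0r.
have dh : is_derive (0 : R) 1 h (partial k f x).
  apply: DeriveDef; first exact: (proj1 (derivable1P f x v)) df.
  rewrite /partial /derive.
  by under eq_fun => t do rewrite /= h0 addr0 /h [t%:A]mulr1.
have ds := is_derive1_sqrt f0; rewrite -h0 in ds *.
have [dc dE] := is_derive1_comp ds dh.
apply: DeriveDef.
  by apply/(derivable1P (fun y => Num.sqrt (f y)) x v).
rewrite -dE /derive.
by under [in RHS]eq_fun => t do rewrite /= h0 addr0 /h [t%:A]mulr1.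
Qed.

Lemma class_C_sqrt r V f : open V -> (forall x, V x -> 0 < f x) ->
  class_C r V f -> class_C r V (fun y => Num.sqrt (f y)).
Proof.
move=> oV f0; elim: r => [|r IH] Cf; split => //;
  try by move=> x Vx; exact: continuous_comp (class_C_continuous Cf Vx) (@sqrt_continuous R (f x)).
move=> k; have [_ /(_ k) [d1 d2]] := Cf; split.
  by move=> x Vx; have [] := is_partial_sqrt (f0 x Vx) (d1 x Vx).
apply: (@class_C_eq _ _ (fun x => (2 * Num.sqrt (f x))^-1 * partial k f x)) => //.
  by move=> x Vx; have [_ <-] := is_partial_sqrt (f0 x Vx) (d1 x Vx).
apply: class_CM => //; apply: class_CV => //.
  by move=> x Vx; rewrite mulf_neq0 // gt_eqF // sqrtr_gt0 f0.
by apply: class_CM; [|exact: class_C_cst|exact: IH (class_CW Cf)].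
Qed.

End RealCalculus.

(** * Symmetry of second partial derivatives *)

Section Clairaut.
Variables (R : realType) (n : nat).
Implicit Types (V : set 'rV[R]_n) (f g : 'rV[R]_n -> R) (x : 'rV[R]_n).

Lemma is_derive_line f x (v : 'rV[R]_n) (t : R) : derivable f (t *: v + x) v ->
  is_derive t 1 (fun s => f (s *: v + x)) ('D_v f (t *: v + x)).
Proof.
move=> df.
have E : (fun h : R => h^-1 *: (((fun s => f (s *: v + x)) \o shift t) (h *: 1)
      - f (t *: v + x))) =
    (fun h : R => h^-1 *: ((f \o shift (t *: v + x)) (h *: v) - f (t *: v + x))).
  by apply/funext => h; rewrite /= [h%:A]mulr1 scalerDl addrA.
by apply: DeriveDef; [rewrite /derivable E|rewrite /derive E].
Qed.

Lemma mvt_line f x (v : 'rV[R]_n) (h : R) : 0 < h ->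
  (forall t, 0 <= t <= h -> derivable f (t *: v + x) v) ->
  exists2 t, 0 <= t <= h & f (h *: v + x) - f x = h * 'D_v f (t *: v + x).
Proof.
move=> h0 df; pose F (s : R) := f (s *: v + x).
have dF t : 0 <= t <= h -> is_derive t 1 F ('D_v f (t *: v + x)).
  by move=> /df /is_derive_line.
have [||t th E] := @MVT R F (fun t => 'D_v f (t *: v + x)) 0 h h0.
- by move=> t; rewrite in_itv /= => /andP [t0 th]; apply: dF; rewrite !ltW.
- apply: derivable_within_continuous => t; rewrite in_itv /= => th.
  by have [] := dF t th.
exists t; first by move: th; rewrite in_itv /= => /andP [t0 th]; rewrite !ltW.
by move: E; rewrite /F scale0r add0r subr0 mulrC => ->; rewrite mulrC.
Qed.

(** Mean value theorem twice: along e_k for the increment of f in direction e_l, then along e_l for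
    the k-th partial derivative. *)
Lemma second_difference V f k l x (h : R) : class_C 2 V f -> 0 < h ->
  (forall s t, 0 <= s <= h -> 0 <= t <= h ->
     V (s *: delta_mx 0 k + (t *: delta_mx 0 l + x))) ->
  exists s t, [/\ 0 <= s <= h, 0 <= t <= h &
    f (h *: delta_mx 0 k + (h *: delta_mx 0 l + x)) - f (h *: delta_mx 0 k + x)
      - f (h *: delta_mx 0 l + x) + f x =
    h * (h * partial l (partial k f) (s *: delta_mx 0 k + (t *: delta_mx 0 l + x)))].
Proof.
move=> [_ /(_ k) [dkf [_ /(_ l) [dlkf _]]]] h0 Vst.
have h0h : 0 <= h <= h by rewrite lexx ltW.
have h00 : 0 <= (0 : R) <= h by rewrite lexx ltW.
set ek := delta_mx 0 k; set el := delta_mx 0 l.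
have dsh t (s : R) : 0 <= s <= h -> 0 <= t <= h -> is_derive (s *: ek + x) ek
    (fun y => f (t *: el + y)) (partial k f (t *: el + (s *: ek + x))).
  move=> sh th; have Vy := Vst _ _ sh th.
  have E : (fun r : R => r^-1 *: (((fun y => f (t *: el + y)) \o shift (s *: ek + x)) (r *: ek)
      - f (t *: el + (s *: ek + x)))) =
    (fun r : R => r^-1 *: ((f \o shift (t *: el + (s *: ek + x))) (r *: ek)
      - f (t *: el + (s *: ek + x)))).
    by apply/funext => r; rewrite /= addrCA.
  have d : derivable f (t *: el + (s *: ek + x)) ek by rewrite addrCA; apply: dkf.
  by apply: DeriveDef; [rewrite /derivable E|rewrite /partial /derive E].
pose F y := f (h *: el + y) - f y.
have dF s : 0 <= s <= h -> is_derive (s *: ek + x) ek F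
    (partial k f (h *: el + (s *: ek + x)) - partial k f (s *: ek + x)).
  move=> sh; apply: is_deriveB; first exact: dsh.
  have [d dE] := dsh _ _ sh h00; apply: DeriveDef.
    by have := d; under eq_fun do rewrite scale0r add0r.
  by move: dE; under eq_fun do rewrite scale0r add0r; rewrite scale0r add0r.
have [|s sh E] := @mvt_line F x ek h h0; first by move=> s /dF [].
have [dFs dFE] := dF s sh; move: E; rewrite dFE => E.
have [|t th E'] := @mvt_line (partial k f) (s *: ek + x) el h h0.
  by move=> t th; rewrite addrCA; apply: dlkf; apply: Vst.
exists s, t; split => //.
move: E; rewrite E' /F => E.
by rewrite (addrCA (h *: ek)) (addrCA (s *: ek)) -/el -E; ring.
Qed.

(** The second difference is symmetric in k and l, so it equates the two mixed derivatives at two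
    points close to x. Continuity carries this to x up to an arbitrary e. *)
Lemma clairaut V f k l x : open V -> V x -> class_C 2 V f ->
  partial l (partial k f) x = partial k (partial l f) x.
Proof.
move=> oV Vx Cf.
have cont k' l' : {for x, continuous (partial l' (partial k' f))}.
  by have [_ /(_ k') [_ [_ /(_ l') [_ [c _]]]]] := Cf; apply: c.
apply/eqP; rewrite -subr_eq0 -normr_le0; apply/ler_addgt0Pl => e e0.
rewrite addr0.
have e20 : 0 < e / 2 by rewrite divr_gt0.
have H1 : \forall y \near x,
    `|partial l (partial k f) x - partial l (partial k f) y| < e / 2.
  by move: (cont k l) => /cvgrPdist_lt /(_ _ e20).
have H2 : \forall y \near x,
    `|partial k (partial l f) x - partial k (partial l f) y| < e / 2.
  by move: (cont l k) => /cvgrPdist_lt /(_ _ e20).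
have [d /= d0 db] : exists2 d : R, 0 < d & forall y, ball x d y -> V y /\
   `|partial l (partial k f) x - partial l (partial k f) y| < e / 2 /\
   `|partial k (partial l f) x - partial k (partial l f) y| < e / 2.
  apply/nbhs_ballP; apply: filterI (filterI H1 H2).
  exact: open_nbhs_nbhs.
clear H1 H2.
pose ek : 'rV[R]_n := delta_mx 0 k; pose el : 'rV[R]_n := delta_mx 0 l.
pose c : R := `|ek : 'rV[R]_n| + `|el : 'rV[R]_n| + 1.
have c0 : 0 < c by rewrite ltr_wpDl // addr_ge0.
(* The parallelogram spanned by h e_k and h e_l at x then lies within distance h c = d/2 of x; the
   summand 1 makes c positive. *)
pose h := d / 2 / c.
have h0 : 0 < h by rewrite !divr_gt0.
have inb s t : 0 <= s <= h -> 0 <= t <= h -> ball x d (s *: ek + (t *: el + x)).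
  move=> /andP [s0 sh] /andP [t0 th]; rewrite -ball_normE /=.
  rewrite addrA opprD addrCA subrr addr0 normrN.
  apply: le_lt_trans (ler_normD _ _) _; rewrite !normrZ !ger0_norm //.
  apply: (@le_lt_trans _ _ (h * (`|ek| + `|el|))).
    by rewrite mulrDr lerD // ler_wpM2r.
  apply: (@lt_le_trans _ _ (h * c)); first by rewrite ltr_pM2l // /c ltrDl.
  by rewrite /h divfK ?lt0r_neq0 //; lra.
have [|s [t [sh th E]]] := @second_difference V f k l x h Cf h0.
  by move=> s t sh th; have [] := db _ (inb _ _ sh th).
have [|t' [s' [th' sh' E']]] := @second_difference V f l k x h Cf h0.
  by move=> s' t' sh' th'; rewrite addrCA; have [] := db _ (inb _ _ th' sh').
have swap (a b : 'rV[R]_n) : a + (b + x) = b + (a + x) by exact: addrCA.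
have EE : partial l (partial k f) (s *: ek + (t *: el + x)) =
    partial k (partial l f) (s' *: ek + (t' *: el + x)).
  apply: (mulfI (lt0r_neq0 h0)); apply: (mulfI (lt0r_neq0 h0)).
  apply: (etrans (esym E)); rewrite -(swap (t' *: el)).
  apply: (etrans _ E'); rewrite (swap (h *: delta_mx 0 k)).
  by congr (_ + _); exact: addrAC.
have [_ [H1 _]] := db _ (inb _ _ sh th).
have [_ [_ H2]] := db _ (inb _ _ sh' th').
rewrite EE in H1; rewrite distrC in H2.
rewrite (splitr e); apply/ltW; apply: le_lt_trans (ltrD H1 H2).
by apply: le_trans (ler_normD _ _); rewrite addrA subrK.
Qed.

End Clairaut.

Section ComplexCalculus.
Variables (R : realType) (n : nat).
Implicit Types (V : set 'rV[R]_n) (f g : 'rV[R]_n -> R[i]) (x : 'rV[R]_n).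

Lemma smooth_derivable V (f : 'rV[R]_n -> R) x k : smooth V f -> V x ->
  derivable f x (delta_mx 0 k).
Proof. by move=> /(_ 1%N) [_ /(_ k) [d _]] /d. Qed.

Lemma smooth_partial V (f : 'rV[R]_n -> R) k : smooth V f -> smooth V (partial k f).
Proof. by move=> sf r; have [_ /(_ k) [_]] := sf r.+1. Qed.

Lemma csmooth_cpartial V f k : csmooth V f -> csmooth V (cpartial k f).
Proof. by move=> [sr si]; split; apply: smooth_partial. Qed.

Lemma csmoothS V U f : (U `<=` V)%classic -> csmooth V f -> csmooth U f.
Proof. by move=> UV [sr si]; split => r; apply: class_CS UV _. Qed.

Lemma csmooth_eq V f g : open V -> (forall y, V y -> f y = g y) ->
  csmooth V f -> csmooth V g.
Proof.
move=> oV fg [sr si]; split => r.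
  by apply: class_C_eq (sr r) => // y /fg ->.
by apply: class_C_eq (si r) => // y /fg ->.
Qed.

Lemma csmooth_cst V (c : R[i]) : csmooth V (fun _ => c).
Proof. by split => r; apply: class_C_cst. Qed.

Lemma ReD (a b : R[i]) : complex.Re (a + b) = complex.Re a + complex.Re b.
Proof. by case: a; case: b. Qed.
Lemma ImD (a b : R[i]) : complex.Im (a + b) = complex.Im a + complex.Im b.
Proof. by case: a; case: b. Qed.
Lemma ReM (a b : R[i]) : complex.Re (a * b) =
  complex.Re a * complex.Re b + -1 * (complex.Im a * complex.Im b).
Proof. by case: a => ? ?; case: b => ? ? /=; rewrite mulN1r. Qed.
Lemma ImM (a b : R[i]) : complex.Im (a * b) =
  complex.Re a * complex.Im b + complex.Im a * complex.Re b.
Proof. by case: a => ? ?; case: b. Qed.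

Lemma csmoothD V f g : open V -> csmooth V f -> csmooth V g ->
  csmooth V (fun y => f y + g y).
Proof.
move=> oV [fr fi] [gr gi]; split => r.
  by under eq_fun do rewrite ReD; apply: class_CD.
by under eq_fun do rewrite ImD; apply: class_CD.
Qed.

Lemma csmoothM V f g : open V -> csmooth V f -> csmooth V g ->
  csmooth V (fun y => f y * g y).
Proof.
move=> oV [fr fi] [gr gi]; split => r.
  under eq_fun do rewrite ReM; apply: class_CD => //; apply: class_CM => //.
    exact: class_C_cst.
  exact: class_CM.
by under eq_fun do rewrite ImM; apply: class_CD => //; apply: class_CM.
Qed.

Lemma csmoothN V f : open V -> csmooth V f -> csmooth V (fun y => - f y).
Proof.
move=> oV sf; under eq_fun do rewrite -mulN1r.
by apply: csmoothM => //; apply: csmooth_cst.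
Qed.

Lemma csmoothB V f g : open V -> csmooth V f -> csmooth V g ->
  csmooth V (fun y => f y - g y).
Proof. by move=> oV sf sg; apply: csmoothD => //; apply: csmoothN. Qed.

Lemma csmooth_sum V I (r : seq I) (P : pred I) (F : I -> 'rV[R]_n -> R[i]) :
  open V -> (forall i, P i -> csmooth V (F i)) ->
  csmooth V (fun y => \sum_(i <- r | P i) F i y).
Proof.
move=> oV sF; elim: r => [|i r IH].
  by under eq_fun do rewrite big_nil; apply: csmooth_cst.
under eq_fun do rewrite big_cons; case: (boolP (P i)) => // Pi.
by apply: csmoothD => //; apply: sF.
Qed.

Lemma csmoothV V f : open V -> (forall x, V x -> f x != 0) -> csmooth V f ->
  csmooth V (fun y => (f y)^-1).
Proof.
move=> oV f0 [fr fi].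
(* 1/f is the conjugate of f divided by [q], the squared modulus. *)
pose q y := complex.Re (f y) * complex.Re (f y) + complex.Im (f y) * complex.Im (f y).
have q0 x : V x -> q x != 0.
  move=> /f0; apply: contraNneq => /eqP; rewrite /q -!expr2 paddr_eq0 ?sqr_ge0 //.
  by rewrite !sqrf_eq0; case: (f x) => a b /= /andP [/eqP -> /eqP ->].
have sq r : class_C r V q by apply: class_CD => //; apply: class_CM.
split => r.
  apply: (@class_C_eq _ _ _ _ (fun y => complex.Re (f y) * (q y)^-1)) => //.
    by move=> y _; rewrite /q -!expr2; case: (f y).
  by apply: class_CM => //; apply: class_CV.
apply: (@class_C_eq _ _ _ _ (fun y => -1 * (complex.Im (f y) * (q y)^-1))) => //.
  by move=> y _; rewrite /q -!expr2 mulN1r; case: (f y).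
by apply: class_CM => //; [exact: class_C_cst|apply: class_CM => //; apply: class_CV].
Qed.

Lemma csmooth_continuous V f x : csmooth V f -> V x ->
  {for x, continuous (fun y => complex.Re (f y))} /\
  {for x, continuous (fun y => complex.Im (f y))}.
Proof. by move=> [/(_ 0%N) [cr _] /(_ 0%N) [ci _]] Vx; split; [exact: cr|exact: ci]. Qed.

Lemma cpartial_eq V f g k x : open V -> V x -> (forall y, V y -> f y = g y) ->
  cpartial k f x = cpartial k g x.
Proof.
move=> oV Vx fg; rewrite /cpartial.
by congr (_ +i* _); apply: partial_eq oV Vx _ => y /fg ->.
Qed.

Lemma cpartial_cst k (c : R[i]) x : cpartial k (fun _ => c) x = 0.
Proof. by rewrite /cpartial !partial_cst. Qed.

Lemma cpartialD V f g k x : csmooth V f -> csmooth V g -> V x ->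
  cpartial k (fun y => f y + g y) x = cpartial k f x + cpartial k g x.
Proof.
move=> [fr fi] [gr gi] Vx; rewrite /cpartial.
under eq_fun do rewrite ReD; under [X in _ +i* partial k X x]eq_fun do rewrite ImD.
by rewrite !partialD //; apply: smooth_derivable Vx.
Qed.

Lemma cpartialM V f g k x : open V -> csmooth V f -> csmooth V g -> V x ->
  cpartial k (fun y => f y * g y) x = cpartial k f x * g x + f x * cpartial k g x.
Proof.
move=> oV [fr fi] [gr gi] Vx; rewrite /cpartial.
under eq_fun do rewrite ReM; under [X in _ +i* partial k X x]eq_fun do rewrite ImM.
have D1 (h : 'rV[R]_n -> R) : smooth V h -> derivable h x (delta_mx 0 k).
  by move=> sh; apply: smooth_derivable Vx.
have sM (h h' : 'rV[R]_n -> R) : smooth V h -> smooth V h' ->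
    smooth V (fun y => h y * h' y).
  by move=> sh sh' r; apply: class_CM.
rewrite partialD; [|by apply: D1; apply: (sM)|by apply: D1; apply: (sM); [move=> r; exact: class_C_cst|apply: (sM)]].
rewrite partialD; [|by apply: D1; apply: (sM)|by apply: D1; apply: (sM)].
rewrite !(@partialM _ _ _ (fun y => complex.Re (f y))); try by apply: D1.
rewrite !(@partialM _ _ _ (fun y => complex.Im (f y))); try by apply: D1.
rewrite (@partialM _ _ _ (fun=> -1)); [|exact: derivable_cst|by apply: D1; apply: sM].
rewrite partialM; try by apply: D1.
have := partial_cst k (-1 : R) x; rewrite /cst => ->.
case: (f x) => a b; case: (g x) => c d /=; apply/eqP; rewrite eq_complex /=.
by apply/andP; split; apply/eqP; ring.
Qed.

Lemma cpartialZ V f k x (c : R[i]) : open V -> csmooth V f -> V x ->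
  cpartial k (fun y => c * f y) x = c * cpartial k f x.
Proof.
move=> oV sf Vx; rewrite (cpartialM _ oV _ sf Vx); last exact: csmooth_cst.
by rewrite cpartial_cst mul0r add0r.
Qed.

Lemma cpartial_sum V I (r : seq I) (P : pred I) (F : I -> 'rV[R]_n -> R[i]) k x :
  open V -> (forall i, P i -> csmooth V (F i)) -> V x ->
  cpartial k (fun y => \sum_(i <- r | P i) F i y) x =
  \sum_(i <- r | P i) cpartial k (F i) x.
Proof.
move=> oV sF Vx; elim: r => [|i r IH].
  by under eq_fun do rewrite big_nil; rewrite cpartial_cst big_nil.
rewrite big_cons; under eq_fun do rewrite big_cons; case: (boolP (P i)) => // Pi.
by rewrite (cpartialD _ (sF i Pi) _ Vx) ?IH //; apply: csmooth_sum.
Qed.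

Lemma cpartial_comm V f k l x : open V -> V x -> csmooth V f ->
  cpartial l (cpartial k f) x = cpartial k (cpartial l f) x.
Proof.
move=> oV Vx [fr fi]; rewrite /cpartial /=.
by rewrite (clairaut _ _ oV Vx (fr 2%N)) (clairaut _ _ oV Vx (fi 2%N)).
Qed.

End ComplexCalculus.

(** * Exterior derivative of forms with smooth coefficients *)

Section Forms.
Variables (R : realType) (n : nat).
Implicit Types (V : set 'rV[R]_n) (f g : 'rV[R]_n -> R[i]) (x : 'rV[R]_n).
Implicit Types (v w : 'rV[R]_n -> ext R n) (a b : 'rV[R]_n -> 'rV[R[i]]_n).

Definition ext_partial (k : 'I_n) w x : ext R n :=
  [ffun S : {set 'I_n} => cpartial k (fun y => w y S) x].

Definition row_partial (k : 'I_n) a x : 'rV[R[i]]_n :=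
  \row_j cpartial k (fun y => a y 0 j) x.

Definition esmooth V w := forall S : {set 'I_n}, csmooth V (fun y => w y S).

Lemma ext_dE w x : ext_d w x = \sum_(k < n) cov (delta_mx 0 k) ∧ ext_partial k w x.
Proof. by []. Qed.

Lemma esmooth_cov V a : open V -> csmooth_mx V a -> esmooth V (fun y => cov (a y)).
Proof.
by move=> oV sa S; under eq_fun do rewrite ffunE; apply: csmooth_sum.
Qed.

Lemma esmooth_wedge V v w : open V -> esmooth V v -> esmooth V w ->
  esmooth V (fun y => v y ∧ w y).
Proof.
move=> oV sv sw S; under eq_fun do rewrite ffunE; apply: csmooth_sum => // T _.
apply: csmoothM => //; apply: csmoothM => //; exact: csmooth_cst.
Qed.

Lemma esmooth_sum V I (r : seq I) (P : pred I) (F : I -> 'rV[R]_n -> ext R n) :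
  open V -> (forall i, esmooth V (F i)) ->
  esmooth V (fun y => \sum_(i <- r | P i) F i y).
Proof.
move=> oV sF S; under eq_fun do rewrite sum_ffunE.
by apply: csmooth_sum => // i _; apply: sF.
Qed.

Lemma ext_partial_eq V v w k x : open V -> V x -> (forall y, V y -> v y = w y) ->
  ext_partial k v x = ext_partial k w x.
Proof.
move=> oV Vx vw; apply/ffunP => S; rewrite !ffunE.
by apply: cpartial_eq oV Vx _ => y /vw ->.
Qed.

Lemma ext_partialD V v w k x : esmooth V v -> esmooth V w -> V x ->
  ext_partial k (fun y => v y + w y) x = ext_partial k v x + ext_partial k w x.
Proof.
move=> sv sw Vx; apply/ffunP => S; rewrite !ffunE.
by under eq_fun do rewrite ffunE; rewrite (cpartialD _ (sv S) (sw S) Vx).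
Qed.

Lemma ext_partialZ V f w k x : open V -> csmooth V f -> esmooth V w -> V x ->
  ext_partial k (fun y => f y *: w y) x =
  cpartial k f x *: w x + f x *: ext_partial k w x.
Proof.
move=> oV sf sw Vx; apply/ffunP => S; rewrite !ffunE.
by under eq_fun do rewrite ffunE; rewrite (cpartialM _ oV sf (sw S) Vx).
Qed.

Lemma ext_partial_sum V I (r : seq I) (P : pred I)
    (F : I -> 'rV[R]_n -> ext R n) k x :
  open V -> (forall i, esmooth V (F i)) -> V x ->
  ext_partial k (fun y => \sum_(i <- r | P i) F i y) x =
  \sum_(i <- r | P i) ext_partial k (F i) x.
Proof.
move=> oV sF Vx; apply/ffunP => S; rewrite sum_ffunE !ffunE.
under eq_fun do rewrite sum_ffunE.
rewrite (cpartial_sum _ _ oV _ Vx) => [|i _]; last exact: sF.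
by apply: eq_bigr => i _; rewrite ffunE.
Qed.

Lemma ext_partial_wedge V v w k x : open V -> esmooth V v -> esmooth V w -> V x ->
  ext_partial k (fun y => v y ∧ w y) x =
  ext_partial k v x ∧ w x + v x ∧ ext_partial k w x.
Proof.
move=> oV sv sw Vx; apply/ffunP => S; rewrite !ffunE -big_split.
under eq_fun do rewrite ffunE.
have sc T : csmooth V (fun y => (-1) ^+ inversions T (S :\: T) * v y T).
  by apply: csmoothM => //; apply: csmooth_cst.
rewrite (cpartial_sum _ _ oV _ Vx) => [|T _]; last by apply: csmoothM.
apply: eq_bigr => T _ /=.
by rewrite (cpartialM _ oV (sc T) (sw _) Vx) (cpartialZ _ _ oV (sv T) Vx) !ffunE.
Qed.

Lemma ext_partial_cov V a k x : open V -> csmooth_mx V a -> V x ->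
  ext_partial k (fun y => cov (a y)) x = cov (row_partial k a x).
Proof.
move=> oV sa Vx; apply/ffunP => S; rewrite !ffunE.
under eq_fun do rewrite ffunE; rewrite (cpartial_sum _ _ oV _ Vx) // .
by apply: eq_bigr => j _; rewrite mxE.
Qed.

Lemma d_covE V a x : open V -> csmooth_mx V a -> V x ->
  d_cov a x = \sum_(k < n) cov (delta_mx 0 k) ∧ cov (row_partial k a x).
Proof.
by move=> oV sa Vx; apply: eq_bigr => k _; rewrite -(ext_partial_cov _ oV sa Vx).
Qed.

Lemma row_delta_sum (r : 'rV[R[i]]_n) :
  cov r = \sum_(k < n) r 0 k *: cov (delta_mx 0 k).
Proof.
rewrite {1}(row_sum_delta r) cov_sum; by apply: eq_bigr => k _; rewrite covZ.
Qed.

Lemma cov_d_fun f x :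
  cov (d_fun f x) = \sum_(k < n) cpartial k f x *: cov (delta_mx 0 k).
Proof. by rewrite row_delta_sum; apply: eq_bigr => k _; rewrite mxE. Qed.

Lemma d_fun_cst (c : R[i]) x : d_fun (fun _ => c) x = 0.
Proof. by apply/rowP => k; rewrite !mxE cpartial_cst. Qed.

Lemma ext_d_eq V v w x : open V -> V x -> (forall y, V y -> v y = w y) ->
  ext_d v x = ext_d w x.
Proof.
move=> oV Vx vw; rewrite !ext_dE; apply: eq_bigr => k _.
by rewrite (ext_partial_eq k oV Vx vw).
Qed.

Lemma ext_dD V v w x : esmooth V v -> esmooth V w -> V x ->
  ext_d (fun y => v y + w y) x = ext_d v x + ext_d w x.
Proof.
move=> sv sw Vx; rewrite !ext_dE -big_split; apply: eq_bigr => k _ /=.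
by rewrite (ext_partialD _ sv sw Vx) wedgeDr.
Qed.

Lemma ext_d_sum V I (r : seq I) (P : pred I) (F : I -> 'rV[R]_n -> ext R n) x :
  open V -> (forall i, esmooth V (F i)) -> V x ->
  ext_d (fun y => \sum_(i <- r | P i) F i y) x = \sum_(i <- r | P i) ext_d (F i) x.
Proof.
move=> oV sF Vx; rewrite ext_dE.
under eq_bigr do rewrite (ext_partial_sum _ _ _ oV sF Vx) wedge_sumr.
by rewrite exchange_big.
Qed.

Lemma ext_dZ V f w x : open V -> csmooth V f -> esmooth V w -> V x ->
  ext_d (fun y => f y *: w y) x = cov (d_fun f x) ∧ w x + f x *: ext_d w x.
Proof.
move=> oV sf sw Vx; rewrite !ext_dE cov_d_fun wedge_suml scaler_sumr -big_split.
apply: eq_bigr => k _ /=.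
by rewrite (ext_partialZ _ oV sf sw Vx) wedgeDr !wedgeZr wedgeZl.
Qed.

Lemma ext_dN V w x : open V -> esmooth V w -> V x ->
  ext_d (fun y => - w y) x = - ext_d w x.
Proof.
move=> oV sw Vx.
rewrite (_ : (fun y => - w y) = (fun y => -1 *: w y)); last first.
  by apply/funext => y; rewrite scaleN1r.
rewrite (ext_dZ oV _ sw Vx); last exact: csmooth_cst.
by rewrite d_fun_cst cov0 wedge0l add0r scaleN1r.
Qed.

Lemma ext_d_cov_wedge V a w x : open V -> csmooth_mx V a -> esmooth V w -> V x ->
  ext_d (fun y => cov (a y) ∧ w y) x = d_cov a x ∧ w x - cov (a x) ∧ ext_d w x.
Proof.
move=> oV sa sw Vx; rewrite /d_cov !ext_dE wedge_suml wedge_sumr -sumrB.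
apply: eq_bigr => k _.
rewrite (ext_partial_wedge _ oV (esmooth_cov oV sa) sw Vx) wedgeDr.
by rewrite -!wedge_assoc (cov_wedge_anti (delta_mx 0 k) (a x)) wedgeNl.
Qed.

Lemma csmooth_mx_d_fun V f : csmooth V f -> csmooth_mx V (d_fun f).
Proof.
by move=> sf i j; under eq_fun do rewrite mxE; apply: csmooth_cpartial.
Qed.

Lemma csmooth_mx_row_partial V a k : csmooth_mx V a -> csmooth_mx V (row_partial k a).
Proof.
by move=> sa i j; under eq_fun do rewrite mxE; apply: csmooth_cpartial.
Qed.

(** The cancellation behind d d = 0: second derivatives are symmetric in the indices in which the
    wedge is antisymmetric. *)
Lemma sum_sym_wedge (s : 'I_n -> 'I_n -> ext R n) : (forall k l, s k l = s l k) ->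
  \sum_k \sum_l cov (delta_mx 0 k) ∧ cov (delta_mx 0 l) ∧ s k l = 0.
Proof.
move=> sym; set t := (LHS); apply: eq_oppr0.
rewrite {1}/t exchange_big -sumrN; apply: eq_bigr => k _.
by rewrite -sumrN; apply: eq_bigr => l _; rewrite cov_wedge_anti wedgeNl sym.
Qed.

Lemma d_cov_cst (r : 'rV[R[i]]_n) x : d_cov (fun _ => r) x = 0.
Proof.
rewrite /d_cov ext_dE big1 // => k _; rewrite (_ : ext_partial _ _ _ = 0) ?wedge0r //.
by apply/ffunP => S; rewrite !ffunE cpartial_cst.
Qed.

Lemma ext_d_d_cov V a x : open V -> csmooth_mx V a -> V x -> ext_d (d_cov a) x = 0.
Proof.
move=> oV sa Vx; rewrite (ext_d_eq oV Vx (fun y Vy => d_covE oV sa Vy)).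
have s1 k : csmooth_mx V (fun _ : 'rV[R]_n => delta_mx 0 k : 'rV[R[i]]_n).
  by move=> i j; apply: csmooth_cst.
have s2 k := csmooth_mx_row_partial k sa.
have symk k l : row_partial l (row_partial k a) x = row_partial k (row_partial l a) x.
  have rE k' b j : (fun y => row_partial k' b y 0 j) = cpartial k' (fun y => b y 0 j).
    by apply/funext => y; rewrite mxE.
  apply/rowP => j; have r2E k' b y : row_partial k' b y 0 j = cpartial k' (fun z => b z 0 j) y.
    by rewrite mxE.
  rewrite [LHS]r2E [RHS]r2E.
  rewrite (rE k a j) (rE l a j).
  have saj : csmooth V (fun y => a y 0 j) by apply: sa.
  exact: (cpartial_comm k l oV Vx saj).
rewrite (ext_d_sum _ _ oV _ Vx) => [|k]; last first.
  by apply: esmooth_wedge => //; apply: esmooth_cov.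
rewrite -[RHS](sum_sym_wedge
  (s := fun k l => - cov (row_partial l (row_partial k a) x))).
  apply: eq_bigr => k _; rewrite (ext_d_cov_wedge oV (s1 k) _ Vx); last exact: esmooth_cov.
  rewrite d_cov_cst wedge0l sub0r -/(d_cov (row_partial k a) x) (d_covE oV (s2 k) Vx).
  by rewrite wedge_sumr -sumrN; apply: eq_bigr => l _; rewrite wedgeNr wedge_assoc.
by move=> k l; rewrite symk.
Qed.

Lemma d_cov_d_fun V f x : open V -> csmooth V f -> V x -> d_cov (d_fun f) x = 0.
Proof.
move=> oV sf Vx; rewrite (d_covE oV (csmooth_mx_d_fun sf) Vx).
(* The unit form is split off so that the double sum takes the shape required by [sum_sym_wedge]. *)
have E k : cov (row_partial k (d_fun f) x) =
    \sum_l cov (delta_mx 0 l) ∧ (cpartial k (cpartial l f) x *: ext1 R n).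
  rewrite row_delta_sum; apply: eq_bigr => l _; rewrite wedgeZr wedge_ext1 mxE.
  by rewrite (_ : (fun y => d_fun f y 0 l) = cpartial l f) //; apply/funext => y; rewrite mxE.
under eq_bigr do rewrite E wedge_sumr.
under eq_bigr do under eq_bigr do rewrite -wedge_assoc.
by apply: sum_sym_wedge => k l; rewrite (cpartial_comm _ _ oV Vx sf).
Qed.

Lemma d_cov_eq V a b x : open V -> V x -> (forall y, V y -> a y = b y) ->
  d_cov a x = d_cov b x.
Proof. by move=> oV Vx ab; apply: ext_d_eq oV Vx _ => y /ab ->. Qed.

Lemma d_covD V a b x : open V -> csmooth_mx V a -> csmooth_mx V b -> V x ->
  d_cov (fun y => a y + b y) x = d_cov a x + d_cov b x.
Proof.
move=> oV sa sb Vx; rewrite /d_cov.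
rewrite (_ : (fun y => cov (a y + b y)) = (fun y => cov (a y) + cov (b y))); last first.
  by apply/funext => y; rewrite covD.
by apply: ext_dD Vx; apply: esmooth_cov.
Qed.

Lemma d_covN V a x : open V -> csmooth_mx V a -> V x ->
  d_cov (fun y => - a y) x = - d_cov a x.
Proof.
move=> oV sa Vx; rewrite /d_cov.
rewrite (_ : (fun y => cov (- a y)) = (fun y => - cov (a y))); last first.
  by apply/funext => y; rewrite covN.
by rewrite (ext_dN oV (esmooth_cov oV sa) Vx).
Qed.

Lemma d_covB V a b x : open V -> csmooth_mx V a -> csmooth_mx V b -> V x ->
  d_cov (fun y => a y - b y) x = d_cov a x - d_cov b x.
Proof.
move=> oV sa sb Vx; rewrite (d_covD oV sa _ Vx) ?(d_covN oV sb Vx) // => i j.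
by under eq_fun do rewrite mxE; apply: csmoothN.
Qed.

Lemma d_covZ V f a x : open V -> csmooth V f -> csmooth_mx V a -> V x ->
  d_cov (fun y => f y *: a y) x = cov (d_fun f x) ∧ cov (a x) + f x *: d_cov a x.
Proof.
move=> oV sf sa Vx; rewrite /d_cov.
rewrite (_ : (fun y => cov (f y *: a y)) = (fun y => f y *: cov (a y))); last first.
  by apply/funext => y; rewrite covZ.
by rewrite (ext_dZ oV sf (esmooth_cov oV sa) Vx).
Qed.

Lemma d_cov_scale V (c : R[i]) a x : open V -> csmooth_mx V a -> V x ->
  d_cov (fun y => c *: a y) x = c *: d_cov a x.
Proof.
move=> oV sa Vx; rewrite (d_covZ oV (csmooth_cst V c) sa Vx).
by rewrite d_fun_cst cov0 wedge0l add0r.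
Qed.

Lemma d_cov_sum V I (r : seq I) (P : pred I) (F : I -> 'rV[R]_n -> 'rV[R[i]]_n) x :
  open V -> (forall i, csmooth_mx V (F i)) -> V x ->
  d_cov (fun y => \sum_(i <- r | P i) F i y) x = \sum_(i <- r | P i) d_cov (F i) x.
Proof.
move=> oV sF Vx; rewrite /d_cov.
rewrite (_ : (fun y => cov (\sum_(i <- r | P i) F i y)) =
    (fun y => \sum_(i <- r | P i) cov (F i y))); last first.
  by apply/funext => y; rewrite cov_sum.
by rewrite (ext_d_sum _ _ oV (fun i => esmooth_cov oV (sF i)) Vx).
Qed.

End Forms.

Section SmoothMatrices.
Variables (R : realType) (n : nat) (V : set 'rV[R]_n) (oV : open V).

Lemma csmooth_mx_cst p q (B : 'M[R[i]]_(p, q)) : csmooth_mx V (fun _ => B).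
Proof. by move=> i j; apply: csmooth_cst. Qed.

Lemma csmooth_mxD p q (B C : 'rV[R]_n -> 'M[R[i]]_(p, q)) :
  csmooth_mx V B -> csmooth_mx V C -> csmooth_mx V (fun y => B y + C y).
Proof. by move=> sB sC i j; under eq_fun do rewrite mxE; apply: csmoothD. Qed.

Lemma csmooth_mxN p q (B : 'rV[R]_n -> 'M[R[i]]_(p, q)) :
  csmooth_mx V B -> csmooth_mx V (fun y => - B y).
Proof. by move=> sB i j; under eq_fun do rewrite mxE; apply: csmoothN. Qed.

Lemma csmooth_mxB p q (B C : 'rV[R]_n -> 'M[R[i]]_(p, q)) :
  csmooth_mx V B -> csmooth_mx V C -> csmooth_mx V (fun y => B y - C y).
Proof. by move=> sB sC; apply: csmooth_mxD => //; apply: csmooth_mxN. Qed.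

Lemma csmooth_mxZ p q (f : 'rV[R]_n -> R[i]) (B : 'rV[R]_n -> 'M[R[i]]_(p, q)) :
  csmooth V f -> csmooth_mx V B -> csmooth_mx V (fun y => f y *: B y).
Proof. by move=> sf sB i j; under eq_fun do rewrite mxE; apply: csmoothM. Qed.

Lemma csmooth_mx_sum p q I (r : seq I) (P : pred I)
    (F : I -> 'rV[R]_n -> 'M[R[i]]_(p, q)) :
  (forall i, csmooth_mx V (F i)) -> csmooth_mx V (fun y => \sum_(i <- r | P i) F i y).
Proof.
move=> sF i j; under eq_fun do rewrite summxE.
by apply: csmooth_sum => // k _; apply: sF.
Qed.

Lemma csmooth_mx_tr p q (B : 'rV[R]_n -> 'M[R[i]]_(p, q)) :
  csmooth_mx V B -> csmooth_mx V (fun y => (B y)^T).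
Proof. by move=> sB i j; under eq_fun do rewrite mxE; apply: sB. Qed.

Lemma csmooth_mx_row p q (B : 'rV[R]_n -> 'M[R[i]]_(p, q)) k :
  csmooth_mx V B -> csmooth_mx V (fun y => row k (B y)).
Proof. by move=> sB i j; under eq_fun do rewrite mxE; apply: sB. Qed.

Lemma csmooth_mxM p q r (B : 'rV[R]_n -> 'M[R[i]]_(p, q))
    (C : 'rV[R]_n -> 'M[R[i]]_(q, r)) :
  csmooth_mx V B -> csmooth_mx V C -> csmooth_mx V (fun y => B y *m C y).
Proof.
move=> sB sC i j; under eq_fun do rewrite mxE.
by apply: csmooth_sum => // k _; apply: csmoothM.
Qed.

Lemma csmooth_prod I (r : seq I) (F : I -> 'rV[R]_n -> R[i]) :
  (forall i, csmooth V (F i)) -> csmooth V (fun y => \prod_(i <- r) F i y).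
Proof.
move=> sF; elim: r => [|i r IH].
  by under eq_fun do rewrite big_nil; apply: csmooth_cst.
by under eq_fun do rewrite big_cons; apply: csmoothM.
Qed.

Lemma csmooth_det p (B : 'rV[R]_n -> 'M[R[i]]_p) :
  csmooth_mx V B -> csmooth V (fun y => \det (B y)).
Proof.
move=> sB; rewrite /determinant; apply: csmooth_sum => // s _.
apply: csmoothM => //; first exact: csmooth_cst.
by apply: csmooth_prod => i; apply: sB.
Qed.

Lemma csmooth_mx_inv p (B : 'rV[R]_n -> 'M[R[i]]_p) :
  csmooth_mx V B -> (forall x, V x -> B x \in unitmx) ->
  csmooth_mx V (fun y => invmx (B y)).
Proof.
move=> sB uB i j.
apply: (csmooth_eq oV (f := fun y => (\det (B y))^-1 * cofactor (B y) j i)).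
  by move=> y Vy; rewrite /invmx uB // !mxE.
have sd : csmooth V (fun y => \det (B y)) by apply: csmooth_det.
have sc : csmooth V (fun y => cofactor (B y) j i).
  rewrite /cofactor; apply: csmoothM => //; first exact: csmooth_cst.
  by apply: csmooth_det => k l; under eq_fun do rewrite !mxE; apply: sB.
apply: csmoothM => //; apply: csmoothV => //.
Qed.

End SmoothMatrices.

(** * Curvature in a null cotetrad *)

Lemma sum_I4 (V : nmodType) (F : 'I_4 -> V) : \sum_i F i = F i1 + F i2 + F i3 + F i4.
Proof.
rewrite !big_ord_recl big_ord0 addr0 !addrA.
by congr (F _ + F _ + F _ + F _); apply/val_inj.
Qed.

Lemma forall_I4 (P : 'I_4 -> Prop) : P i1 -> P i2 -> P i3 -> P i4 -> forall i, P i.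
Proof.
move=> P1 P2 P3 P4 [[|[|[|[|i]]]] //= Hi].
- by rewrite (_ : Ordinal Hi = i1) //; apply/val_inj.
- by rewrite (_ : Ordinal Hi = i2) //; apply/val_inj.
- by rewrite (_ : Ordinal Hi = i3) //; apply/val_inj.
- by rewrite (_ : Ordinal Hi = i4) //; apply/val_inj.
Qed.

Section NullFrame.
Variable R : realType.
Local Notation C := (R[i]).

(** Gram matrix of MP - NK in the coframe (M, P, N, K); the factor 1/2 is that of the symmetric
    product. *)
Definition null_metric : 'M[C]_4 :=
  2^-1 *: (delta_mx i1 i2 + delta_mx i2 i1 - delta_mx i3 i4 - delta_mx i4 i3).

Lemma null_metricE i j : null_metric i j =
  2^-1 * (((i == i1) && (j == i2))%:R + ((i == i2) && (j == i1))%:R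
    - ((i == i3) && (j == i4))%:R - ((i == i4) && (j == i3))%:R).
Proof. by rewrite !mxE. Qed.

Lemma null_metric_sym : null_metric^T = null_metric.
Proof.
by apply/matrixP => i j; rewrite mxE !null_metricE; move: i j;
  do 2!apply: forall_I4; rewrite /=; ring.
Qed.

Lemma null_metric_mul4 : null_metric *m (4 *: null_metric) = 1%:M.
Proof.
apply/matrixP => i j; rewrite mxE sum_I4 ![(4 *: null_metric) _ _]mxE [RHS]mxE !null_metricE.
by move: i j; do 2!apply: forall_I4; rewrite /=; field.
Qed.

Lemma null_metric_unit : null_metric \in unitmx.
Proof. by case/mulmx1_unit: null_metric_mul4 => u _; exact: u. Qed.

Lemma null_metric_inv : invmx null_metric = 4 *: null_metric.
Proof.
by rewrite -[RHS](mulKmx null_metric_unit) null_metric_mul4 mulmx1.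
Qed.

Definition lower (G : 'M[C]_4) (r : tensor4 R) : tensor4 R :=
  fun i j k l => \sum_h G i h * r h j k l.

(** Lowering an index and contracting it again cancels the metric. Ricci is thus a bare trace of the
    curvature with its first index up, which is the form used in all later computations. *)
Lemma ricci_lower (G : 'M[C]_4) r : G^T = G -> G \in unitmx ->
  ricci G (lower G r) = \matrix_(j, l) \sum_k r k j k l.
Proof.
move=> Gs Gu; apply/matrixP => j l; rewrite !mxE exchange_big; apply: eq_bigr => k _ /=.
under eq_bigr do rewrite /lower mulr_sumr.
rewrite exchange_big (bigD1 k) //= [X in _ + X]big1 ?addr0.
  under eq_bigr do rewrite mulrA; rewrite -mulr_suml.
  rewrite (_ : \sum_i _ = 1) ?mul1r //.
  have := congr1 (fun A : 'M[C]_4 => A k k) (mulmxV Gu); rewrite !mxE eqxx mulr1n => <-.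
  apply: eq_bigr => i _; rewrite mulrC; congr (_ * _); by rewrite -[in LHS]Gs mxE.
move=> h hk; under eq_bigr do rewrite mulrA; rewrite -mulr_suml.
rewrite (_ : \sum_i _ = 0) ?mul0r //.
have := congr1 (fun A : 'M[C]_4 => A h k) (mulmxV Gu); rewrite !mxE (negPf hk) mulr0n => E; rewrite -[RHS]E.
apply: eq_bigr => i _; rewrite mulrC; congr (_ * _); by rewrite -[in LHS]Gs mxE.
Qed.

(* In a null cotetrad, r h j k l = Omega^h_j(e_k, e_l). *)
Record weyl_curvature_symmetries (r : tensor4 R) : Prop := {
  r_anti : forall h j k l, r h j k l = - r h j l k;
  r12 : forall k l, r i1 i2 k l = 0;
  r21 : forall k l, r i2 i1 k l = 0;
  r34 : forall k l, r i3 i4 k l = 0;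
  r43 : forall k l, r i4 i3 k l = 0;
  r14 : forall k l, r i1 i4 k l = r i3 i2 k l;
  r41 : forall k l, r i4 i1 k l = r i2 i3 k l;
  r24 : forall k l, r i2 i4 k l = r i3 i1 k l;
  r42 : forall k l, r i4 i2 k l = r i1 i3 k l;
  r33 : forall k l, r i3 i3 k l = r i1 i1 k l + r i2 i2 k l - r i4 i4 k l;
  r_bianchi : forall i k l m, r i m k l + r i k l m + r i l m k = 0
}.

(** For antisymmetric w this is -w(zm - k, zn - p), the value up to sign on the null plane with
    parameter z. It vanishes for all z exactly when w has no self-dual component. *)
Definition sd_part (z : C) (w : 'I_4 -> 'I_4 -> C) : C :=
  w i2 i4 + z * (w i1 i2 - w i3 i4) - z ^+ 2 * w i1 i3.

Definition curv_z (r : tensor4 R) (z : C) (k l : 'I_4) : C :=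
  - r i3 i2 k l + z * (r i1 i1 k l - r i4 i4 k l) + z ^+ 2 * r i2 i3 k l.

Definition curv_z' (r : tensor4 R) (z : C) (k l : 'I_4) : C :=
  - r i3 i1 k l + z * (r i2 i2 k l - r i4 i4 k l) + z ^+ 2 * r i1 i3 k l.

Lemma lin_comb (x y e : C) : e = 0 -> x - y = e -> x = y.
Proof. by move=> -> /eqP; rewrite subr_eq0 => /eqP. Qed.

Lemma poly2_eq0 (c0 c1 c2 : C) :
  (forall z, c0 + z * c1 + z ^+ 2 * c2 = 0) -> [/\ c0 = 0, c1 = 0 & c2 = 0].
Proof.
move=> H; have H0 := H 0; have H1 := H 1; have H2 := H (-1).
have E0 : c0 = 0 by rewrite -H0; ring.
have E2 : c2 = 0.
  apply: (lin_comb (e := 2^-1 * (c0 + 1 * c1 + 1 ^+ 2 * c2 + (c0 + -1 * c1 + (-1) ^+ 2 * c2)) - c0)).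
    by rewrite H1 H2 E0; ring.
  by field.
by split => //; rewrite -H1 E0 E2; ring.
Qed.

(** Five values suffice. The central fourth difference at 0, 1, -1, 2, -2 is 24 c4, and the odd
    combination used for c3 is 12 c3. *)
Lemma poly4_eq0 (c0 c1 c2 c3 c4 : C) :
  (forall z, c0 + z * c1 + z ^+ 2 * c2 + z ^+ 3 * c3 + z ^+ 4 * c4 = 0) ->
  [/\ c0 = 0, c1 = 0, c2 = 0, c3 = 0 & c4 = 0].
Proof.
move=> H; pose p z := c0 + z * c1 + z ^+ 2 * c2 + z ^+ 3 * c3 + z ^+ 4 * c4.
have p0 z : p z = 0 := H z.
have E0 : c0 = 0 by rewrite -(p0 0) /p; ring.
have E4 : c4 = 0.
  apply: (lin_comb (e := 24^-1 * (p 2 + p (-2) - 4 * (p 1 + p (-1)) + 6 * p 0))).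
    by rewrite !p0; ring.
  by rewrite /p; field.
have E2 : c2 = 0.
  apply: (lin_comb (e := 2^-1 * (p 1 + p (-1)) - c0 - c4)).
    by rewrite !p0 E0 E4; ring.
  by rewrite /p; field.
have E3 : c3 = 0.
  apply: (lin_comb (e := 12^-1 * (p 2 - p (-2) - 2 * (p 1 - p (-1))))).
    by rewrite !p0; ring.
  by rewrite /p; field.
by split => //; rewrite -(p0 1) /p E0 E2 E3 E4; ring.
Qed.

End NullFrame.

(** * The obstruction polynomials against the trace-free Ricci and Weyl components *)

Section NullCurvature.
Variables (R : realType) (r : tensor4 R).
Hypothesis S : weyl_curvature_symmetries r.
Local Notation C := (R[i]).
Local Notation B i k l m := (r i m k l + r i k l m + r i l m k).
Local Notation H := (null_metric R).

Let r_diag h j k : r h j k k = 0.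
Proof.
exact: (@eq_oppr0 _ C^o) (r_anti S h j k k).
Qed.

Let r_norm := (r12 S, r21 S, r34 S, r43 S, r14 S, r41 S, r24 S, r42 S, r33 S,
  r_diag, (fun h j => r_anti S h j i2 i1), (fun h j => r_anti S h j i3 i1),
  (fun h j => r_anti S h j i4 i1), (fun h j => r_anti S h j i3 i2),
  (fun h j => r_anti S h j i4 i2), (fun h j => r_anti S h j i4 i3)).

Let BE i k l m : B i k l m = 0 := r_bianchi S i k l m.

Lemma ricci_null j l : ricci H (lower H r) j l =
  r i1 j i1 l + r i2 j i2 l + r i3 j i3 l + r i4 j i4 l.
Proof.
by rewrite (ricci_lower _ (null_metric_sym R) (null_metric_unit R)) mxE sum_I4.
Qed.

Lemma lower_null j k l : [/\ lower H r i1 j k l = 2^-1 * r i2 j k l,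
  lower H r i2 j k l = 2^-1 * r i1 j k l, lower H r i3 j k l = - 2^-1 * r i4 j k l &
  lower H r i4 j k l = - 2^-1 * r i3 j k l].
Proof. by split; rewrite /lower sum_I4 !null_metricE /=; ring. Qed.

Lemma scalar_curv_null : scalar_curv H (lower H r) =
  2 * (ricci H (lower H r) i1 i2 + ricci H (lower H r) i2 i1)
  - 2 * (ricci H (lower H r) i3 i4 + ricci H (lower H r) i4 i3).
Proof.
rewrite /scalar_curv sum_I4 !sum_I4 null_metric_inv.
by rewrite ![(4 *: H) _ _]mxE !null_metricE /=; field.
Qed.

Let W := weyl_tensor H (lower H r).
Let T := tracefree_ricci H (lower H r).

(** [s0], [s1], [s2] are the coefficients of the powers of z in [sd_part], and [v0], [v1], [v2]
    those of the powers of z' in [curv_z']; a product such as [s1 v2] is a coefficient of q'. *)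
Let s0 (w : 'I_4 -> 'I_4 -> C) := w i2 i4.
Let s1 (w : 'I_4 -> 'I_4 -> C) := w i1 i2 - w i3 i4.
Let s2 (w : 'I_4 -> 'I_4 -> C) := - w i1 i3.
Let v0 k l := - r i3 i1 k l.
Let v1 k l := r i2 i2 k l - r i4 i4 k l.
Let v2 k l := r i1 i3 k l.

Let TE i j : T i j = 2^-1 * (ricci H (lower H r) i j + ricci H (lower H r) j i)
    - 4^-1 * scalar_curv H (lower H r) * H i j.
Proof. by rewrite !mxE. Qed.

Let TE' := (TE, ricci_null, null_metricE, scalar_curv_null).

(* A vanishing quantity is exhibited as a linear combination [e] of quantities
   that vanish by [zs]: Bianchi sums and the coefficients of the obstruction. *)
Ltac ricci_comb e zs := apply: (lin_comb (e := e)); [by rewrite ?zs; ring |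
  by rewrite !TE' /= /s0 /s1 /s2 /v0 /v1 /v2 !r_norm; field].

(** Modulo Bianchi sums, each of the nine coefficients of q' is a nonzero multiple of one component
    of the trace-free Ricci tensor. The ten components of a symmetric matrix are accounted for
    because tracelessness equates the entries (1,2) and (3,4), which both come from [s1 v1]. *)
Lemma tracefree_ricci_null_eq0 :
  (forall z z', sd_part z (curv_z' r z') = 0) <-> tracefree_ricci H (lower H r) = 0.
Proof.
have sdE z z' : sd_part z (curv_z' r z') =
    (s0 v0 + z' * s0 v1 + z' ^+ 2 * s0 v2)
    + z * (s1 v0 + z' * s1 v1 + z' ^+ 2 * s1 v2)
    + z ^+ 2 * (s2 v0 + z' * s2 v1 + z' ^+ 2 * s2 v2).
  by rewrite /sd_part /curv_z' /s0 /s1 /s2 /v0 /v1 /v2; ring.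
split => [h|h].
  have [p00 p10 p20 [p01 p11 p21] [p02 p12 p22]] : [/\ s0 v0 = 0, s0 v1 = 0,
      s0 v2 = 0, [/\ s1 v0 = 0, s1 v1 = 0 & s1 v2 = 0]
      & [/\ s2 v0 = 0, s2 v1 = 0 & s2 v2 = 0]].
    (* Coefficients are compared twice: in z for fixed z', then in z'. *)
    have h' z' := poly2_eq0 (fun z => etrans (esym (sdE z z')) (h z z')).
    have [a0 a1 a2] := poly2_eq0 (fun z' => let: And3 e _ _ := h' z' in e).
    have b := poly2_eq0 (fun z' => let: And3 _ e _ := h' z' in e).
    by have c := poly2_eq0 (fun z' => let: And3 _ _ e := h' z' in e).
  have zs := (BE, p00, p10, p20, p01, p11, p21, p02, p12, p22).
  have Ts i j : T i j = T j i.
    have Hs : H i j = H j i by rewrite -{1}(null_metric_sym R) mxE.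
    by rewrite !TE Hs [ricci _ _ i j + _]addrC.
  have t11 : T i1 i1 = 0.
    ricci_comb (- 2 * s2 v0 + B i2 i1 i3 i4) zs.
  have t12 : T i1 i2 = 0.
    ricci_comb (- 1 / 2 * s1 v1 + 1 / 4 * B i1 i1 i3 i4 - 1 / 4 * B i2 i2 i3 i4
      + 1 / 4 * B i3 i1 i2 i3 - 1 / 4 * B i4 i1 i2 i4) zs.
  have t13 : T i1 i3 = 0.
    ricci_comb (s2 v1 - 1 / 2 * B i2 i1 i2 i3 - 1 / 2 * B i4 i1 i3 i4) zs.
  have t14 : T i1 i4 = 0.
    ricci_comb (s1 v0 + 1 / 2 * B i2 i1 i2 i4 - 1 / 2 * B i3 i1 i3 i4) zs.
  have t22 : T i2 i2 = 0.
    ricci_comb (- 2 * s0 v2 - B i1 i2 i3 i4) zs.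
  have t23 : T i2 i3 = 0.
    ricci_comb (s1 v2 - 1 / 2 * B i1 i1 i2 i3 + 1 / 2 * B i4 i2 i3 i4) zs.
  have t24 : T i2 i4 = 0.
    ricci_comb (s0 v1 + 1 / 2 * B i1 i1 i2 i4 + 1 / 2 * B i3 i2 i3 i4) zs.
  have t33 : T i3 i3 = 0.
    ricci_comb (- 2 * s2 v2 + B i4 i1 i2 i3) zs.
  have t34 : T i3 i4 = 0.
    ricci_comb (- 1 / 2 * s1 v1 + 1 / 4 * B i1 i1 i3 i4 - 1 / 4 * B i2 i2 i3 i4
      + 1 / 4 * B i3 i1 i2 i3 - 1 / 4 * B i4 i1 i2 i4) zs.
  have t44 : T i4 i4 = 0.
    ricci_comb (- 2 * s0 v0 - B i3 i1 i2 i4) zs.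
  apply/matrixP => i j; rewrite [RHS]mxE; move: i j.
  apply: forall_I4; apply: forall_I4 => //; by rewrite Ts.
have T0 i j : T i j = 0 by rewrite /T h mxE.
have zs := (BE, T0).
have p00 : s0 v0 = 0.
    ricci_comb (- 1 / 2 * T i4 i4 - 1 / 2 * B i3 i1 i2 i4) zs.
have p01 : s1 v0 = 0.
    ricci_comb (T i1 i4 - 1 / 2 * B i2 i1 i2 i4 + 1 / 2 * B i3 i1 i3 i4) zs.
have p02 : s2 v0 = 0.
    ricci_comb (- 1 / 2 * T i1 i1 + 1 / 2 * B i2 i1 i3 i4) zs.
have p10 : s0 v1 = 0.
    ricci_comb (T i2 i4 - 1 / 2 * B i1 i1 i2 i4 - 1 / 2 * B i3 i2 i3 i4) zs.
have p11 : s1 v1 = 0.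
    ricci_comb (- 2 * T i1 i2 + 1 / 2 * B i1 i1 i3 i4 - 1 / 2 * B i2 i2 i3 i4
      + 1 / 2 * B i3 i1 i2 i3 - 1 / 2 * B i4 i1 i2 i4) zs.
have p12 : s2 v1 = 0.
    ricci_comb (T i1 i3 + 1 / 2 * B i2 i1 i2 i3 + 1 / 2 * B i4 i1 i3 i4) zs.
have p20 : s0 v2 = 0.
    ricci_comb (- 1 / 2 * T i2 i2 - 1 / 2 * B i1 i2 i3 i4) zs.
have p21 : s1 v2 = 0.
    ricci_comb (T i2 i3 + 1 / 2 * B i1 i1 i2 i3 - 1 / 2 * B i4 i2 i3 i4) zs.
have p22 : s2 v2 = 0.
    ricci_comb (- 1 / 2 * T i3 i3 + 1 / 2 * B i4 i1 i2 i3) zs.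
move=> z z'; rewrite sdE p00 p01 p02 p10 p11 p12 p20 p21 p22; ring.
Qed.

(** In general Omega^1_1 + Omega^2_2 = dA; its vanishing expresses the Levi-Civita case, in which
    the curvature takes values in the orthogonal algebra and the Weyl tensor is antisymmetric in its
    first two indices. *)
Hypothesis r22 : forall k l, r i2 i2 k l = - r i1 i1 k l.
Let r_norm' := (r_norm, r22).

Let WE i j k l : W i j k l = lower H r i j k l
    - 2^-1 * (H i k * ricci H (lower H r) j l - H i l * ricci H (lower H r) j k
      - H j k * ricci H (lower H r) i l + H j l * ricci H (lower H r) i k)
    + 6^-1 * scalar_curv H (lower H r) * (H i k * H j l - H i l * H j k).
Proof. by []. Qed.

Let lowerE := (fun j k l => let: And4 e _ _ _ := lower_null j k l in e,
  fun j k l => let: And4 _ e _ _ := lower_null j k l in e,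
  fun j k l => let: And4 _ _ e _ := lower_null j k l in e,
  fun j k l => let: And4 _ _ _ e := lower_null j k l in e).

Let WE' := (WE, lowerE, ricci_null, null_metricE, scalar_curv_null).

Lemma weyl_null_anti i j k l : W j i k l = - W i j k l.
Proof.
rewrite !WE.
have -> : lower H r j i k l = - lower H r i j k l.
  by move: i j; do 2!apply: forall_I4; rewrite !lowerE !r_norm'; ring.
by rewrite -!mulrN; ring.
Qed.

Let w0 k l := - r i3 i2 k l.
Let w1 k l := r i1 i1 k l - r i4 i4 k l.
Let w2 k l := r i2 i3 k l.
Let c0 := s0 w0.
Let c1 := s0 w1 + s1 w0.
Let c2 := s0 w2 + s1 w1 + s2 w0.
Let c3 := s1 w2 + s2 w1.
Let c4 := s2 w2.

Ltac weyl_comb e zs := apply: (lin_comb (e := e)); [by rewrite ?zs; ring |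
  by rewrite !WE' /= /c0 /c1 /c2 /c3 /c4 /s0 /s1 /s2 /w0 /w1 /w2 !r_norm'; field].

(** The five coefficients of the quartic q are, modulo Bianchi sums, the components of the self-dual
    half of the Weyl tensor. The right side says that each form W_ij has no self-dual part; for the
    converse the pairs (1,2), (1,3) and (2,4) already yield all five coefficients. *)
Lemma weyl_sd_null_eq0 : (forall z, sd_part z (curv_z r z) = 0) <->
  forall i j, [/\ W i j i2 i4 = 0, W i j i1 i2 = W i j i3 i4 & W i j i1 i3 = 0].
Proof.
have sdE z : sd_part z (curv_z r z) =
    c0 + z * c1 + z ^+ 2 * c2 + z ^+ 3 * c3 + z ^+ 4 * c4.
  by rewrite /sd_part /curv_z /c0 /c1 /c2 /c3 /c4 /s0 /s1 /s2 /w0 /w1 /w2; ring.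
split => [h|h].
  have [h0 h1 h2 h3 h4] := poly4_eq0 (fun z => etrans (esym (sdE z)) (h z)).
  (* Antisymmetry in i and j leaves six pairs. *)
  suff w_lt (i j : 'I_4) : (i < j)%N ->
      [/\ W i j i2 i4 = 0, W i j i1 i2 = W i j i3 i4 & W i j i1 i3 = 0].
    move=> i j; case: (ltngtP i j) => [/w_lt //|/w_lt [e0 e1 e2]|/val_inj ->].
      by rewrite !(weyl_null_anti j i) e0 e1 e2 oppr0.
    have W0 k l : W j j k l = 0 := @eq_oppr0 _ C^o _ (weyl_null_anti j j k l).
    by rewrite !W0.
  have zs := (BE, h0, h1, h2, h3, h4).
  have W12 : [/\ W i1 i2 i2 i4 = 0, W i1 i2 i1 i2 = W i1 i2 i3 i4 & W i1 i2 i1 i3 = 0].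
    split.
    - weyl_comb (- 1 / 8 * c1 - 1 / 8 * B i1 i1 i2 i4 - 1 / 8 * B i3 i2 i3 i4) zs.
    - weyl_comb (- 1 / 6 * c2 + 1 / 6 * B i1 i1 i3 i4 - 1 / 6 * B i2 i2 i3 i4
        + 1 / 12 * B i3 i1 i2 i3 - 1 / 12 * B i4 i1 i2 i4) zs.
    - weyl_comb (1 / 8 * c3 - 1 / 8 * B i2 i1 i2 i3 - 1 / 8 * B i4 i1 i3 i4) zs.
  have W13 : [/\ W i1 i3 i2 i4 = 0, W i1 i3 i1 i2 = W i1 i3 i3 i4 & W i1 i3 i1 i3 = 0].
    split.
    - weyl_comb (1 / 12 * c2 + 1 / 24 * B i1 i1 i3 i4 - 1 / 24 * B i2 i2 i3 i4
        - 1 / 24 * B i3 i1 i2 i3 + 1 / 24 * B i4 i1 i2 i4) zs.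
    - weyl_comb (1 / 4 * c3) zs.
    - weyl_comb (- 1 / 2 * c4) zs.
  have W14 : [/\ W i1 i4 i2 i4 = 0, W i1 i4 i1 i2 = W i1 i4 i3 i4 & W i1 i4 i1 i3 = 0].
    split.
    - weyl_comb (1 / 4 * B i3 i1 i2 i4) zs.
    - weyl_comb (1 / 4 * B i2 i1 i2 i4 - 1 / 4 * B i3 i1 i3 i4) zs.
    - weyl_comb (1 / 4 * B i2 i1 i3 i4) zs.
  have W23 : [/\ W i2 i3 i2 i4 = 0, W i2 i3 i1 i2 = W i2 i3 i3 i4 & W i2 i3 i1 i3 = 0].
    split.
    - weyl_comb (- 1 / 4 * B i1 i2 i3 i4) zs.
    - weyl_comb (1 / 4 * B i1 i1 i2 i3 - 1 / 4 * B i4 i2 i3 i4) zs.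
    - weyl_comb (- 1 / 4 * B i4 i1 i2 i3) zs.
  have W24 : [/\ W i2 i4 i2 i4 = 0, W i2 i4 i1 i2 = W i2 i4 i3 i4 & W i2 i4 i1 i3 = 0].
    split.
    - weyl_comb (- 1 / 2 * c0) zs.
    - weyl_comb (- 1 / 4 * c1) zs.
    - weyl_comb (1 / 12 * c2 + 1 / 24 * B i1 i1 i3 i4 - 1 / 24 * B i2 i2 i3 i4
        - 1 / 24 * B i3 i1 i2 i3 + 1 / 24 * B i4 i1 i2 i4) zs.
  have W34 : [/\ W i3 i4 i2 i4 = 0, W i3 i4 i1 i2 = W i3 i4 i3 i4 & W i3 i4 i1 i3 = 0].
    split.
    - weyl_comb (1 / 8 * c1 - 1 / 8 * B i1 i1 i2 i4 - 1 / 8 * B i3 i2 i3 i4) zs.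
    - weyl_comb (1 / 6 * c2 + 1 / 12 * B i1 i1 i3 i4 - 1 / 12 * B i2 i2 i3 i4
        + 1 / 6 * B i3 i1 i2 i3 - 1 / 6 * B i4 i1 i2 i4) zs.
    - weyl_comb (- 1 / 8 * c3 - 1 / 8 * B i2 i1 i2 i3 - 1 / 8 * B i4 i1 i3 i4) zs.
  by move: i j; do 2!apply: forall_I4.
have h' i j : [/\ W i j i2 i4 = 0, W i j i1 i2 - W i j i3 i4 = 0 & W i j i1 i3 = 0].
  by have [-> -> ->] := h i j; rewrite subrr.
have h0 : c0 = 0.
  have [e0 e1 e2] := h' i2 i4; have zs := (BE, e0, e1, e2).
  weyl_comb (- 2 * W i2 i4 i2 i4) zs.
have h1 : c1 = 0.
  have [e0 e1 e2] := h' i1 i2; have zs := (BE, e0, e1, e2).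
  weyl_comb (- 8 * W i1 i2 i2 i4 - B i1 i1 i2 i4 - B i3 i2 i3 i4) zs.
have h2 : c2 = 0.
  have [e0 e1 e2] := h' i1 i2; have zs := (BE, e0, e1, e2).
  weyl_comb (- 6 * (W i1 i2 i1 i2 - W i1 i2 i3 i4) + B i1 i1 i3 i4 - B i2 i2 i3 i4
    + 1 / 2 * B i3 i1 i2 i3 - 1 / 2 * B i4 i1 i2 i4) zs.
have h3 : c3 = 0.
  have [e0 e1 e2] := h' i1 i2; have zs := (BE, e0, e1, e2).
  weyl_comb (8 * W i1 i2 i1 i3 + B i2 i1 i2 i3 + B i4 i1 i3 i4) zs.
have h4 : c4 = 0.
  have [e0 e1 e2] := h' i1 i3; have zs := (BE, e0, e1, e2).
  weyl_comb (- 2 * W i1 i3 i1 i3) zs.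
by move=> z; rewrite sdE h0 h1 h2 h3 h4; ring.
Qed.

End NullCurvature.

(** * Contractions of 2-forms and the Bianchi identity *)

Section TwoForms.
Variables (R : realType) (n : nat).
Implicit Types (u v w : ext R n) (a b e f : 'rV[R[i]]_n).

(** A list of decomposable summands reduces any identity linear in w to products of two
    covectors. *)
Definition two_form w := exists s : seq ('rV[R[i]]_n * 'rV[R[i]]_n),
  w = \sum_(p <- s) cov p.1 ∧ cov p.2.

Lemma two_form_cov a b : two_form (cov a ∧ cov b).
Proof. by exists [:: (a, b)]; rewrite big_seq1. Qed.

Lemma two_formD u v : two_form u -> two_form v -> two_form (u + v).
Proof. by move=> [s ->] [t ->]; exists (s ++ t); rewrite big_cat. Qed.

Lemma two_form_0 : two_form (0 : ext R n).
Proof. by exists [::]; rewrite big_nil. Qed.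

Lemma two_form_sum I (r : seq I) (F : I -> ext R n) :
  (forall i, two_form (F i)) -> two_form (\sum_(i <- r) F i).
Proof.
move=> dF; elim: r => [|i r IH]; first by rewrite big_nil; apply: two_form_0.
by rewrite big_cons; apply: two_formD.
Qed.

Lemma iota_vD e u v : iota_v e (u + v) = iota_v e u + iota_v e v.
Proof.
apply/ffunP => S; rewrite !ffunE -big_split; apply: eq_bigr => k _ /=.
by rewrite ffunE mulrDr.
Qed.

Lemma iota_v_sum e I (r : seq I) (F : I -> ext R n) :
  iota_v e (\sum_(i <- r) F i) = \sum_(i <- r) iota_v e (F i).
Proof.
by apply: (big_morph (iota_v e)) => [u v|]; rewrite ?iota_vD ?iota_v0.
Qed.

Lemma iota_v_ext1 e : iota_v e (ext1 R n) = 0.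
Proof.
apply/ffunP => S; rewrite !ffunE big1 // => k _; rewrite ffunE.
have /negPf -> : (k |: S)%SET != finset.set0.
  by apply/finset.set0Pn; exists k; rewrite !inE eqxx.
by rewrite mulr0.
Qed.

Lemma iota_v_cov1 e a : iota_v e (cov a) = pairing a e *: ext1 R n.
Proof.
by rewrite -[cov a]wedge_ext1 iota_v_cov iota_v_ext1 wedge0r subr0.
Qed.

Lemma iota_vN e w : iota_v e (- w) = - iota_v e w.
Proof. by rewrite -scaleN1r iota_vZ scaleN1r. Qed.

Lemma iota_v_cov2 e a b :
  iota_v e (cov a ∧ cov b) = pairing a e *: cov b - pairing b e *: cov a.
Proof. by rewrite iota_v_cov iota_v_cov1 wedgeZr wedge_ext1. Qed.

Lemma iota_v_wedge2 a b e f : iota_v f (iota_v e (cov a ∧ cov b)) =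
  eval2 (cov a ∧ cov b) e f *: ext1 R n.
Proof.
rewrite iota_v_cov2 iota_vD iota_vN !iota_vZ !iota_v_cov1 !scalerA -scalerBl.
by rewrite eval2_cov; congr (_ *: _); ring.
Qed.

Lemma iota_v_lin3 e (p q r : R[i]) u v w :
  iota_v e (p *: u - q *: v + r *: w) =
  p *: iota_v e u - q *: iota_v e v + r *: iota_v e w.
Proof. by rewrite iota_vD iota_vD iota_vN !iota_vZ. Qed.

Lemma iota_v_cov3 e a b c : iota_v e (cov a ∧ cov b ∧ cov c) =
  pairing a e *: (cov b ∧ cov c) - pairing b e *: (cov a ∧ cov c)
  + pairing c e *: (cov a ∧ cov b).
Proof.
rewrite wedge_assoc iota_v_cov iota_v_cov2 wedgeDr wedgeNr !wedgeZr.
by rewrite opprD opprK addrA.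
Qed.

(** Contracting with three vectors produces the cyclic sum; with a a coframe element this is how the
    Bianchi identity for forms becomes one for components. *)
Lemma iota_v_wedge3 w a (e f g : 'rV[R[i]]_n) : two_form w ->
  iota_v g (iota_v f (iota_v e (w ∧ cov a))) =
  (pairing a e * eval2 w f g + pairing a f * eval2 w g e
   + pairing a g * eval2 w e f) *: ext1 R n.
Proof.
move=> [s ->]; rewrite wedge_suml !iota_v_sum !eval2_sum !mulr_sumr -!big_split.
rewrite scaler_suml; apply: eq_bigr => -[b c] _ /=.
rewrite iota_v_cov3 !iota_v_lin3.
rewrite !iota_v_wedge2 !scalerA -scalerBl -scalerDl !eval2_cov.
by congr (_ *: _); ring.
Qed.

Lemma two_form_d_cov V (a : 'rV[R]_n -> 'rV[R[i]]_n) x :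
  open V -> csmooth_mx V a -> V x -> two_form (d_cov a x).
Proof.
move=> oV sa Vx; rewrite (d_covE oV sa Vx).
by apply: two_form_sum => k; apply: two_form_cov.
Qed.

Lemma ext1_neq0 : ext1 R n != 0.
Proof.
apply/eqP => /ffunP /(_ finset.set0); rewrite !ffunE eqxx => /eqP.
by rewrite oner_eq0.
Qed.

Lemma pairingD a b e : pairing (a + b) e = pairing a e + pairing b e.
Proof.
by rewrite /pairing -big_split; apply: eq_bigr => k _; rewrite mxE mulrDl.
Qed.

Lemma pairingZ c a e : pairing (c *: a) e = c * pairing a e.
Proof. by rewrite /pairing mulr_sumr; apply: eq_bigr => k _; rewrite mxE mulrA. Qed.

Lemma pairingN a e : pairing (- a) e = - pairing a e.
Proof. by rewrite -scaleN1r pairingZ mulN1r. Qed.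

Lemma pairing0 e : pairing 0 e = 0.
Proof. by rewrite -(scale0r 0) pairingZ mul0r. Qed.

Lemma eval2N w e f : eval2 (- w) e f = - eval2 w e f.
Proof. by rewrite -scaleN1r eval2Z mulN1r. Qed.

Lemma eval2_0 e f : eval2 (0 : ext R n) e f = 0.
Proof. by rewrite -(scale0r 0) eval2Z mul0r. Qed.

End TwoForms.

Section Coframes.
Variable R : realType.
Implicit Types (V : set 'rV[R]_4) (x : 'rV[R]_4) (th : 'rV[R]_4 -> 'M[R[i]]_4).

Lemma pairing_frame th x i k : th x \in unitmx ->
  pairing (row i (th x)) (row k (frame th x)) = (i == k)%:R.
Proof.
move=> u; have := congr1 (fun M : 'M[R[i]]_4 => M i k) (mulmxV u).
rewrite !mxE => <-; apply: eq_bigr => j _; by rewrite /frame !mxE.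
Qed.

Lemma coframe_expand th x (a : 'rV[R[i]]_4) : th x \in unitmx ->
  a = \sum_k pairing a (row k (frame th x)) *: row k (th x).
Proof.
move=> u; rewrite -[LHS](mulmxKV u) {1}mulmx_sum_row; apply: eq_bigr => k _.
congr (_ *: _); rewrite mxE; apply: eq_bigr => j _; by rewrite /frame !mxE.
Qed.

Definition curv_comp th (Gam : connection R) x : tensor4 R := fun h j k l =>
  eval2 (curvature_form Gam h j x) (row k (frame th x)) (row l (frame th x)).

Lemma curvature_lower g th Gam x :
  curvature g th Gam x = lower (frame_metric g th x) (curv_comp th Gam x).
Proof. by []. Qed.

Lemma two_form_curvature V (Gam : connection R) h j x : open V ->
  (forall i j, csmooth_mx V (fun x => Gam x i j)) -> V x ->
  two_form (curvature_form Gam h j x).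
Proof.
move=> oV sG Vx; apply: two_formD; first exact: two_form_d_cov oV _ Vx.
by apply: two_form_sum => k; apply: two_form_cov.
Qed.

Section Bianchi.
Variables (V : set 'rV[R]_4) (th : 'rV[R]_4 -> 'M[R[i]]_4) (Gam : connection R).
Hypotheses (oV : open V) (cth : coframe V th).
Hypothesis sG : forall i j, csmooth_mx V (fun x => Gam x i j).
Hypothesis torsion_free : forall i x, V x ->
  d_cov (fun y => row i (th y)) x
    = - \sum_j (cov (Gam x i j) ∧ cov (row j (th x))).

(** Exterior derivative of the torsion-free equation: d d theta = 0, and the dtheta that appears in
    d(Gamma /\ theta) is replaced by the same equation. *)
Lemma bianchi_form i x : V x ->
  \sum_j curvature_form Gam i j x ∧ cov (row j (th x)) = 0.
Proof.
move=> Vx; have [sth _] := cth.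
have srow j : csmooth_mx V (fun y => row j (th y)) by apply: csmooth_mx_row.
have := ext_d_d_cov oV (srow i) Vx.
rewrite (ext_d_eq oV Vx (fun y Vy => torsion_free i Vy)).
have se j := esmooth_wedge oV (esmooth_cov oV (sG i j)) (esmooth_cov oV (srow j)).
rewrite (ext_dN oV (esmooth_sum _ _ oV se) Vx) (ext_d_sum _ _ oV se Vx).
move/eqP; rewrite oppr_eq0 => /eqP E0; rewrite -[RHS]E0 => {E0}.
have E j : ext_d (fun y => cov (Gam y i j) ∧ cov (row j (th y))) x =
    d_cov (fun y => Gam y i j) x ∧ cov (row j (th x)) +
    \sum_k cov (Gam x i j) ∧ cov (Gam x j k) ∧ cov (row k (th x)).
  rewrite (ext_d_cov_wedge oV (sG i j) (esmooth_cov oV (srow j)) Vx).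
  rewrite -/(d_cov _ _) torsion_free // wedgeNr opprK wedge_sumr.
  by congr (_ + _); apply: eq_bigr => k _; rewrite wedge_assoc.
under [RHS]eq_bigr do rewrite E.
rewrite big_split exchange_big /= -big_split; apply: eq_bigr => j _ /=.
by rewrite wedgeDl wedge_suml.
Qed.

Lemma bianchi_comp i k l m x : V x -> let r := curv_comp th Gam x in
  r i m k l + r i k l m + r i l m k = 0.
Proof.
move=> Vx r; have [_ uth] := cth; have u := uth x Vx.
pose e := fun k => row k (frame th x).
have := congr1 (fun w => iota_v (e l) (iota_v (e k) (iota_v (e m) w)))
  (bianchi_form i Vx).
rewrite !iota_v0 !iota_v_sum.
under eq_bigr => j _ do
  rewrite (iota_v_wedge3 _ _ _ _ (two_form_curvature i j oV sG Vx)).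
rewrite -scaler_suml => /eqP; rewrite scaler_eq0 (negPf (ext1_neq0 _ _)) orbF.
move/eqP => E0; rewrite -[RHS]E0 !big_split /= => {E0}.
have pick (F : 'I_4 -> R[i]) k0 : \sum_j pairing (row j (th x)) (e k0) * F j = F k0.
  rewrite (bigD1 k0) //= pairing_frame // eqxx mul1r big1 ?addr0 // => j /negPf jk.
  by rewrite pairing_frame // jk mul0r.
by rewrite !pick.
Qed.

End Bianchi.
End Coframes.

(** * Connection and curvature in a null cotetrad *)

Section NullCotetrads.
Variable R : realType.
Local Notation C := (R[i]).
Implicit Types (V : set 'rV[R]_4) (x : 'rV[R]_4) (th g : 'rV[R]_4 -> 'M[C]_4).
Local Notation H := (null_metric R).

Lemma null_metric_pullback (t : 'M[C]_4) :
  sym_prod (row i1 t) (row i2 t) - sym_prod (row i3 t) (row i4 t) = t^T *m H *m t.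
Proof.
apply/matrixP => a b; rewrite [RHS]mxE sum_I4 !mxE !sum_I4 !big_ord1 !null_metricE !mxE /=.
by ring.
Qed.

Lemma frame_metric_null V g vol th x : null_cotetrad V g vol th -> V x ->
  frame_metric g th x = H.
Proof.
move=> [[_ u] gE _] Vx; rewrite /frame_metric gE // null_metric_pullback /frame trmxK.
rewrite !mulmxA -trmx_mul mulmxV ?u // trmx1 mul1mx -mulmxA mulmxV ?u // mulmx1 //.
Qed.

(** The matrices of the conformal algebra of the null metric, A being the trace part. *)
Record null_connection (G : 'I_4 -> 'I_4 -> 'rV[C]_4) (A : 'rV[C]_4) : Prop := {
  G12 : G i1 i2 = 0; G21 : G i2 i1 = 0; G34 : G i3 i4 = 0; G43 : G i4 i3 = 0;
  G14 : G i1 i4 = G i3 i2; G41 : G i4 i1 = G i2 i3;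
  G24 : G i2 i4 = G i3 i1; G42 : G i4 i2 = G i1 i3;
  G22 : G i2 i2 = A - G i1 i1; G33 : G i3 i3 = A - G i4 i4
}.

(** The metric components are constant in a null cotetrad, so the metric equation becomes linear
    algebra; each relation is a multiple of a single component (i, j) of it. *)
Lemma weyl_null_connection V g vol A th Gam x : open V ->
  null_cotetrad V g vol th -> weyl_connection V g A th Gam -> V x ->
  null_connection (Gam x) (A x).
Proof.
move=> oV nct [_ met _] Vx.
have Gx y : V y -> frame_metric g th y = H := frame_metric_null nct.
have E i j m : \sum_k H i k * Gam x k j 0 m + \sum_k H j k * Gam x k i 0 m = H i j * A x 0 m.
  have := congr1 (fun v : 'rV[C]_4 => v 0 m) (met i j x Vx).
  have -> : d_fun (fun y => frame_metric g th y i j) x = 0.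
    rewrite -(d_fun_cst (H i j) x); apply/rowP => k; rewrite [LHS]mxE [RHS]mxE.
    by apply: (cpartial_eq k oV Vx) => y Vy; rewrite Gx.
  rewrite Gx // !mxE !summxE add0r -opprD => /oppr_inj <-.
  by congr (_ + _); apply: eq_bigr => k _; rewrite [RHS]mxE.
have ecomb c i j m a b : a - b = c * (H i i1 * Gam x i1 j 0 m + H i i2 * Gam x i2 j 0 m
    + H i i3 * Gam x i3 j 0 m + H i i4 * Gam x i4 j 0 m
    + (H j i1 * Gam x i1 i 0 m + H j i2 * Gam x i2 i 0 m
    + H j i3 * Gam x i3 i 0 m + H j i4 * Gam x i4 i 0 m) - H i j * A x 0 m) -> a = b.
  by have := E i j m; rewrite !sum_I4 => ->; rewrite subrr mulr0 => /eqP; rewrite subr_eq0 => /eqP.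
split; apply/rowP => m; rewrite ?mxE.
- by apply: (ecomb 1 i2 i2 m); rewrite !null_metricE /=; field.
- by apply: (ecomb 1 i1 i1 m); rewrite !null_metricE /=; field.
- by apply: (ecomb (- 1) i4 i4 m); rewrite !null_metricE /=; field.
- by apply: (ecomb (- 1) i3 i3 m); rewrite !null_metricE /=; field.
- by apply: (ecomb 2 i2 i4 m); rewrite !null_metricE /=; field.
- by apply: (ecomb (- 2) i1 i3 m); rewrite !null_metricE /=; field.
- by apply: (ecomb 2 i1 i4 m); rewrite !null_metricE /=; field.
- by apply: (ecomb (- 2) i2 i3 m); rewrite !null_metricE /=; field.
- by apply: (ecomb 2 i1 i2 m); rewrite !null_metricE /=; field.
- by apply: (ecomb (- 2) i3 i4 m); rewrite !null_metricE /=; field.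
Qed.

Section Curvature.
Variables (V : set 'rV[R]_4) (g : 'rV[R]_4 -> 'M[C]_4) (vol : 'rV[R]_4 -> C).
Variables (A : 'rV[R]_4 -> 'rV[C]_4) (th : 'rV[R]_4 -> 'M[C]_4) (Gam : connection R).
Hypotheses (oV : open V) (nct : null_cotetrad V g vol th).
Hypothesis (wc : weyl_connection V g A th Gam).

Let sG i j : csmooth_mx V (fun x => Gam x i j).
Proof. by have [] := wc. Qed.

Let nc x : V x -> null_connection (Gam x) (A x).
Proof. by move=> Vx; exact: (weyl_null_connection oV nct wc Vx). Qed.

Local Notation e th x k := (row k (frame th x)).

Lemma curv_compE x h j k l : curv_comp th Gam x h j k l =
  eval2 (d_cov (fun y => Gam y h j) x) (e th x k) (e th x l) +
  \sum_m (pairing (Gam x h m) (e th x k) * pairing (Gam x m j) (e th x l)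
        - pairing (Gam x h m) (e th x l) * pairing (Gam x m j) (e th x k)).
Proof.
rewrite /curv_comp eval2D eval2_sum; congr (_ + _); apply: eq_bigr => m _.
by rewrite eval2_cov.
Qed.

Let dG h j := fun x => d_cov (fun y => Gam y h j) x.

(** The relations between the connection forms hold on all of V and may be differentiated, and the
    quadratic terms satisfy them because the matrices in question form a Lie algebra. Eliminating A
    between the two diagonal relations gives the one for the index pair (3,3). *)
Lemma curv_null_symmetries x : V x ->
  weyl_curvature_symmetries (curv_comp th Gam x).
Proof.
move=> Vx; have [g12 g21 g34 g43 g14 g41 g24 g42 g22 g33] := nc Vx.
have d0 h j : (forall y, V y -> Gam y h j = 0) -> dG h j x = 0.
  by move=> z; rewrite /dG (d_cov_eq (b := fun=> 0) oV Vx z) d_cov_cst.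
have d12 : dG i1 i2 x = 0 by apply: d0 => y /nc [].
have d21 : dG i2 i1 x = 0 by apply: d0 => y /nc [].
have d34 : dG i3 i4 x = 0 by apply: d0 => y /nc [].
have d43 : dG i4 i3 x = 0 by apply: d0 => y /nc [].
have d14 : dG i1 i4 x = dG i3 i2 x by apply: d_cov_eq oV Vx _ => y /nc [].
have d41 : dG i4 i1 x = dG i2 i3 x by apply: d_cov_eq oV Vx _ => y /nc [].
have d24 : dG i2 i4 x = dG i3 i1 x by apply: d_cov_eq oV Vx _ => y /nc [].
have d42 : dG i4 i2 x = dG i1 i3 x by apply: d_cov_eq oV Vx _ => y /nc [].
have d33 : dG i3 i3 x = dG i1 i1 x + dG i2 i2 x - dG i4 i4 x.
  rewrite /dG -(d_covD oV (sG _ _) (sG _ _) Vx) -(d_covB oV _ (sG _ _) Vx); last first.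
    by apply: csmooth_mxD.
  apply: d_cov_eq oV Vx _ => y /nc [_ _ _ _ _ _ _ _ -> ->].
  by rewrite [X in _ = X - _]addrC subrK.
have rE k l h j := curv_compE x h j k l.
have a33 : Gam x i3 i3 = Gam x i1 i1 + Gam x i2 i2 - Gam x i4 i4.
  by rewrite g33 g22 [X in _ = X - _]addrC subrK.
have gE := (g12, g21, g34, g43, g14, g41, g24, g42, a33).
have dE := (d12, d21, d34, d43, d14, d41, d24, d42, d33).
have E := (eval2_0, eval2D, eval2N, pairing0, pairingD, pairingN).
split.
- by move=> h j k l; rewrite /curv_comp eval2_anti.
- by move=> k l; rewrite rE sum_I4 -/(dG _ _ _) !dE !gE !E; ring.
- by move=> k l; rewrite rE sum_I4 -/(dG _ _ _) !dE !gE !E; ring.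
- by move=> k l; rewrite rE sum_I4 -/(dG _ _ _) !dE !gE !E; ring.
- by move=> k l; rewrite rE sum_I4 -/(dG _ _ _) !dE !gE !E; ring.
- by move=> k l; rewrite !rE !sum_I4 -!/(dG _ _ _) !dE !gE !E; ring.
- by move=> k l; rewrite !rE !sum_I4 -!/(dG _ _ _) !dE !gE !E; ring.
- by move=> k l; rewrite !rE !sum_I4 -!/(dG _ _ _) !dE !gE !E; ring.
- by move=> k l; rewrite !rE !sum_I4 -!/(dG _ _ _) !dE !gE !E; ring.
- by move=> k l; rewrite !rE !sum_I4 -!/(dG _ _ _) !dE !gE !E; ring.
- move=> i k l m; have [cth _ _] := nct; have [_ _ tf] := wc.
  exact: (bianchi_comp oV cth sG tf i k l m Vx).
Qed.

Lemma curv_null_trace x k l : (forall y, V y -> A y = 0) -> V x ->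
  curv_comp th Gam x i2 i2 k l = - curv_comp th Gam x i1 i1 k l.
Proof.
move=> A0 Vx; have [g12 g21 g34 g43 g14 g41 g24 g42 g22 g33] := nc Vx.
have d22 : dG i2 i2 x = - dG i1 i1 x.
  rewrite /dG -(d_covN oV (sG _ _) Vx); apply: d_cov_eq oV Vx _ => y Vy.
  by have [_ _ _ _ _ _ _ _ -> _] := nc Vy; rewrite A0 // sub0r.
have E := (eval2_0, eval2D, eval2N, pairing0, pairingD, pairingN).
rewrite A0 // in g22 g33; rewrite !curv_compE !sum_I4 -!/(dG _ _ _) d22.
by rewrite g12 g21 g14 g24 g41 g42 g22 !E; ring.
Qed.

(* On the slice z = const, tw_E restricts to ez z and d(tw_E) contributes
   dz /\ qz z. *)
Definition ez (z : C) (y : 'rV[R]_4) : 'rV[C]_4 :=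
  - Gam y i3 i2 + z *: (Gam y i1 i1 - Gam y i4 i4) + z ^+ 2 *: Gam y i2 i3.
Definition qz (z : C) (y : 'rV[R]_4) : 'rV[C]_4 :=
  Gam y i1 i1 - Gam y i4 i4 + (2 * z) *: Gam y i2 i3.

End Curvature.
End NullCotetrads.

(** * Change of the Weyl form *)

Lemma sub_addD (U : zmodType) (u p q s t : U) :
  u - (p + s) - (q + t) = u - p - q - (s + t).
Proof. by rewrite !opprD !addrA (addrAC (u - p) (- s) (- q)). Qed.

(* [ring] compares atoms up to conversion, which is slow on matrix entries and
   indexed families; generalizing them first avoids this. *)
Ltac generalize_entries f :=
  repeat match goal with
  | |- context [f ?a ?b ?c ?d] => let v := fresh "t" in generalize (f a b c d); intro v
  | |- context [f ?a ?b ?c] => let v := fresh "t" in generalize (f a b c); intro v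
  | |- context [f ?a ?b] => let v := fresh "t" in generalize (f a b); intro v
  | |- context [f ?a] => let v := fresh "t" in generalize (f a); intro v
  end.

Lemma rvD (U : zmodType) n (u v : 'rV[U]_n) m : (u + v) 0 m = u 0 m + v 0 m.
Proof. by rewrite mxE. Qed.
Lemma rvN (U : zmodType) n (u : 'rV[U]_n) m : (- u) 0 m = - u 0 m.
Proof. by rewrite mxE. Qed.
Lemma rvZ (U : pzRingType) n (c : U) (u : 'rV[U]_n) m : (c *: u) 0 m = c * u 0 m.
Proof. by rewrite mxE. Qed.

Section ConnectionShift.
Variable R : realType.
Local Notation C := (R[i]).
Local Notation H := (null_metric R).
Implicit Types (V : set 'rV[R]_4) (x : 'rV[R]_4) (th g : 'rV[R]_4 -> 'M[C]_4).

(* Replacing the Weyl form A by A + a adds the 1-form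
   1/2 (delta^i_j a + a_j theta^i - a^i theta_j) to Gamma^i_j; these are its
   components, with a^i = g^ik a_k and g^ik = 4 H i k. *)
Definition shift_coef (c : 'I_4 -> C) (i j l : 'I_4) : C :=
  2^-1 * ((i == j)%:R * c l + (i == l)%:R * c j - 4 * (\sum_k H i k * c k) * H j l).

(** Symmetry in the lower indices: the shift leaves the connection torsion-free. *)
Lemma shift_coef_sym c i j l : shift_coef c i j l = shift_coef c i l j.
Proof.
rewrite /shift_coef (_ : H l j = H j l); first by ring.
by rewrite -{1}(null_metric_sym R) mxE.
Qed.

(** The shift contributes exactly g_ij a to the metric equation. The terms c_i H_jl and c_j H_il
    from the two sums cancel each other. *)
Lemma shift_coef_metric c i j l :
  \sum_k H i k * shift_coef c k j l + \sum_k H j k * shift_coef c k i l = H i j * c l.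
Proof.
have pick (a b : 'I_4) : \sum_k H a k * (k == b)%:R = H a b.
  rewrite (bigD1 b) //= eqxx mulr1 big1 ?addr0 // => k /negPf ->.
  by rewrite mulr0.
have raise (a : 'I_4) : \sum_k H a k * (4 * \sum_m H k m * c m) = c a.
  have := congr1 (fun M : 'M[C]_4 => (M *m (\col_k c k)) a 0) (null_metric_mul4 R).
  rewrite mul1mx -mulmxA !mxE => E; rewrite -[RHS]E; apply: eq_bigr => k _.
  rewrite [X in _ = _ * X]mxE; congr (_ * _); rewrite mulr_sumr; apply: eq_bigr => m _.
  by rewrite [X in _ = X * _]mxE [X in _ = _ * X]mxE mulrA.
have S a b : \sum_k H a k * shift_coef c k b l =
    2^-1 * (H a b * c l + H a l * c b - c a * H b l).
  rewrite -[H a b]pick -[H a l]pick -[in RHS](raise a) !mulr_suml.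
  rewrite -big_split -sumrB mulr_sumr; apply: eq_bigr => k _ /=.
  by rewrite /shift_coef; ring.
rewrite !S (_ : H j i = H i j); last by rewrite -{1}(null_metric_sym R) mxE.
by field.
Qed.

Definition coef (th : 'rV[R]_4 -> 'M[C]_4) (a : 'rV[R]_4 -> 'rV[C]_4) (y : 'rV[R]_4)
  (k : 'I_4) : C := pairing (a y) (row k (frame th y)).

Definition conn_shift th (a : 'rV[R]_4 -> 'rV[C]_4) (Gam : connection R) : connection R :=
  fun y i j => Gam y i j + \sum_l shift_coef (coef th a y) i j l *: row l (th y).

Lemma shift_coefE c i j l : shift_coef c i j l =
  2^-1 * ((i == j)%:R * c l + (i == l)%:R * c j
    - 4 * (H i i1 * c i1 + H i i2 * c i2 + H i i3 * c i3 + H i i4 * c i4) * H j l).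
Proof. by rewrite /shift_coef sum_I4. Qed.

Lemma shift_coef32 c : [/\ shift_coef c i3 i2 i1 = 2^-1 * c i4, shift_coef c i3 i2 i2 = 0,
  shift_coef c i3 i2 i3 = 2^-1 * c i2 & shift_coef c i3 i2 i4 = 0].
Proof. by split; rewrite shift_coefE !null_metricE /=; field. Qed.

Lemma shift_coef23 c : [/\ shift_coef c i2 i3 i1 = 0, shift_coef c i2 i3 i2 = 2^-1 * c i3,
  shift_coef c i2 i3 i3 = 0 & shift_coef c i2 i3 i4 = 2^-1 * c i1].
Proof. by split; rewrite shift_coefE !null_metricE /=; field. Qed.

Lemma shift_coef11 c : [/\ shift_coef c i1 i1 i1 = c i1, shift_coef c i1 i1 i2 = 0,
  shift_coef c i1 i1 i3 = 2^-1 * c i3 & shift_coef c i1 i1 i4 = 2^-1 * c i4].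
Proof. by split; rewrite shift_coefE !null_metricE /=; field. Qed.

Lemma shift_coef44 c : [/\ shift_coef c i4 i4 i1 = 2^-1 * c i1,
  shift_coef c i4 i4 i2 = 2^-1 * c i2, shift_coef c i4 i4 i3 = 0 & shift_coef c i4 i4 i4 = c i4].
Proof. by split; rewrite shift_coefE !null_metricE /=; field. Qed.

Lemma csmooth_coef V th a k : open V -> coframe V th -> csmooth_mx V a ->
  csmooth V (fun y => coef th a y k).
Proof.
move=> oV [sth uth] sa; rewrite /coef /pairing; apply: csmooth_sum => // l _.
apply: csmoothM => //.
under eq_fun do rewrite !mxE; exact: (csmooth_mx_inv oV sth uth).
Qed.

Lemma csmooth_shift_coef V th a i j l : open V -> coframe V th -> csmooth_mx V a ->
  csmooth V (fun y => shift_coef (coef th a y) i j l).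
Proof.
move=> oV cth sa; have sc k := csmooth_coef k oV cth sa.
have k1 (c : C) : csmooth V (fun _ => c) := csmooth_cst V c.
rewrite /shift_coef; apply: csmoothM => //; apply: csmoothB => //.
  by apply: csmoothD => //; apply: csmoothM.
apply: csmoothM => //; apply: csmoothM => //.
by apply: csmooth_sum => // m _; apply: csmoothM.
Qed.

Lemma weyl_connection_shift V g vol A th Gam a : open V ->
  null_cotetrad V g vol th -> weyl_connection V g A th Gam -> csmooth_mx V a ->
  weyl_connection V g (fun y => A y + a y) th (conn_shift th a Gam).
Proof.
move=> oV nct [sG met tf] sa; have [cth _ _] := nct; have [sth uth] := cth.
split.
- move=> i j; apply: csmooth_mxD => //; apply: csmooth_mx_sum => // l.
  apply: csmooth_mxZ => //; first exact: csmooth_shift_coef.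
  exact: csmooth_mx_row.
- move=> i j x Vx; have := met i j x Vx.
  rewrite !(frame_metric_null nct Vx) => E; rewrite scalerDr opprD -E.
  under eq_bigr do rewrite scalerDr; under [X in _ - X = _]eq_bigr do rewrite scalerDr.
  rewrite !big_split /=.
  have S k0 j0 : \sum_k H k0 k *: (\sum_l shift_coef (coef th a x) k j0 l *: row l (th x)) =
      \sum_l (\sum_k H k0 k * shift_coef (coef th a x) k j0 l) *: row l (th x).
    under eq_bigr do rewrite scaler_sumr; rewrite exchange_big; apply: eq_bigr => l _ /=.
    by rewrite scaler_suml; apply: eq_bigr => k _; rewrite scalerA.
  have T : H i j *: a x = \sum_l (\sum_k H i k * shift_coef (coef th a x) k j l) *: row l (th x)
      + \sum_l (\sum_k H j k * shift_coef (coef th a x) k i l) *: row l (th x).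
    rewrite -big_split {1}(coframe_expand (a x) (uth x Vx)) scaler_sumr.
    by apply: eq_bigr => l _; rewrite /= -scalerDl shift_coef_metric scalerA.
  by rewrite T !S sub_addD.
- move=> i x Vx; rewrite tf // [X in _ = - X](_ : _ =
      \sum_j (cov (Gam x i j) ∧ cov (row j (th x)))) //.
  rewrite /conn_shift; under eq_bigr do rewrite covD wedgeDl; rewrite big_split /=.
  rewrite [X in _ + X](_ : _ = 0) ?addr0 //.
  pose T := \sum_j \sum_l shift_coef (coef th a x) i j l *:
     (cov (row l (th x)) ∧ cov (row j (th x))).
  rewrite (_ : \sum_j _ = T); last first.
    apply: eq_bigr => j _; rewrite cov_sum wedge_suml; apply: eq_bigr => l _.
    by rewrite covZ wedgeZl.
  apply: eq_oppr0; rewrite {1}/T exchange_big -sumrN; apply: eq_bigr => j _.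
  rewrite -sumrN; apply: eq_bigr => l _ /=; rewrite cov_wedge_anti scalerN.
  by rewrite shift_coef_sym.
Qed.

(** [qz] is the derivative of [ez] in z, and the quadratic terms of the three curvature forms
    assemble into [qz] /\ [ez]. This is what dE becomes when dz is replaced by -e_z, as it may be
    modulo E. *)
Lemma curv_z_eval V g vol A th Gam x z k l : open V -> null_cotetrad V g vol th ->
  weyl_connection V g A th Gam -> V x ->
  curv_z (curv_comp th Gam x) z k l =
  eval2 (d_cov (ez Gam z) x + cov (qz Gam z x) ∧ cov (ez Gam z x))
    (row k (frame th x)) (row l (frame th x)).
Proof.
move=> oV nct wc Vx; have [sG _ _] := wc.
have [g12 g21 g34 g43 g14 g41 g24 g42 g22 g33] := weyl_null_connection oV nct wc Vx.
have dez : d_cov (ez Gam z) x = - d_cov (fun y => Gam y i3 i2) x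
    + z *: (d_cov (fun y => Gam y i1 i1) x - d_cov (fun y => Gam y i4 i4) x)
    + z ^+ 2 *: d_cov (fun y => Gam y i2 i3) x.
  have dZ c a : csmooth_mx V a -> d_cov (fun y => c *: a y) x = c *: d_cov a x.
    by move=> sa; exact: (d_cov_scale c oV sa Vx).
  rewrite /ez; rewrite !(d_covD oV _ _ Vx, d_covB oV _ _ Vx, d_covN oV _ Vx, dZ) //;
  do ?[apply: csmooth_mxD|apply: csmooth_mxB|apply: csmooth_mxN|apply: csmooth_mxZ] => //;
  exact: csmooth_cst.
have [p pE] : exists p, forall i j m, pairing (Gam x i j) (row m (frame th x)) = p i j m.
  by exists (fun i j m => pairing (Gam x i j) (row m (frame th x))).
have [D DE] : exists D, forall i j, eval2 (d_cov (fun y => Gam y i j) x)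
    (row k (frame th x)) (row l (frame th x)) = D i j.
  by exists (fun i j => eval2 (d_cov (fun y => Gam y i j) x)
    (row k (frame th x)) (row l (frame th x))).
rewrite dez /curv_z !curv_compE !sum_I4 /qz /ez !(eval2D, eval2N, eval2Z, eval2_cov).
rewrite !(pairingD, pairingN, pairingZ).
rewrite g12 g21 g34 g43 g14 g41 g24 g42 g22 g33 !(pairing0, pairingD, pairingN).
rewrite !pE !DE; generalize_entries p; generalize_entries D.
by generalize_entries (@pairing R 4); ring.
Qed.

(* Elimination in the quotient by the ideal of L = N + zP and F = M + zK: the
   four equations are the first structure equations of a null cotetrad. *)
Lemma structure_mod_ideal (psi : ext R 4 -> C) (z : C) (G : 'I_4 -> 'I_4 -> 'rV[C]_4)
    (A : 'rV[C]_4) (t : 'I_4 -> 'rV[C]_4) (dt : 'I_4 -> ext R 4) :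
  (forall u v, psi (u + v) = psi u + psi v) -> (forall c u, psi (c *: u) = c * psi u) ->
  (forall u, psi (cov u ∧ cov (t i3 + z *: t i2)) = 0) ->
  (forall u, psi (cov u ∧ cov (t i1 + z *: t i4)) = 0) ->
  null_connection G A -> (forall i, dt i = - \sum_j (cov (G i j) ∧ cov (t j))) ->
  let e := - G i3 i2 + z *: (G i1 i1 - G i4 i4) + z ^+ 2 *: G i2 i3 in
  psi (dt i3 + z *: dt i2) = psi (cov e ∧ cov (t i2)) /\
  psi (dt i1 + z *: dt i4) = psi (cov e ∧ cov (t i4)).
Proof.
move=> pD pZ pL pF [g12 g21 g34 g43 g14 g41 g24 g42 g22 g33] tf e.
have pN u : psi (- u) = - psi u by rewrite -scaleN1r pZ mulN1r.
have p0 : psi 0 = 0 by rewrite -(scale0r 0) pZ mul0r.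
have [b bE] : exists b, forall u v, psi (cov u ∧ cov v) = b u v.
  by exists (fun u v => psi (cov u ∧ cov v)).
have bD u v w : b (u + v) w = b u w + b v w by rewrite -!bE covD wedgeDl pD.
have bZ c u w : b (c *: u) w = c * b u w by rewrite -!bE covZ wedgeZl pZ.
have bN u w : b (- u) w = - b u w by rewrite -scaleN1r bZ mulN1r.
have b0 w : b 0 w = 0 by rewrite -(scale0r 0) bZ mul0r.
have b3 u : b u (t i3) = - z * b u (t i2).
  have := pL u; rewrite covD covZ wedgeDr wedgeZr pD pZ !bE => /eqP.
  by rewrite addr_eq0 => /eqP ->; rewrite mulNr.
have b1 u : b u (t i1) = - z * b u (t i4).
  have := pF u; rewrite covD covZ wedgeDr wedgeZr pD pZ !bE => /eqP.
  by rewrite addr_eq0 => /eqP ->; rewrite mulNr.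
have pt i : psi (dt i) = - (b (G i i1) (t i1) + b (G i i2) (t i2)
    + b (G i i3) (t i3) + b (G i i4) (t i4)).
  rewrite tf pN (big_morph psi pD p0) sum_I4 !bE //.
have pDZ i j : psi (dt i + z *: dt j) = - (b (G i i1) (t i1) + b (G i i2) (t i2)
    + b (G i i3) (t i3) + b (G i i4) (t i4)) + z * - (b (G j i1) (t i1)
    + b (G j i2) (t i2) + b (G j i3) (t i3) + b (G j i4) (t i4)).
  by rewrite pD pZ !pt.
split; apply: (etrans (pDZ _ _)); apply: (etrans _ (esym (bE _ _))); rewrite /e;
  rewrite ?g12 ?g21 ?g34 ?g43 ?g14 ?g41 ?g24 ?g42 ?g22 ?g33 !b0 !b3 !b1 !(bD, bN, bZ);
  by generalize_entries b; ring.
Qed.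

Definition sd_eval th x (z : C) (w : ext R 4) : C :=
  sd_part z (fun k l => eval2 w (row k (frame th x)) (row l (frame th x))).

Lemma sd_evalD th x z u v : sd_eval th x z (u + v) = sd_eval th x z u + sd_eval th x z v.
Proof.
rewrite /sd_eval /sd_part !eval2D; generalize_entries (@eval2 R 4); ring.
Qed.

Lemma sd_evalZ th x z c u : sd_eval th x z (c *: u) = c * sd_eval th x z u.
Proof.
rewrite /sd_eval /sd_part !eval2Z; generalize_entries (@eval2 R 4); ring.
Qed.

(** The vectors zm - k and zn - p lie in the kernel of N + zP, and likewise of M + zK in the next
    lemma. *)
Lemma sd_eval_L th x z u : th x \in unitmx ->
  sd_eval th x z (cov u ∧ cov (row i3 (th x) + z *: row i2 (th x))) = 0.
Proof.
move=> ux; rewrite /sd_eval /sd_part !eval2_cov !pairingD !pairingZ !pairing_frame //=.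
by generalize_entries (@pairing R 4); ring.
Qed.

Lemma sd_eval_F th x z u : th x \in unitmx ->
  sd_eval th x z (cov u ∧ cov (row i1 (th x) + z *: row i4 (th x))) = 0.
Proof.
move=> ux; rewrite /sd_eval /sd_part !eval2_cov !pairingD !pairingZ !pairing_frame //=.
by generalize_entries (@pairing R 4); ring.
Qed.

(** The differentials of the coefficients al and be appear only multiplied by L or F and are lost.
    What remains of the new terms is al dL + be dF, equal to e /\ (al P + be K) modulo the ideal,
    and it is cancelled by the change of q, which contributes (al P + be K) /\ e. *)
Lemma sd_shift_algebra (psi : ext R 4 -> C) (L F P K e q da db : 'rV[C]_4)
    (DL DF De : ext R 4) (al be al1 be1 : C) :
  (forall u v, psi (u + v) = psi u + psi v) -> (forall c u, psi (c *: u) = c * psi u) ->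
  (forall u, psi (cov u ∧ cov L) = 0) -> (forall u, psi (cov u ∧ cov F) = 0) ->
  psi DL = psi (cov e ∧ cov P) -> psi DF = psi (cov e ∧ cov K) ->
  psi (De + (cov da ∧ cov L + al *: DL + (cov db ∧ cov F + be *: DF))
    + cov (q + (al1 *: L + al *: P + (be1 *: F + be *: K)))
        ∧ cov (e + (al *: L + be *: F))) = psi (De + cov q ∧ cov e).
Proof.
move=> pD pZ.
have [b bE] : exists b, forall u v, psi (cov u ∧ cov v) = b u v.
  by exists (fun u v => psi (cov u ∧ cov v)).
have bDl u v w : b (u + v) w = b u w + b v w by rewrite -!bE covD wedgeDl pD.
have bZl c u w : b (c *: u) w = c * b u w by rewrite -!bE covZ wedgeZl pZ.
have bDr u v w : b w (u + v) = b w u + b w v by rewrite -!bE covD wedgeDr pD.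
have bZr c u w : b w (c *: u) = c * b w u by rewrite -!bE covZ wedgeZr pZ.
have ba u v : b u v = - b v u by rewrite -!bE cov_wedge_anti -scaleN1r pZ mulN1r.
move=> pL pF hL hF; have bL u : b u L = 0 by rewrite -bE.
have bF u : b u F = 0 by rewrite -bE.
rewrite 6!pD 2!pZ hL hF !bE !(bDr, bZr) !bL !bF !(bDl, bZl).
rewrite (ba L) (ba F) (ba P) (ba K) bL bF.
by generalize_entries b; ring.
Qed.

Section Invariance.
Variables (V : set 'rV[R]_4) (g : 'rV[R]_4 -> 'M[C]_4) (vol : 'rV[R]_4 -> C).
Variables (A a : 'rV[R]_4 -> 'rV[C]_4) (th : 'rV[R]_4 -> 'M[C]_4) (Gam : connection R).
Hypotheses (oV : open V) (nct : null_cotetrad V g vol th).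
Hypotheses (wc : weyl_connection V g A th Gam) (sa : csmooth_mx V a).
Variable z : C.

Let c := coef th a.
Let alpha y := 2^-1 * (z * c y i3 - c y i2).
Let beta y := 2^-1 * (z * c y i1 - c y i4).
Let rowL y := row i3 (th y) + z *: row i2 (th y).
Let rowF y := row i1 (th y) + z *: row i4 (th y).

(** The change of connection affects e_z only within the span of N + zP and M + zK; [alpha] and
    [beta] are the resulting coefficients. *)
Let ez_shift y : ez (conn_shift th a Gam) z y =
  ez Gam z y + (alpha y *: rowL y + beta y *: rowF y).
Proof.
rewrite /ez /conn_shift !sum_I4 -/c.
have [-> -> -> ->] := shift_coef32 (c y); have [-> -> -> ->] := shift_coef23 (c y).
have [-> -> -> ->] := shift_coef11 (c y); have [-> -> -> ->] := shift_coef44 (c y).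
rewrite /alpha /beta /rowL /rowF; generalize_entries (Gam y).
generalize_entries (@row C 4 4); generalize_entries (c y).
apply/rowP => m; rewrite !(rvD, rvN, rvZ).
by generalize_entries (@fun_of_matrix C 1 4); field.
Qed.

(** This is the z-derivative of [ez_shift]: [rowL] and [rowF] contribute P and K, while [alpha] and
    [beta] contribute the halves of c_3 and c_1. *)
Let qz_shift y : qz (conn_shift th a Gam) z y =
  qz Gam z y + ((2^-1 * c y i3) *: rowL y + alpha y *: row i2 (th y)
    + ((2^-1 * c y i1) *: rowF y + beta y *: row i4 (th y))).
Proof.
rewrite /qz /conn_shift !sum_I4 -/c.
have [-> -> -> ->] := shift_coef23 (c y).
have [-> -> -> ->] := shift_coef11 (c y); have [-> -> -> ->] := shift_coef44 (c y).
rewrite /alpha /beta /rowL /rowF; generalize_entries (Gam y).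
generalize_entries (@row C 4 4); generalize_entries (c y).
apply/rowP => m; rewrite !(rvD, rvN, rvZ).
by generalize_entries (@fun_of_matrix C 1 4); field.
Qed.

Lemma sd_curv_z_shift x : V x ->
  sd_part z (curv_z (curv_comp th (conn_shift th a Gam) x) z) =
  sd_part z (curv_z (curv_comp th Gam x) z).
Proof.
move=> Vx; have wc' := weyl_connection_shift oV nct wc sa.
have [cth _ _] := nct; have [sth uth] := cth; have u := uth x Vx.
have [sG _ tf] := wc.
have srow j : csmooth_mx V (fun y => row j (th y)) by apply: csmooth_mx_row.
have sc k : csmooth V (fun y => c y k) by apply: csmooth_coef.
have k1 (b : C) : csmooth V (fun _ => b) := csmooth_cst V b.
have sal : csmooth V alpha.
  by apply: csmoothM => //; apply: csmoothB => //; apply: csmoothM.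
have sbe : csmooth V beta.
  by apply: csmoothM => //; apply: csmoothB => //; apply: csmoothM.
have sL : csmooth_mx V rowL by apply: csmooth_mxD => //; apply: csmooth_mxZ.
have sF : csmooth_mx V rowF by apply: csmooth_mxD => //; apply: csmooth_mxZ.
have sez : csmooth_mx V (ez Gam z).
  by do ?[apply: csmooth_mxD|apply: csmooth_mxB|apply: csmooth_mxN|apply: csmooth_mxZ].
have dL : d_cov rowL x = d_cov (fun y => row i3 (th y)) x
    + z *: d_cov (fun y => row i2 (th y)) x.
  rewrite /rowL (d_covD oV (srow i3) (csmooth_mxZ oV (k1 z) (srow i2)) Vx).
  by congr (_ + _); exact: (d_cov_scale z oV (srow i2) Vx).
have dF : d_cov rowF x = d_cov (fun y => row i1 (th y)) x
    + z *: d_cov (fun y => row i4 (th y)) x.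
  rewrite /rowF (d_covD oV (srow i1) (csmooth_mxZ oV (k1 z) (srow i4)) Vx).
  by congr (_ + _); exact: (d_cov_scale z oV (srow i4) Vx).
have dez : d_cov (ez (conn_shift th a Gam) z) x = d_cov (ez Gam z) x
    + (cov (d_fun alpha x) ∧ cov (rowL x) + alpha x *: d_cov rowL x
    + (cov (d_fun beta x) ∧ cov (rowF x) + beta x *: d_cov rowF x)).
  rewrite (d_cov_eq oV Vx (fun y _ => ez_shift y)).
  have sLa := csmooth_mxZ oV sal sL; have sFb := csmooth_mxZ oV sbe sF.
  rewrite (d_covD oV sez (csmooth_mxD oV sLa sFb) Vx) (d_covD oV sLa sFb Vx).
  by congr (_ + (_ + _)); [exact: (d_covZ oV sal sL Vx)|exact: (d_covZ oV sbe sF Vx)].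
have E1 : sd_part z (curv_z (curv_comp th Gam x) z) =
    sd_eval th x z (d_cov (ez Gam z) x + cov (qz Gam z x) ∧ cov (ez Gam z x)).
  by rewrite /sd_part !(curv_z_eval z _ _ oV nct wc Vx).
have E2 : sd_part z (curv_z (curv_comp th (conn_shift th a Gam) x) z) =
    sd_eval th x z (d_cov (ez (conn_shift th a Gam) z) x
      + cov (qz (conn_shift th a Gam) z x) ∧ cov (ez (conn_shift th a Gam) z x)).
  by rewrite /sd_part !(curv_z_eval z _ _ oV nct wc' Vx).
rewrite E1 E2 dez ez_shift qz_shift.
pose psi := sd_eval th x z.
have pD : forall u v, psi (u + v) = psi u + psi v by apply: sd_evalD.
have pZ : forall c u, psi (c *: u) = c * psi u by apply: sd_evalZ.
have pL : forall u, psi (cov u ∧ cov (rowL x)) = 0 by move=> u'; apply: sd_eval_L.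
have pF : forall u, psi (cov u ∧ cov (rowF x)) = 0 by move=> u'; apply: sd_eval_F.
have [] := structure_mod_ideal pD pZ pL pF (weyl_null_connection oV nct wc Vx)
  (fun i => tf i x Vx).
rewrite -dL -dF => hL hF.
exact: (@sd_shift_algebra psi _ _ _ _ _ _ _ _ _ _ _ _ _ _ _ pD pZ pL pF hL hF).
Qed.

End Invariance.
End ConnectionShift.

(** * Change of coframe *)

Lemma cancel_terms (U : zmodType) (a1 a2 a3 a4 a5 : U) :
  a2 - a4 - a5 = a1 + a2 + a3 + (- a4 - a3) + (- a5 - a1).
Proof.
rewrite [- a4 - a3]addrC (addrA (a1 + a2 + a3)) addrK [- a5 - a1]addrC.
by rewrite (addrA _ (- a1)) [a1 + a2]addrC; congr (_ - a5); rewrite addrAC addrK.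
Qed.

Lemma cancel_terms2 (U : zmodType) (d' d w w' t : U) :
  w + d' = w' + d -> d' + (t - w' + w) = d + t.
Proof.
move=> E; rewrite (addrAC t) addrA [t + w]addrC (addrA d') [d' + w]addrC E.
by rewrite -addrA [w' + d]addrC -addrA [w' + _]addrC subrK.
Qed.

Section CoframeChange0.
Variables (R : realType) (n : nat).

Lemma eval2_suml (w : ext R n) I (r : seq I) (c : I -> R[i]) (E : I -> 'rV[R[i]]_n) f :
  eval2 w (\sum_(k <- r) c k *: E k) f = \sum_(k <- r) c k * eval2 w (E k) f.
Proof.
elim: r => [|k r IH].
  rewrite !big_nil /eval2 big1 // => a _; rewrite big1 // => b _.
  by rewrite !mxE !mul0r subrr mulr0.
rewrite !big_cons -IH; move: (\sum_(j <- r) _) => X.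
rewrite /eval2 mulr_sumr -big_split; apply: eq_bigr => a _ /=.
rewrite mulr_sumr -big_split; apply: eq_bigr => b _ /=.
by rewrite !mxE; ring.
Qed.

Lemma eval2_sumr (w : ext R n) I (r : seq I) (c : I -> R[i]) (E : I -> 'rV[R[i]]_n) f :
  eval2 w f (\sum_(k <- r) c k *: E k) = \sum_(k <- r) c k * eval2 w f (E k).
Proof.
rewrite eval2_anti eval2_suml -sumrN; apply: eq_bigr => k _.
by rewrite (eval2_anti w f) mulrN.
Qed.

End CoframeChange0.

Section CoframeChange.
Variable R : realType.
Local Notation C := (R[i]).
Implicit Types (V : set 'rV[R]_4) (x : 'rV[R]_4) (th g : 'rV[R]_4 -> 'M[C]_4).

Definition partial_mx (m : 'I_4) p q (B : 'rV[R]_4 -> 'M[C]_(p, q)) x : 'M[C]_(p, q) :=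
  \matrix_(i, j) cpartial m (fun y => B y i j) x.

Lemma partial_mxM V m p q r (B : 'rV[R]_4 -> 'M[C]_(p, q)) (D : 'rV[R]_4 -> 'M[C]_(q, r)) x :
  open V -> csmooth_mx V B -> csmooth_mx V D -> V x ->
  partial_mx m (fun y => B y *m D y) x = partial_mx m B x *m D x + B x *m partial_mx m D x.
Proof.
move=> oV sB sD Vx; apply/matrixP => i j; rewrite !mxE -big_split /=.
rewrite (_ : (fun y => (B y *m D y) i j) = (fun y => \sum_k B y i k * D y k j)); last first.
  by apply/funext => y; rewrite mxE.
rewrite (cpartial_sum _ _ oV _ Vx) => [|k _]; last by apply: csmoothM.
by apply: eq_bigr => k _; rewrite !mxE (cpartialM _ oV (sB i k) (sD k j) Vx).
Qed.

Lemma partial_mx_tr m p q (B : 'rV[R]_4 -> 'M[C]_(p, q)) x :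
  partial_mx m (fun y => (B y)^T) x = (partial_mx m B x)^T.
Proof.
apply/matrixP => i j; rewrite !mxE; congr (cpartial m _ x).
by apply/funext => y; rewrite mxE.
Qed.

Lemma partial_mx_eq V m p q (B D : 'rV[R]_4 -> 'M[C]_(p, q)) x : open V -> V x ->
  (forall y, V y -> B y = D y) -> partial_mx m B x = partial_mx m D x.
Proof.
move=> oV Vx BD; apply/matrixP => i j; rewrite !mxE.
by apply: cpartial_eq oV Vx _ => y /BD ->.
Qed.

Definition conn_mx (Gam : connection R) x (m : 'I_4) : 'M[C]_4 :=
  \matrix_(i, j) Gam x i j 0 m.

(** In matrix form, one coordinate direction m at a time, a change of coframe acts by congruence. *)
Lemma weyl_metric_mx g (A : 'rV[R]_4 -> 'rV[C]_4) th (Gam : connection R) x :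
  let G := frame_metric g th in
  (forall i j, d_fun (fun y => G y i j) x - \sum_k G x i k *: Gam x k j
          - \sum_k G x j k *: Gam x k i = - (G x i j *: A x)) <->
  (forall m, partial_mx m G x - G x *m conn_mx Gam x m - (G x *m conn_mx Gam x m)^T
     = - (A x 0 m *: G x)).
Proof.
move=> G; split => E.
  move=> m; apply/matrixP => i j; have := congr1 (fun u : 'rV[C]_4 => u 0 m) (E i j).
  rewrite !mxE !summxE mulrC => <-; congr (_ - _ - _).
    by apply: eq_bigr => k _; rewrite !mxE.
  by apply: eq_bigr => k _; rewrite !mxE.
move=> i j; apply/rowP => m; have := congr1 (fun B : 'M[C]_4 => B i j) (E m).
rewrite !mxE !summxE mulrC => <-; congr (_ - _ - _).
  by apply: eq_bigr => k _; rewrite !mxE.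
by apply: eq_bigr => k _; rewrite !mxE.
Qed.

(** In matrix notation: Gamma' S = S Gamma - dS together with its exterior derivative gives Omega' S
    = S Omega. The two identities are separate hypotheses, so that only algebra is left here. *)
Lemma curvature_change_algebra (S : 'I_4 -> 'I_4 -> C) (G' G dS : 'I_4 -> 'I_4 -> 'rV[C]_4)
    (D' D : 'I_4 -> 'I_4 -> ext R 4) i m :
  (forall i m, \sum_j S j m *: G' i j = \sum_k S i k *: G k m - dS i m) ->
  \sum_j (cov (dS j m) ∧ cov (G' i j) + S j m *: D' i j) =
    \sum_k (cov (dS i k) ∧ cov (G k m) + S i k *: D k m) ->
  \sum_j S j m *: (D' i j + \sum_k cov (G' i k) ∧ cov (G' k j)) =
    \sum_k S i k *: (D k m + \sum_l cov (G k l) ∧ cov (G l m)).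
Proof.
move=> cE dE.
have W1 : \sum_j S j m *: (\sum_k cov (G' i k) ∧ cov (G' k j)) =
    \sum_k cov (G' i k) ∧ cov (\sum_l S k l *: G l m)
    - \sum_k cov (G' i k) ∧ cov (dS k m).
  rewrite -sumrB.
  transitivity (\sum_k cov (G' i k) ∧ cov (\sum_j S j m *: G' k j)); last first.
    by apply: eq_bigr => k _; rewrite cE covB wedgeDr wedgeNr.
  under eq_bigr do rewrite scaler_sumr; rewrite exchange_big; apply: eq_bigr => k _ /=.
  by rewrite cov_sum wedge_sumr; apply: eq_bigr => j _; rewrite covZ wedgeZr.
have W2 : \sum_k cov (G' i k) ∧ cov (\sum_l S k l *: G l m) =
    \sum_k S i k *: (\sum_l cov (G k l) ∧ cov (G l m))
    - \sum_l cov (dS i l) ∧ cov (G l m).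
  transitivity (\sum_l cov (\sum_k S k l *: G' i k) ∧ cov (G l m)).
    under eq_bigr do rewrite cov_sum wedge_sumr; rewrite exchange_big.
    apply: eq_bigr => l _ /=; rewrite cov_sum wedge_suml; apply: eq_bigr => k _.
    by rewrite !covZ wedgeZl wedgeZr.
  have -> : \sum_k S i k *: (\sum_l cov (G k l) ∧ cov (G l m)) =
      \sum_l cov (\sum_k S i k *: G k l) ∧ cov (G l m).
    under eq_bigr do rewrite scaler_sumr; rewrite exchange_big.
    apply: eq_bigr => l _ /=; rewrite cov_sum wedge_suml; apply: eq_bigr => k _.
    by rewrite covZ wedgeZl.
  by rewrite -sumrB; apply: eq_bigr => l _; rewrite cE covB wedgeDl wedgeNl.
have anti : \sum_k cov (G' i k) ∧ cov (dS k m) = - \sum_j cov (dS j m) ∧ cov (G' i j).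
  by rewrite -sumrN; apply: eq_bigr => j _; rewrite cov_wedge_anti.
transitivity (\sum_j S j m *: D' i j + \sum_j S j m *: (\sum_k cov (G' i k) ∧ cov (G' k j))).
  by rewrite -big_split; apply: eq_bigr => j _; rewrite /= scalerDr.
transitivity (\sum_k S i k *: D k m + \sum_k S i k *: (\sum_l cov (G k l) ∧ cov (G l m)));
  last by rewrite -big_split; apply: eq_bigr => j _; rewrite /= scalerDr.
rewrite W1 W2 anti opprK; apply: cancel_terms2.
by move: dE; rewrite 2!big_split.
Qed.

Section Change.
Variables (V : set 'rV[R]_4) (g : 'rV[R]_4 -> 'M[C]_4) (A : 'rV[R]_4 -> 'rV[C]_4).
Variables (th th' : 'rV[R]_4 -> 'M[C]_4) (Gam : connection R).
Hypotheses (oV : open V) (cth : coframe V th) (cth' : coframe V th').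
Hypotheses (sg : csmooth_mx V g) (gsym : forall x, V x -> (g x)^T = g x).
Hypothesis wc : weyl_connection V g A th Gam.

Definition coframe_quotient (t t' : 'rV[R]_4 -> 'M[C]_4) y := t' y *m invmx (t y).
Let S := coframe_quotient th th'.
Let Si := coframe_quotient th' th.

(** The gauge transformation Gamma' = (S Gamma - dS) S^-1, where theta' = S theta and the quotient
    with exchanged arguments is S^-1. *)
Definition conn_change (t t' : 'rV[R]_4 -> 'M[C]_4) (Ga : connection R) : connection R :=
  fun y i j => \sum_k coframe_quotient t' t y k j *:
    (\sum_l coframe_quotient t t' y i l *: Ga y l k
      - d_fun (fun w => coframe_quotient t t' w i k) y).
Let Gam' := conn_change th th' Gam.

Let u x : V x -> th x \in unitmx. Proof. by case: cth => _; apply. Qed.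
Let u' x : V x -> th' x \in unitmx. Proof. by case: cth' => _; apply. Qed.

Let SiS x : V x -> Si x *m S x = 1%:M.
Proof. by move=> Vx; rewrite /S /Si /coframe_quotient mulmxA mulmxKV ?u' // mulmxV ?u. Qed.

Let SSi x : V x -> S x *m Si x = 1%:M.
Proof. by move=> Vx; rewrite /S /Si /coframe_quotient mulmxA mulmxKV ?u // mulmxV ?u'. Qed.

Let thE x : V x -> th' x = S x *m th x.
Proof. by move=> Vx; rewrite /S /coframe_quotient mulmxKV ?u. Qed.

Let sS : csmooth_mx V S.
Proof.
have [sth uth] := cth; have [sth' _] := cth'.
by apply: csmooth_mxM => //; apply: csmooth_mx_inv.
Qed.

Let sSi : csmooth_mx V Si.
Proof.
have [sth uth] := cth; have [sth' uth'] := cth'.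
by apply: csmooth_mxM => //; apply: csmooth_mx_inv.
Qed.

Let sG i j : csmooth_mx V (fun x => Gam x i j).
Proof. by case: wc => s _ _; apply: s. Qed.

Let sG' i j : csmooth_mx V (fun x => Gam' x i j).
Proof.
apply: csmooth_mx_sum => // k; apply: csmooth_mxZ => //.
apply: csmooth_mxB => //; last by apply: csmooth_mx_d_fun; apply: sS.
by apply: csmooth_mx_sum => // l; apply: csmooth_mxZ => //; apply: sS.
Qed.

(** Multiplied by S on the right, the transformation law is free of S^-1, so that its exterior
    derivative involves no derivative of an inverse. *)
Lemma conn_changeE x i m : V x -> \sum_j S x j m *: Gam' x i j =
  \sum_k S x i k *: Gam x k m - d_fun (fun w => S w i m) x.
Proof.
move=> Vx; rewrite /Gam' /conn_change; under eq_bigr do rewrite scaler_sumr.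
rewrite exchange_big /=.
under eq_bigr => k _ do (under eq_bigr do rewrite scalerA mulrC; rewrite -scaler_suml).
have E k : \sum_j coframe_quotient th' th x k j * S x j m = (k == m)%:R.
  by have := congr1 (fun B : 'M[C]_4 => B k m) (SiS Vx); rewrite !mxE.
rewrite (bigD1 m) //= E eqxx scale1r [X in _ + X = _]big1 ?addr0 // => k /negPf km.
by rewrite E km scale0r.
Qed.

Let dS x i m : 'rV[C]_4 := d_fun (fun w => S w i m) x.

Lemma frame_metric_change x : V x ->
  frame_metric g th x = (S x)^T *m frame_metric g th' x *m S x.
Proof.
move=> Vx; rewrite /frame_metric /frame !trmxK.
have <- : invmx (th' x) *m S x = invmx (th x).
  by rewrite /S /coframe_quotient mulmxA mulVmx ?u' // mul1mx.
by rewrite trmx_mul !mulmxA.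
Qed.

(** For the metric equation, G = S^T G' S is differentiated and S Gamma = Gamma' S + dS inserted;
    all terms in dS cancel, and what is left is the new equation up to congruence by the invertible
    S. The torsion equation is d(S theta) = dS /\ theta + S dtheta. *)
Lemma weyl_connection_change : weyl_connection V g A th' Gam'.
Proof.
have [_ met tf] := wc; have [sth uth] := cth; have [sth' uth'] := cth'.
split; first exact: sG'.
- move=> i j x Vx; move: i j.
  have /weyl_metric_mx E := fun i j => met i j x Vx.
  apply/weyl_metric_mx => m; move: (E m).
  pose G' := frame_metric g th'.
  have sfr : csmooth_mx V (frame th').
    by apply: csmooth_mx_tr => //; apply: csmooth_mx_inv.
  have sGG' : csmooth_mx V G'.
    by do 2?apply: csmooth_mxM => //; apply: csmooth_mx_tr.
  have sSt : csmooth_mx V (fun y => (S y)^T) by apply: csmooth_mx_tr.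
  rewrite [partial_mx m _ x](partial_mx_eq m oV Vx frame_metric_change).
  rewrite (frame_metric_change Vx).
  rewrite (partial_mxM m oV (csmooth_mxM oV sSt sGG') sS Vx).
  rewrite (partial_mxM m oV sSt sGG' Vx) partial_mx_tr -/(G' x).
  have K : S x *m conn_mx Gam x m = conn_mx Gam' x m *m S x + partial_mx m S x.
    apply/matrixP => i j; rewrite mxE [RHS]mxE [X in X + _]mxE [X in _ + X]mxE.
    have E' : \sum_k S x k j * Gam' x i k 0 m =
        \sum_k S x i k * Gam x k j 0 m - cpartial m (fun w => S w i j) x.
      have := congr1 (fun w : 'rV[C]_4 => w 0 m) (conn_changeE i j Vx).
      rewrite summxE rvD rvN summxE [X in _ = _ - X]mxE => E'.
      transitivity (\sum_k (S x k j *: Gam' x i k) 0 m).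
        by apply: eq_bigr => k _; rewrite rvZ.
      by rewrite E'; congr (_ - _); apply: eq_bigr => k _; rewrite rvZ.
    rewrite (_ : \sum_k conn_mx Gam' x m i k * S x k j =
        \sum_k S x k j * Gam' x i k 0 m); last first.
      by apply: eq_bigr => k _; rewrite mxE mulrC.
    by rewrite E' subrK; apply: eq_bigr => k _; rewrite [conn_mx _ _ _ k j]mxE.
  have Gs : (G' x)^T = G' x.
    rewrite /G' /frame_metric; move: (frame th' x) => f.
    by rewrite !trmx_mul trmxK gsym // mulmxA.
  rewrite -(mulmxA _ (S x)) K.
  move: (partial_mx m S x) (partial_mx m G' x) (conn_mx Gam' x m) (G' x) (S x) (SSi Vx)
    (A x 0 m) Gs => dS0 dG0 W0 G0 S0 SS0 a Gs.
  move=> E0; have Su : S0 \in unitmx by have [] := mulmx1_unit SS0.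
  have Stu : S0^T \in unitmx by rewrite unitmx_tr.
  apply: (can_inj (mulKmx Stu)); apply: (can_inj (mulmxK Su)).
  rewrite !(mulmxBr, mulmxBl, mulmxN, mulNmx) -scalemxAr -scalemxAl -E0.
  rewrite !mulmxDl !mulmxDr !raddfD /= !trmx_mul !trmxK Gs !mulmxA.
  exact: cancel_terms.
- move=> i x Vx.
  rewrite (_ : d_cov _ x = \sum_k (cov (dS x i k) ∧ cov (row k (th x))
      + S x i k *: d_cov (fun y => row k (th y)) x)); last first.
    have srow k : csmooth_mx V (fun y => row k (th y)) by apply: csmooth_mx_row.
    transitivity (d_cov (fun y => \sum_k S y i k *: row k (th y)) x).
      apply: d_cov_eq oV Vx _ => y Vy; rewrite thE // row_mul mulmx_sum_row.
      by apply: eq_bigr => k _; rewrite mxE.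
    rewrite (d_cov_sum _ _ oV (fun k => csmooth_mxZ oV (sS i k) (srow k)) Vx).
    by apply: eq_bigr => k _; exact: (d_covZ oV (sS i k) (srow k) Vx).
  have E j : cov (Gam' x i j) ∧ cov (row j (th' x)) =
      \sum_l cov (S x j l *: Gam' x i j) ∧ cov (row l (th x)).
    move: (Gam' x i j) => G1.
    rewrite thE // row_mul mulmx_sum_row cov_sum wedge_sumr; apply: eq_bigr => l _.
    by rewrite !covZ wedgeZl wedgeZr mxE.
  under [in RHS]eq_bigr do rewrite E.
  rewrite exchange_big /= -sumrN big_split /=.
  have E2 l : - (\sum_j cov (S x j l *: Gam' x i j) ∧ cov (row l (th x))) =
      cov (dS x i l) ∧ cov (row l (th x))
      - \sum_k S x i k *: (cov (Gam x k l) ∧ cov (row l (th x))).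
    rewrite -wedge_suml -cov_sum conn_changeE // covB wedgeDl wedgeNl opprB.
    congr (_ - _); rewrite cov_sum wedge_suml; apply: eq_bigr => k _.
    by rewrite covZ wedgeZl.
  rewrite [in RHS](eq_bigr _ (fun l _ => E2 l)) big_split /=; congr (_ + _).
  rewrite sumrN exchange_big /= -sumrN; apply: eq_bigr => k _.
  by rewrite tf // scalerN scaler_sumr.
Qed.

(** The derivative of [conn_changeE] supplies the second hypothesis of [curvature_change_algebra],
    the term d(dS) being zero. *)
Lemma curvature_form_change x i m : V x ->
  \sum_j S x j m *: curvature_form Gam' i j x =
  \sum_k S x i k *: curvature_form Gam k m x.
Proof.
move=> Vx.
have dE : \sum_j (cov (dS x j m) ∧ cov (Gam' x i j)
      + S x j m *: d_cov (fun y => Gam' y i j) x) =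
    \sum_k (cov (dS x i k) ∧ cov (Gam x k m) + S x i k *: d_cov (fun y => Gam y k m) x).
  transitivity (d_cov (fun y => \sum_j S y j m *: Gam' y i j) x).
    rewrite (d_cov_sum _ _ oV (fun j => csmooth_mxZ oV (sS j m) (sG' i j)) Vx).
    by apply: eq_bigr => j _; rewrite -(d_covZ oV (sS j m) (sG' i j) Vx).
  rewrite (d_cov_eq oV Vx (fun y Vy => conn_changeE i m Vy)).
  have s1 k := csmooth_mxZ oV (sS i k) (sG k m).
  rewrite (d_covB oV (csmooth_mx_sum oV _ _ s1) (csmooth_mx_d_fun (sS i m)) Vx).
  rewrite (d_cov_d_fun oV (sS i m) Vx) subr0 (d_cov_sum _ _ oV s1 Vx).
  by apply: eq_bigr => k _; rewrite -(d_covZ oV (sS i k) (sG k m) Vx).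
have cE i' m' : \sum_j S x j m' *: Gam' x i' j = \sum_k S x i' k *: Gam x k m' - dS x i' m'.
  exact: conn_changeE.
exact: (@curvature_change_algebra (S x) (Gam' x) (Gam x) (dS x)
  (fun i j => d_cov (fun y => Gam' y i j) x) (fun i j => d_cov (fun y => Gam y i j) x)
  i m cE dE).
Qed.

(** The Ricci tensor as a trace of the curvature, which by [ricci_lower] involves no metric and so
    transforms by the curvature law alone. *)
Definition ricci_form t (Ga : connection R) x : 'M[C]_4 :=
  \matrix_(j, l) \sum_k curv_comp t Ga x k j k l.

Lemma ricci_form_change x : V x ->
  ricci_form th Gam x = (S x)^T *m ricci_form th' Gam' x *m S x.
Proof.
move=> Vx; pose e k := row k (frame th x); pose e' k := row k (frame th' x).
have eE p : e p = \sum_k S x k p *: e' k.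
  rewrite /e /e' (_ : frame th x = (S x)^T *m frame th' x); last first.
    rewrite /frame -trmx_mul; congr (_^T).
    by rewrite /S /coframe_quotient mulmxA mulVmx ?u' // mul1mx.
  by rewrite row_mul mulmx_sum_row; apply: eq_bigr => k _; rewrite !mxE.
apply/matrixP => j l; rewrite [LHS]mxE.
have E q : \sum_b S x b j * \sum_k eval2 (curvature_form Gam' k b x) (e' k) (e' q) =
    \sum_a eval2 (curvature_form Gam a j x) (e a) (e' q).
  under eq_bigr do rewrite mulr_sumr; rewrite exchange_big /=.
  transitivity (\sum_k eval2 (\sum_b S x b j *: curvature_form Gam' k b x) (e' k) (e' q)).
    by apply: eq_bigr => k _; rewrite eval2_sum; apply: eq_bigr => b _; rewrite eval2Z.
  transitivity (\sum_k \sum_a eval2 (S x k a *: curvature_form Gam a j x) (e' k) (e' q)).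
    by apply: eq_bigr => k _; rewrite curvature_form_change // eval2_sum.
  rewrite exchange_big; apply: eq_bigr => a _ /=.
  by rewrite eE eval2_suml; apply: eq_bigr => k _; rewrite eval2Z.
transitivity (\sum_q (\sum_a eval2 (curvature_form Gam a j x) (e a) (e' q)) * S x q l).
  under [RHS]eq_bigr do rewrite mulr_suml; rewrite [RHS]exchange_big; apply: eq_bigr => a _ /=.
  rewrite /curv_comp -!/(e _) (eE l) eval2_sumr; apply: eq_bigr => q _.
  by rewrite mulrC.
rewrite mxE; apply: eq_bigr => q _; congr (_ * _); rewrite mxE -E.
by apply: eq_bigr => b _; rewrite [(S x)^T _ _]mxE [ricci_form _ _ _ _ _]mxE.
Qed.

Lemma tracefree_ricci_change x : V x -> g x \in unitmx ->
  tracefree_ricci (frame_metric g th x) (curvature g th Gam x) =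
  (S x)^T *m tracefree_ricci (frame_metric g th' x) (curvature g th' Gam' x) *m S x.
Proof.
move=> Vx ug.
have fsym t : (frame_metric g t x)^T = frame_metric g t x.
  rewrite /frame_metric; move: (frame t x) => f.
  by rewrite !trmx_mul trmxK gsym // mulmxA.
have funit t : t x \in unitmx -> frame_metric g t x \in unitmx.
  move=> ut; rewrite /frame_metric /frame trmxK.
  by rewrite !unitmx_mul unitmx_tr unitmx_inv ut ug.
have ricE t Ga : t x \in unitmx ->
    ricci (frame_metric g t x) (curvature g t Ga x) = ricci_form t Ga x.
  by move=> ut; rewrite curvature_lower ricci_lower // funit.
have scE t Ga : t x \in unitmx ->
    scalar_curv (frame_metric g t x) (curvature g t Ga x) =
    \tr ((invmx (frame_metric g t x))^T *m ricci_form t Ga x).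
  move=> ut; rewrite /scalar_curv /mxtrace ricE // exchange_big; apply: eq_bigr => i _ /=.
  by rewrite mxE; apply: eq_bigr => j _; rewrite [in RHS]mxE.
rewrite /tracefree_ricci !scE ?u ?u' // !ricE ?u ?u' //.
have uG := funit th (u Vx); have uG' := funit th' (u' Vx).
move: uG uG' (fsym th'); rewrite (frame_metric_change Vx) (ricci_form_change Vx).
move: (frame_metric g th' x) (ricci_form th' Gam' x) (S x) (SSi Vx) => G T S0 SS0.
move=> uG uG' Gs; have Su : S0 \in unitmx by case/mulmx1_unit: SS0 => q _; exact: q.
have Stu : S0^T \in unitmx by rewrite unitmx_tr.
(* The scalar curvature is a trace of G^-1 against Ricci, unchanged when both matrices undergo the
   same congruence. *)
have trE : \tr ((invmx (S0^T *m G *m S0))^T *m (S0^T *m T *m S0)) = \tr ((invmx G)^T *m T).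
  have -> : invmx (S0^T *m G *m S0) = invmx S0 *m invmx G *m invmx S0^T.
    have M1 : (S0^T *m G *m S0) *m (invmx S0 *m invmx G *m invmx S0^T) = 1%:M.
      by rewrite !mulmxA mulmxK // mulmxK // mulmxV.
    by rewrite -[RHS](mulKmx uG) M1 mulmx1.
  have AT : (invmx S0^T)^T = invmx S0 by rewrite trmx_inv trmxK.
  have ST : (invmx S0)^T *m S0^T = 1%:M by rewrite -trmx_mul mulmxV // trmx1.
  rewrite trmx_mul trmx_mul AT -!mulmxA (mulmxA _ (S0^T)) ST mul1mx mxtrace_mulC.
  by rewrite -!mulmxA mulmxV // mulmx1.
rewrite trE !trmx_mul trmxK mulmxA mulmxBr mulmxBl -!scalemxAr -!scalemxAl.
by rewrite mulmxDr mulmxDl.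
Qed.

End Change.
End CoframeChange.

(** * Existence of null cotetrads *)

Section LocalRoots.
Variables (R : realType) (d : nat).
Local Notation C := (R[i]).
Implicit Types (V : set 'rV[R]_d) (x : 'rV[R]_d).

Lemma open_pos V (a : 'rV[R]_d -> R) : open V ->
  (forall x, V x -> {for x, continuous a}) -> open (fun x => V x /\ 0 < a x).
Proof.
move=> oV ca; rewrite openE => x [Vx ax].
apply: filterI; first exact: open_nbhs_nbhs.
by have := ca x Vx; move=> /cvgr_gt /(_ 0 ax).
Qed.

(** The half-angle formula for the principal square root, rho being the modulus. *)
Lemma complex_sqrt_identity (a b rho s : R) : 0 < a -> 0 <= rho -> rho * rho = a * a + b * b ->
  s * s = (rho + a) / 2 -> s != 0 ->
  (s +i* (b / (2 * s))) ^+ 2 = a +i* b.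
Proof.
move=> a0 rho0 rhoE sE s0.
have ra : rho + a != 0 by rewrite lt0r_neq0 // ltr_wpDl.
have bb : b * b = (rho + a) * (rho - a).
  by rewrite (_ : (rho + a) * (rho - a) = rho * rho - a * a); [rewrite rhoE|]; ring.
have E1 : b / (2 * s) * (b / (2 * s)) = (rho - a) / 2.
  rewrite (_ : b / (2 * s) * (b / (2 * s)) = b * b / (4 * (s * s))); last by field.
  by rewrite bb sE; field.
rewrite expr2; apply/eqP; rewrite eq_complex /=; apply/andP; split; apply/eqP.
  by rewrite E1 sE; field.
by field.
Qed.

(** Division by f x0 moves the value at x0 to 1. Near x0 the quotient has positive real part, where
    the principal root is smooth in its real and imaginary parts; a fixed root of f x0 is then
    multiplied back. *)
Lemma local_sqrt V (f : 'rV[R]_d -> C) x0 : open V -> V x0 -> csmooth V f -> f x0 != 0 ->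
  exists U w, [/\ open U, U x0, (U `<=` V)%classic, csmooth U w &
    forall x, U x -> w x ^+ 2 = f x /\ w x != 0].
Proof.
move=> oV Vx0 sf f0; pose h x := (f x0)^-1 * f x.
have sh : csmooth V h by apply: csmoothM => //; apply: csmooth_cst.
pose a x := complex.Re (h x); pose b x := complex.Im (h x).
have [sa sb] : smooth V a /\ smooth V b by [].
pose U := (fun x => V x /\ 0 < a x) : set 'rV[R]_d.
have oU : open U by apply: open_pos => // x Vx; have [ca _] := csmooth_continuous sh Vx.
have UV : (U `<=` V)%classic by move=> x [].
have Ux0 : U x0 by split => //; rewrite /a /h mulVf.
pose rho x := Num.sqrt (a x * a x + b x * b x).
pose s x := Num.sqrt (2^-1 * (rho x + a x)).
have ab0 x : U x -> 0 < a x * a x + b x * b x.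
  by move=> [_ ax]; rewrite ltr_wpDr ?mulr_gt0 // -expr2 sqr_ge0.
have ra0 x : U x -> 0 < 2^-1 * (rho x + a x).
  by move=> [_ ax]; rewrite mulr_gt0 ?invr_gt0 // ltr_wpDl // sqrtr_ge0.
have sub g : smooth V g -> smooth U g by move=> sg r; apply: class_CS UV _.
have srho : smooth U rho.
  move=> r; apply: class_C_sqrt => //.
  by apply: class_CD => //; apply: class_CM => //; apply: sub.
have ss : smooth U s.
  move=> r; apply: class_C_sqrt => //; apply: class_CM => //; first exact: class_C_cst.
  by apply: class_CD => //; apply: sub.
have s0 x : U x -> s x != 0 by move=> Ux; rewrite lt0r_neq0 // sqrtr_gt0 ra0.
pose w1 x := s x +i* (b x / (2 * s x)).
have sw1 : csmooth U w1.
  split => // r; apply: class_CM => //; first exact: sub.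
  apply: class_CV => //; first by move=> x Ux; rewrite mulf_neq0 ?s0.
  by apply: class_CM => //; apply: class_C_cst.
have w1E x : U x -> w1 x ^+ 2 = h x.
  move=> Ux; rewrite /w1 (@complex_sqrt_identity (a x) (b x) (rho x)) ?s0 //.
  - by rewrite /a /b; case: (h x).
  - by case: Ux.
  - by rewrite sqrtr_ge0.
  - by rewrite -expr2 sqr_sqrtr // ltW // ab0.
  - by rewrite -expr2 sqr_sqrtr ?ltW ?ra0 // mulrC.
exists U, (fun x => sqrtC (f x0) * w1 x); split => //.
  by apply: csmoothM => //; apply: csmooth_cst.
move=> x Ux; split; first by rewrite exprMn sqrtCK w1E // /h mulVKf.
rewrite mulf_neq0 // ?sqrtC_eq0 //.
by apply/eqP => /(congr1 (@complex.Re R)) /= /eqP; rewrite (negPf (s0 x Ux)).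
Qed.

End LocalRoots.

Section Congruence.
Variables (R : realType).
Local Notation C := (R[i]).

(** By polarization a nonzero symmetric form does not vanish on all vectors: if no basis vector
    serves, e_i + e_j has value 2 Q_ij. [row_ebase] completes such a vector, up to scale, to a
    basis. *)
Lemma nonisotropic_basis n (Q : 'M[C]_n.+1) : Q^T = Q -> Q \in unitmx ->
  exists2 P : 'M[C]_n.+1, P \in unitmx & (P *m Q *m P^T) 0 0 != 0.
Proof.
move=> Qs Qu.
have [v vQ] : exists v : 'rV[C]_n.+1, (v *m Q *m v^T) 0 0 != 0.
  have dQ (i j : 'I_n.+1) : (delta_mx 0 i *m Q *m (delta_mx 0 j)^T) (0 : 'I_1) (0 : 'I_1) = Q i j.
    by rewrite -rowE trmx_delta -colE !mxE.
  have [[i Qi]|noi] := pselect (exists i, Q i i != 0).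
    by exists (delta_mx 0 i); rewrite dQ.
  have Q0 i : Q i i = 0 by apply/eqP; apply: contra_notT noi => Qi; exists i.
  have [[ij Qij]|noij] := pselect (exists ij : 'I_n.+1 * 'I_n.+1, Q ij.1 ij.2 != 0).
    exists (delta_mx 0 ij.1 + delta_mx 0 ij.2).
    rewrite linearD /= !(mulmxDl, mulmxDr) mxE [X in X + _]mxE [X in _ + X]mxE !dQ !Q0.
    rewrite add0r addr0 (_ : Q ij.2 ij.1 = Q ij.1 ij.2); last by rewrite -{1}Qs mxE.
    by rewrite -mulr2n mulrn_eq0 (negPf Qij).
  have Q00 : Q = 0.
    apply/matrixP => i j; rewrite mxE; apply/eqP; apply: contra_notT noij => Qij.
    by exists (i, j).
  by move: Qu; rewrite Q00 unitmxE det0 unitr0.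
have v0 : v != 0 by apply: contraNneq vQ => ->; rewrite !mul0mx mxE.
exists (row_ebase v); first exact: row_ebase_unit.
have r1 : \rank v = 1%N by rewrite rank_rV v0.
have := mulmx_ebase v; rewrite r1; set a := col_ebase v; set P := row_ebase v => vE.
have {}vE : v = a 0 0 *: row 0 P.
  rewrite -[LHS]vE [a]mx11_scalar mul_scalar_mx -scalemxAl [in RHS]mxE eqxx mulr1n; congr (_ *: _).
  apply/rowP => j; rewrite [LHS]mxE [RHS]mxE (bigD1 0) //= [pid_mx 1 _ _]mxE mul1r.
  rewrite big1 ?addr0 // => i i0; rewrite [pid_mx 1 _ _]mxE.
  case: (boolP (_ && _)) => [/andP [/eqP e _]|_]; last by rewrite mul0r.
  by case/negP: i0; apply/eqP/val_inj.
have PE : (P *m Q *m P^T) 0 0 = (row 0 P *m Q *m (row 0 P)^T) 0 0.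
  rewrite rowE trmx_mul trmx_delta !mulmxA -colE [RHS]mxE -!mulmxA -rowE [RHS]mxE.
  by rewrite !mulmxA.
apply: contraNneq vQ; rewrite PE vE linearZ /= -!scalemxAl -scalemxAr => E.
by rewrite !mxE in E *; rewrite E !mulr0.
Qed.

(** Completion of the square with parameters, by induction on the size. Over the complex numbers
    every nonzero pivot has a local smooth square root, so there is no signature and every
    nondegenerate symmetric matrix is locally Z^T Z. *)
Lemma smooth_congruence d n (V : set 'rV[R]_d) (Q : 'rV[R]_d -> 'M[C]_n) x0 :
  open V -> V x0 -> csmooth_mx V Q -> (forall x, V x -> (Q x)^T = Q x) ->
  Q x0 \in unitmx ->
  exists U (Z : 'rV[R]_d -> 'M[C]_n), [/\ open U, U x0, (U `<=` V)%classic, csmooth_mx U Z &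
    forall x, U x -> (Z x)^T *m Z x = Q x].
Proof.
elim: n V Q => [|n IH] V Q oV Vx0 sQ Qs Qu.
  exists V, Q; split => // x Vx; by apply/matrixP => -[].
have [P Pu P00] := nonisotropic_basis (Qs _ Vx0) Qu.
pose Q1 x : 'M[C]_(1 + n) := P *m Q x *m P^T.
have sP : csmooth_mx V (fun _ => P) by apply: csmooth_mx_cst.
have sQ1 : csmooth_mx V Q1.
  by apply: csmooth_mxM => //; [apply: csmooth_mxM|apply: csmooth_mx_cst].
have Q1s x : V x -> (Q1 x)^T = Q1 x.
  by move=> Vx; rewrite /Q1 !trmx_mul trmxK Qs // mulmxA.
have [U1 [w [oU1 U1x0 U1V sw wE]]] := local_sqrt oV Vx0 (sQ1 0 0) P00.
pose r x : 'rV[C]_n := ursubmx (Q1 x).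
(* The Schur complement of the pivot, to which the induction hypothesis applies. *)
pose Q2 x : 'M[C]_n := drsubmx (Q1 x) - (w x ^+ 2)^-1 *: ((r x)^T *m r x).
have subU p q (B : 'rV[R]_d -> 'M[C]_(p, q)) : csmooth_mx V B -> csmooth_mx U1 B.
  by move=> sB i j; apply: csmoothS U1V _.
have w0 x : U1 x -> w x != 0 by move=> /wE [].
have sr : csmooth_mx U1 r.
  by move=> i j; rewrite /r; under eq_fun do rewrite 2!mxE; apply: (subU _ _ _ sQ1).
have swV : csmooth U1 (fun x => (w x)^-1) by apply: csmoothV.
have sw2 : csmooth U1 (fun x => (w x ^+ 2)^-1).
  apply: csmoothV => //; first by move=> x Ux; rewrite expf_neq0 // w0.
  by under eq_fun do rewrite expr2; apply: csmoothM.
have sQ2 : csmooth_mx U1 Q2.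
  apply: csmooth_mxB => //.
    by move=> i j; under eq_fun do rewrite 2!mxE; apply: (subU _ _ _ sQ1).
  by apply: csmooth_mxZ => //; apply: csmooth_mxM => //; apply: csmooth_mx_tr.
have blockE x : U1 x -> Q1 x = block_mx (w x ^+ 2)%:M (r x) (r x)^T (drsubmx (Q1 x)).
  move=> Ux; rewrite -[LHS]submxK; congr block_mx.
    rewrite [LHS]mx11_scalar; congr (_%:M); have [-> _] := wE x Ux.
    by rewrite [LHS]mxE [LHS]mxE; congr (Q1 x _ _); apply/val_inj.
  by rewrite /r trmx_ursub Q1s //; apply: U1V.
have Q2s x : U1 x -> (Q2 x)^T = Q2 x.
  move=> Ux; rewrite /Q2 linearB linearZ /= trmx_mul trmxK trmx_drsub Q1s //.
  exact: U1V.
pose Z1 x : 'M[C]_(1 + n) := block_mx (w x)%:M ((w x)^-1 *: r x) 0 1%:M.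
pose D x : 'M[C]_(1 + n) := block_mx 1%:M 0 0 (Q2 x).
have Q1E x : U1 x -> Q1 x = (Z1 x)^T *m D x *m Z1 x.
  move=> Ux; rewrite [LHS]blockE // /Z1 /D tr_block_mx !mulmx_block.
  rewrite !(mulmx1, mul1mx, mulmx0, mul0mx, addr0, add0r, trmx0, trmx1) tr_scalar_mx.
  rewrite -scalar_mxM -expr2; congr block_mx.
  - by rewrite mul_scalar_mx scalerA divff ?w0 // scale1r.
  - by rewrite mul_mx_scalar linearZ /= scalerA divff ?w0 // scale1r.
  - have -> : ((w x)^-1 *: r x)^T = (w x)^-1 *: (r x)^T by rewrite linearZ.
    rewrite -scalemxAl -scalemxAr scalerA /Q2 -expr2 exprVn.
    by rewrite addrC subrK.
have Q2u : Q2 x0 \in unitmx.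
  have : Q1 x0 \in unitmx by rewrite !unitmx_mul unitmx_tr Pu Qu.
  rewrite Q1E // !unitmx_mul => /andP [/andP [_ +] _].
  by rewrite !unitmxE /D det_ublock det1 mul1r.
have [U [Z [oU Ux0 UU1 sZ ZE]]] := IH U1 Q2 oU1 U1x0 sQ2 Q2s Q2u.
pose Z2 x : 'M[C]_(1 + n) := block_mx (w x)%:M ((w x)^-1 *: r x) 0 (Z x).
exists U, (fun x => Z2 x *m invmx P^T); split => //.
- by move=> x /UU1 /U1V.
- suff sZ2 (i j : 'I_(1 + n)) : csmooth U (fun x => Z2 x i j).
    by apply: csmooth_mxM => //; exact: csmooth_mx_cst.
  have sub2 p q (B : 'rV[R]_d -> 'M[C]_(p, q)) : csmooth_mx U1 B -> csmooth_mx U B.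
    by move=> sB i1 j1; apply: csmoothS UU1 _.
  have s1 : csmooth_mx U1 (fun x => (w x)%:M : 'M[C]_1).
    move=> a b; rewrite (ord1 a) (ord1 b); under eq_fun do rewrite mxE eqxx mulr1n; exact: sw.
  have s2 : csmooth_mx U1 (fun x => (w x)^-1 *: r x) by apply: csmooth_mxZ.
  rewrite /Z2; case: (split_ordP i) => k ->; case: (split_ordP j) => l ->.
  + by under eq_fun do rewrite block_mxEul; apply: (sub2 _ _ _ s1).
  + by under eq_fun do rewrite block_mxEur; apply: (sub2 _ _ _ s2).
  + by under eq_fun do rewrite block_mxEdl; apply: csmooth_mx_cst.
  + by under eq_fun do rewrite block_mxEdr; apply: sZ.
- move=> x Ux.
  have Z2E : Z2 x = block_mx 1%:M 0 0 (Z x) *m Z1 x.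
    rewrite /Z2 /Z1 mulmx_block.
    by rewrite !(mulmx1, mul1mx, mulmx0, mul0mx, addr0, add0r).
  have E : (Z2 x)^T *m Z2 x = Q1 x.
    rewrite Q1E; last exact: UU1.
    have BE : (block_mx 1%:M 0 0 (Z x))^T *m block_mx 1%:M 0 0 (Z x) = D x.
      rewrite tr_block_mx mulmx_block !trmx0 trmx1.
      by rewrite !(mulmx1, mul1mx, mulmx0, mul0mx, addr0, add0r) ZE.
    rewrite Z2E trmx_mul -BE; move: (block_mx 1%:M 0 0 (Z x)) => B.
    by rewrite !mulmxA.
  have PTu : P^T \in unitmx by rewrite unitmx_tr.
  rewrite trmx_mul !mulmxA -(mulmxA _ (Z2 x)^T) E /Q1 trmx_inv trmxK.
  by rewrite !mulmxA mulVmx // mul1mx mulmxK.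
Qed.

Local Notation H := (null_metric R).

(** Origin of the factor 16 in the volume form: g = th^T H th gives (det th)^2 = 16 det g. *)
Lemma det_null_metric : 16%:R * \det H = 1.
Proof.
pose B : 'M[C]_2 := \matrix_(i, j) (2^-1 * (i != j)%:R).
have HE : H = block_mx B 0 0 (- B) :> 'M[C]_(2 + 2).
  apply/matrixP => i j; rewrite null_metricE.
  case: (split_ordP i) => k ->; case: (split_ordP j) => l ->;
    rewrite ?(block_mxEul, block_mxEur, block_mxEdl, block_mxEdr) !mxE;
    case: k => [[|[|k]] hk] //; case: l => [[|[|l]] hl] //; rewrite /= ?mulr0n ?mulr1n; ring.
rewrite (_ : \det H = \det (block_mx B 0 0 (- B))); last by rewrite HE.
have dB : \det B = - 4^-1.
  rewrite (expand_det_row B 0) !big_ord_recl big_ord0 /cofactor !det_mx11 !mxE /=.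
  by field.
by rewrite det_ublock -scaleN1r detZ dB; field.
Qed.

Lemma swap_null_metric : (perm_mx (tperm i1 i2))^T *m H *m perm_mx (tperm i1 i2) = H.
Proof.
rewrite tr_perm_mx tpermV -row_permE -[X in _ *m perm_mx X]tpermV -col_permE.
apply/matrixP => i j; rewrite mxE [LHS]mxE !null_metricE; move: i j.
by do 2!apply: forall_I4; rewrite !permE /=; ring.
Qed.

(** With g = Z^T Z and H = Y^T Y, Y constant, the coframe Y^-1 Z satisfies th^T H th = g. Its
    determinant equals vol up to a sign at each point, and this sign remains to be adjusted. *)
Lemma null_cotetrad_exists (V : set 'rV[R]_4) (g : 'rV[R]_4 -> 'M[C]_4)
    (vol : 'rV[R]_4 -> C) x0 :
  open V -> V x0 -> csmooth_mx V g -> (forall x, V x -> (g x)^T = g x) ->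
  (forall x, V x -> g x \in unitmx) -> csmooth V vol ->
  (forall x, V x -> vol x ^+ 2 = 16%:R * \det (g x)) ->
  exists U th, [/\ open U, U x0, (U `<=` V)%classic & null_cotetrad U g vol th].
Proof.
move=> oV Vx0 sg gs gu sv vE.
have [U0 [Y [_ U0x0 _ _ YE]]] := smooth_congruence (n := 4) oV Vx0 (csmooth_mx_cst V H)
  (fun _ _ => null_metric_sym R) (null_metric_unit R).
have {}YE := YE x0 U0x0; move: (Y x0) YE => {}Y YE.
have Yu : Y \in unitmx.
  by have := null_metric_unit R; rewrite -YE unitmx_mul => /andP [].
have JE : (invmx Y)^T *m H *m invmx Y = 1%:M.
  by rewrite -YE mulmxA mulmxK // -trmx_mul mulmxV // trmx1.
have [U1 [Z [oU1 U1x0 U1V sZ ZE]]] := smooth_congruence oV Vx0 sg gs (gu x0 Vx0).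
pose good (J : 'M[C]_4) := forall x, U1 x -> g x = (J *m Z x)^T *m H *m (J *m Z x).
have sq J x : good J -> U1 x -> (\det (J *m Z x) - vol x) * (\det (J *m Z x) + vol x) = 0.
  move=> gJ Ux; have := vE x (U1V x Ux); rewrite gJ // !det_mulmx det_tr det_mulmx => E.
  rewrite -subr_sqr E.
  transitivity ((\det J * \det (Z x)) ^+ 2 * (1 - 16%:R * \det H)); first by ring.
  by rewrite det_null_metric subrr mulr0.
have good1 : good (invmx Y).
  move=> x Ux; rewrite trmx_mul !mulmxA -(mulmxA _ _ H) -(mulmxA _ _ (invmx Y)) JE mulmx1.
  by rewrite ZE.
(* If the sign is wrong at x0, exchanging M and P corrects it and preserves the metric. *)
have [J [gJ J0]] : exists J, good J /\ \det (J *m Z x0) = vol x0.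
  have /eqP := sq _ _ good1 U1x0; rewrite mulf_eq0 subr_eq0 addr_eq0.
  case/orP => /eqP dJ; first by exists (invmx Y).
  exists (perm_mx (tperm i1 i2) *m invmx Y); split.
    have congrE (A B : 'M[C]_4) : (A *m B)^T *m H *m (A *m B) = B^T *m (A^T *m H *m A) *m B.
      by rewrite trmx_mul !mulmxA.
    by move=> x Ux; rewrite -(mulmxA (perm_mx _)) congrE swap_null_metric; exact: good1.
  rewrite -mulmxA det_mulmx dJ det_perm odd_tperm; case: eqP => // _.
  by rewrite expr1 mulN1r opprK.
have v0 : vol x0 != 0.
  have := vE x0 Vx0; have := gu x0 Vx0; rewrite unitmxE unitfE => d0 E.
  by apply: contraNneq d0 => v0; move: E; rewrite v0 expr0n => /esym/eqP;
    rewrite mulf_eq0 pnatr_eq0.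
have sJZ : csmooth_mx U1 (fun x => J *m Z x).
  by apply: csmooth_mxM => //; apply: csmooth_mx_cst.
have sf : csmooth U1 (fun x => \det (J *m Z x) + vol x).
  by apply: csmoothD => //; [apply: csmooth_det|apply: csmoothS U1V _].
have f0 : \det (J *m Z x0) + vol x0 != 0.
  by rewrite J0 -mulr2n mulrn_eq0.
(* Only the neighbourhood is of interest: a square root exists on it that is nonzero, hence det +
   vol does not vanish there, and the factor det - vol must. *)
have [U [w [oU Ux0 UU1 _ wE]]] := local_sqrt oU1 U1x0 sf f0.
have dE x : U x -> \det (J *m Z x) = vol x.
  move=> Ux; have [fE w0] := wE x Ux; have /eqP := sq J x gJ (UU1 x Ux).
  rewrite mulf_eq0 -fE expf_eq0 /= (negPf w0) orbF subr_eq0 => /eqP //.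
exists U, (fun x => J *m Z x); split => //; first by move=> x /UU1 /U1V.
split => //.
- split; first by move=> i j; apply: csmoothS UU1 _; apply: sJZ.
  move=> x Ux; have Vx := U1V _ (UU1 _ Ux).
  have := gu x Vx; rewrite gJ; last exact: UU1.
  by rewrite unitmx_mul => /andP [].
- by move=> x Ux; rewrite null_metric_pullback gJ //; exact: UU1.
Qed.

End Congruence.

(** * Forms on the twistor bundle *)

Section TwistorCalculus.
Variable R : realType.
Local Notation C := (R[i]).
Implicit Types (V : set 'rV[R]_4) (y : 'rV[R]_(4 + 4)).

Lemma open_tw_base V : open V -> open (@tw_base R @^-1` V)%classic.
Proof.
by move=> oV; apply: open_comp => // y _; exact: continuous_lsubmx.
Qed.

Lemma line_base (f : 'rV[R]_4 -> R) y (v : 'rV[R]_(4 + 4)) :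
  (fun h : R => h^-1 *: (((f \o @tw_base R) \o shift y) (h *: v) - (f \o @tw_base R) y)) =
  (fun h : R => h^-1 *: ((f \o shift (tw_base y)) (h *: lsubmx v) - f (tw_base y))).
Proof.
apply/funext => h; rewrite /= /tw_base; congr (_ *: (f _ - _)).
by rewrite linearD linearZ.
Qed.

Lemma lsubmx_delta (k : 'I_(4 + 4)) : lsubmx (delta_mx 0 k : 'rV[R]_(4 + 4)) =
  if fintype.split k is inl j then delta_mx 0 j else 0.
Proof.
apply/rowP => j; rewrite mxE mxE; case: splitP => l kE; rewrite mxE eqxx /=.
  by congr (_%:R); rewrite -(inj_eq val_inj) /= kE (inj_eq val_inj).
by case: eqP => // /(congr1 val) /= E; have := ltn_ord j; rewrite E kE ltnNge leq_addr.
Qed.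

Lemma partial_base k (f : 'rV[R]_4 -> R) y : partial k (f \o @tw_base R) y =
  if fintype.split k is inl j then partial j f (tw_base y) else 0.
Proof.
rewrite /partial /derive line_base lsubmx_delta; case: (fintype.split k) => [//|_].
exact: derive0.
Qed.

Lemma class_C_base r V f : class_C r V f ->
  class_C r (@tw_base R @^-1` V)%classic (f \o @tw_base R).
Proof.
elim: r f => [|r IH] f Cf; split => //;
  try by move=> y Vy; apply: continuous_comp; [exact: continuous_lsubmx|exact: class_C_continuous Cf Vy].
move=> k; have [_ df] := Cf; split.
  move=> y Vy; rewrite /derivable line_base lsubmx_delta; case: (fintype.split k) => [j|_].
    by have [d _] := df j; apply: d.
  exact: derivable0.
case E : (fintype.split k) => [j|j].
  rewrite (_ : partial k (f \o @tw_base R) = partial j f \o @tw_base R).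
    by apply: IH; have [] := df j.
  by apply/funext => y; rewrite partial_base E.
rewrite (_ : partial k (f \o @tw_base R) = cst 0); first exact: class_C_cst.
by apply/funext => y; rewrite partial_base E.
Qed.

Lemma csmooth_base V (f : 'rV[R]_4 -> C) : csmooth V f ->
  csmooth (@tw_base R @^-1` V)%classic (fun y => f (tw_base y)).
Proof.
by move=> [sr si]; split => r; [exact: class_C_base (sr r)|exact: class_C_base (si r)].
Qed.

Lemma cpartial_base k (f : 'rV[R]_4 -> C) y : cpartial k (fun y => f (tw_base y)) y =
  if fintype.split k is inl j then cpartial j f (tw_base y) else 0.
Proof.
rewrite /cpartial (partial_base k (fun x => complex.Re (f x))).
rewrite (partial_base k (fun x => complex.Im (f x))).
by case: (fintype.split k).
Qed.

Lemma is_derive_coord n (j : 'I_n) (x v : 'rV[R]_n) :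
  is_derive x v (fun w => w 0 j) (v 0 j).
Proof.
have D : derivable (fun w : 'rV[R]_n => w 0 j) x v.
  apply/derivable1P; rewrite (_ : (fun h : R => _) = (fun h => h * v 0 j + x 0 j)).
    exact: ex_derive.
  by apply/funext => h; rewrite !mxE.
apply: DeriveDef => //.
have D0 : derivable (fun w : 'rV[R]_n => w 0 j) (0 *: v + x) v by rewrite scale0r add0r.
have [_] := is_derive_line D0; rewrite scale0r add0r => <-.
rewrite (_ : (fun h : R => _) = (fun h => h * v 0 j + x 0 j)); last first.
  by apply/funext => h; rewrite !mxE.
by rewrite derive_val scaler0 add0r addr0 [_%:A]mulr1.
Qed.

Lemma smooth_coord n (j : 'I_n) (U : set 'rV[R]_n) : smooth U (fun w => w 0 j).
Proof.
move=> [|r]; split => //; try by move=> x _; exact: coord_continuous.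
move=> k; split; first by move=> x _; have [] := is_derive_coord j x (delta_mx 0 k).
rewrite (_ : partial k _ = cst ((delta_mx 0 k : 'rV[R]_n) 0 j)); first exact: class_C_cst.
by apply/funext => x; have [_] := is_derive_coord j x (delta_mx 0 k).
Qed.

(* The complex coordinate and its differential on the fibre for the pair
   (k1, k2) of real fibre coordinates: tw_z is (i1, i2), tw_z' is (i3, i4). *)
Definition fib (k : 'I_4 * 'I_4) y : C := rsubmx y 0 k.1 +i* rsubmx y 0 k.2.
Definition dfib (k : 'I_4 * 'I_4) : 'rV[C]_(4 + 4) :=
  row_mx 0 (delta_mx 0 k.1 + (0 +i* 1) *: delta_mx 0 k.2).

Lemma csmooth_fib k U : csmooth U (fib k).
Proof.
split.
  rewrite (_ : (fun y => _) = (fun y : 'rV[R]_(4 + 4) => y 0 (rshift 4 k.1))).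
    exact: smooth_coord.
  by apply/funext => y; rewrite /= mxE.
rewrite (_ : (fun y => _) = (fun y : 'rV[R]_(4 + 4) => y 0 (rshift 4 k.2))).
  exact: smooth_coord.
by apply/funext => y; rewrite /= mxE.
Qed.

Lemma d_fun_fib k y : d_fun (fib k) y = dfib k.
Proof.
have dE (j : 'I_4) l : partial l (fun y : 'rV[R]_(4 + 4) => rsubmx y 0 j) y = (l == rshift 4 j)%:R.
  rewrite (_ : (fun y => _) = (fun y : 'rV[R]_(4 + 4) => y 0 (rshift 4 j))).
    by have [_ E] := is_derive_coord (rshift 4 j) y (delta_mx 0 l); rewrite /partial E mxE eqxx eq_sym.
  by apply/funext => w; rewrite /= mxE.
apply/rowP => l; rewrite mxE /cpartial /= !dE /dfib.
case: (split_ordP l) => m ->.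
  by rewrite row_mxEl mxE !eq_lrshift.
rewrite row_mxEr !(inj_eq (@rshift_inj _ _)) !mxE eqxx /=; apply/eqP.
by case: (m == k.1); case: (m == k.2); rewrite eq_complex; apply/andP; split; apply/eqP => /=; ring.
Qed.

Lemma pullD (a b : 'rV[C]_4) : pull (a + b) = pull a + pull b.
Proof. by rewrite /pull add_row_mx addr0. Qed.

Lemma pullZ (c : C) (a : 'rV[C]_4) : pull (c *: a) = c *: pull a.
Proof. by rewrite /pull scale_row_mx scaler0. Qed.

Lemma pullN (a : 'rV[C]_4) : pull (- a) = - pull a.
Proof. by rewrite -scaleN1r pullZ scaleN1r. Qed.

Lemma pullB (a b : 'rV[C]_4) : pull (a - b) = pull a - pull b.
Proof. by rewrite pullD pullN. Qed.

Lemma pull_sum I (r : seq I) (F : I -> 'rV[C]_4) :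
  pull (\sum_(i <- r) F i) = \sum_(i <- r) pull (F i).
Proof.
apply: (big_morph (@pull R)); first exact: pullD.
by rewrite /pull row_mx0.
Qed.

Lemma csmooth_mx_pull V (a : 'rV[R]_4 -> 'rV[C]_4) : csmooth_mx V a ->
  csmooth_mx (@tw_base R @^-1` V)%classic (fun y => pull (a (tw_base y))).
Proof.
move=> sa i j; rewrite /pull; case: (split_ordP j) => k ->.
  under eq_fun do rewrite row_mxEl; exact: csmooth_base (sa i k).
by under eq_fun do rewrite row_mxEr mxE; exact: csmooth_cst.
Qed.

(** Exterior derivative commutes with pullback. The right side is the coordinate expression of d a
    with each covector pulled back, as [pull] acts on 1-forms only. *)
Lemma d_cov_pull V (a : 'rV[R]_4 -> 'rV[C]_4) y : open V -> csmooth_mx V a ->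
  V (tw_base y) -> d_cov (fun y => pull (a (tw_base y))) y =
  \sum_(k < 4) cov (pull (delta_mx 0 k)) ∧ cov (pull (row_partial k a (tw_base y))).
Proof.
move=> oV sa Vy.
rewrite (d_covE (open_tw_base oV) (csmooth_mx_pull sa) (Vy : (_ @^-1` V)%classic y)).
have rp k : row_partial k (fun y => pull (a (tw_base y))) y =
    if fintype.split k is inl j then pull (row_partial j a (tw_base y)) else 0.
  apply/rowP => j; rewrite mxE /pull; case: (split_ordP j) => l ->.
    rewrite (_ : (fun w => _) = (fun w => a (tw_base w) 0 l)); last first.
      by apply/funext => w; rewrite row_mxEl.
    rewrite (cpartial_base k (fun x => a x 0 l)).
    by case: (fintype.split k) => [m|_]; rewrite ?row_mxEl mxE.
  rewrite (_ : (fun w => _) = (fun=> 0)); last by apply/funext => w; rewrite row_mxEr mxE.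
  by rewrite cpartial_cst; case: (fintype.split k) => [m|_]; rewrite ?row_mxEr mxE.
rewrite big_split_ord /= [X in _ + X]big1 ?addr0 => [|k _]; last first.
  by rewrite rp (unsplitK (inr k)) cov0 wedge0r.
apply: eq_bigr => k _; rewrite rp (unsplitK (inl k)); congr (cov _ ∧ _).
apply/rowP => j; rewrite /pull; case: (split_ordP j) => l ->.
  by rewrite row_mxEl !mxE eq_lshift.
by rewrite row_mxEr !mxE eq_sym eq_lrshift.
Qed.

End TwistorCalculus.

(** * Differentials of the canonical forms modulo L and F *)

Section TwistorForms.
Variable R : realType.
Local Notation C := (R[i]).
Implicit Types (V : set 'rV[R]_4) (y : 'rV[R]_(4 + 4)).

(** The pair s selects the fibre coordinate. Thus E' is an instance of the same formula for the
    connection with indices 1 and 2 exchanged, and part (b) is an instance of part (a). *)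
Definition gE (s : 'I_4 * 'I_4) (Ga : connection R) y : 'rV[C]_(4 + 4) :=
  dfib R s + pull (ez Ga (fib s y) (tw_base y)).
Definition gF (s : 'I_4 * 'I_4) (th : 'rV[R]_4 -> 'M[C]_4) y : 'rV[C]_(4 + 4) :=
  pull (row i1 (th (tw_base y)) + fib s y *: row i4 (th (tw_base y))).
Definition gL (s t : 'I_4 * 'I_4) (th : 'rV[R]_4 -> 'M[C]_4) y : 'rV[C]_(4 + 4) :=
  - pull (row i3 (th (tw_base y)) + fib s y *: row i2 (th (tw_base y)))
  - fib t y *: gF s th y.

Section Lift.
Variables (th : 'rV[R]_4 -> 'M[C]_4) (x : 'rV[R]_4) (Phi : ext R (4 + 4) -> C).
Hypothesis u : th x \in unitmx.
Hypothesis PD : forall v w, Phi (v + w) = Phi v + Phi w.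
Hypothesis PZ : forall c w, Phi (c *: w) = c * Phi w.

Let t k := row k (th x).
Let e k := row k (frame th x).

Definition lift_basis k l := Phi (cov (pull (t k)) ∧ cov (pull (t l))).

(* The functional on 2-forms of the base induced by Phi through the pullback. *)
Definition lift2 (w : ext R 4) : C :=
  \sum_k \sum_l 2^-1 * eval2 w (e k) (e l) * lift_basis k l.

Lemma lift_basis_anti k l : lift_basis k l = - lift_basis l k.
Proof. by rewrite /lift_basis cov_wedge_anti -scaleN1r PZ mulN1r. Qed.

Lemma lift2D v w : lift2 (v + w) = lift2 v + lift2 w.
Proof.
rewrite /lift2 -big_split; apply: eq_bigr => k _; rewrite -big_split /=.
by apply: eq_bigr => l _; rewrite eval2D; ring.
Qed.

Lemma lift2Z c w : lift2 (c *: w) = c * lift2 w.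
Proof.
rewrite /lift2 mulr_sumr; apply: eq_bigr => k _; rewrite mulr_sumr.
by apply: eq_bigr => l _; rewrite eval2Z; ring.
Qed.

Lemma lift2_cov a b : lift2 (cov a ∧ cov b) = Phi (cov (pull a) ∧ cov (pull b)).
Proof.
have P0 : Phi 0 = 0 by rewrite -(scale0r 0) PZ mul0r.
have -> : Phi (cov (pull a) ∧ cov (pull b)) =
    \sum_k \sum_l pairing a (e k) * pairing b (e l) * lift_basis k l.
  rewrite {1}(coframe_expand a u) {1}(coframe_expand b u) !pull_sum !cov_sum.
  rewrite wedge_suml (big_morph Phi PD P0); apply: eq_bigr => k _.
  rewrite wedge_sumr (big_morph Phi PD P0); apply: eq_bigr => l _.
  by rewrite !pullZ !covZ wedgeZl wedgeZr !PZ mulrA.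
pose S := \sum_k \sum_l pairing a (e k) * pairing b (e l) * lift_basis k l.
have E : \sum_k \sum_l pairing a (e l) * pairing b (e k) * lift_basis k l = - S.
  rewrite exchange_big -sumrN; apply: eq_bigr => k _; rewrite -sumrN.
  by apply: eq_bigr => l _; rewrite /= lift_basis_anti mulrN.
transitivity (2^-1 * (S - \sum_k \sum_l pairing a (e l) * pairing b (e k) * lift_basis k l)).
  rewrite /lift2 /S -sumrB mulr_sumr; apply: eq_bigr => k _.
  rewrite -sumrB mulr_sumr; apply: eq_bigr => l _; rewrite eval2_cov; ring.
have half (c : C) : 2^-1 * (c - - c) = c by field.
by rewrite E half.
Qed.

(** Modulo the ideal theta^3 is -z theta^2 and theta^1 is -z theta^4, so all products of two coframe
    elements become multiples of P /\ K; the multiples add up to [sd_part]. *)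
Lemma lift2_sd z w :
  (forall v, Phi (v ∧ cov (pull (t i3 + z *: t i2))) = 0) ->
  (forall v, Phi (v ∧ cov (pull (t i1 + z *: t i4))) = 0) ->
  lift2 w = sd_eval th x z w * lift_basis i2 i4.
Proof.
move=> pL pF.
have b3 k : lift_basis k i3 = - z * lift_basis k i2.
  have := pL (cov (pull (t k))); rewrite pullD pullZ covD covZ wedgeDr wedgeZr PD PZ.
  by move/eqP; rewrite addr_eq0 => /eqP E; rewrite /lift_basis E mulNr.
have b1 k : lift_basis k i1 = - z * lift_basis k i4.
  have := pF (cov (pull (t k))); rewrite pullD pullZ covD covZ wedgeDr wedgeZr PD PZ.
  by move/eqP; rewrite addr_eq0 => /eqP E; rewrite /lift_basis E mulNr.
have b0 k : lift_basis k k = 0 by rewrite /lift_basis cov_wedge_cov -(scale0r 0) PZ mul0r.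
have ba := lift_basis_anti.
have b21 : lift_basis i2 i1 = - z * lift_basis i2 i4 := b1 i2.
have b12 : lift_basis i1 i2 = z * lift_basis i2 i4 by rewrite ba b21; ring.
have b13 : lift_basis i1 i3 = - z ^+ 2 * lift_basis i2 i4 by rewrite b3 b12; ring.
have b31 : lift_basis i3 i1 = z ^+ 2 * lift_basis i2 i4 by rewrite ba b13; ring.
have b41 : lift_basis i4 i1 = 0 by rewrite b1 b0 mulr0.
have b14 : lift_basis i1 i4 = 0 by rewrite ba b41 oppr0.
have b23 : lift_basis i2 i3 = 0 by rewrite b3 b0 mulr0.
have b32 : lift_basis i3 i2 = 0 by rewrite ba b23 oppr0.
have b42 : lift_basis i4 i2 = - lift_basis i2 i4 := ba i4 i2.
have b43 : lift_basis i4 i3 = z * lift_basis i2 i4 by rewrite b3 b42; ring.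
have b34 : lift_basis i3 i4 = - z * lift_basis i2 i4 by rewrite ba b43; ring.
rewrite /lift2 /sd_eval /sd_part sum_I4 !sum_I4 !b0.
rewrite b21 b12 b13 b31 b41 b14 b23 b32 b42 b43 b34.
have eA k l := eval2_anti w (e k) (e l).
rewrite (eA i2 i1) (eA i3 i1) (eA i4 i1) (eA i3 i2) (eA i4 i2) (eA i4 i3).
move: (lift_basis i2 i4) => B; rewrite -!/(e _).
by generalize_entries (@eval2 R 4); field.
Qed.

End Lift.

Lemma wedge_kill_combination n (a b : 'rV[C]_n) (c : C) X :
  cov (- a - c *: b) ∧ X = 0 -> cov b ∧ X = 0 -> cov a ∧ X = 0.
Proof.
rewrite covB covN covZ wedgeDl !wedgeNl wedgeZl => E bX; move: E.
by rewrite bX scaler0 subr0 => /eqP; rewrite oppr_eq0 => /eqP.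
Qed.

Section Core.
Variables (V : set 'rV[R]_4) (g : 'rV[R]_4 -> 'M[C]_4) (vol : 'rV[R]_4 -> C).
Variables (A : 'rV[R]_4 -> 'rV[C]_4) (th : 'rV[R]_4 -> 'M[C]_4) (Gam : connection R).
Hypotheses (oV : open V) (nct : null_cotetrad V g vol th).
Hypothesis wc : weyl_connection V g A th Gam.
Variables (s t : 'I_4 * 'I_4) (y : 'rV[R]_(4 + 4)) (X : ext R (4 + 4)).
Hypothesis Vy : V (tw_base y).
(** Congruence modulo L and F is expressed by multiplication with a form X that both annihilate. X
    will be E /\ L /\ F, E' /\ L /\ F or the product of all four forms. *)
Hypotheses (LX : cov (gL s t th y) ∧ X = 0) (FX : cov (gF s th y) ∧ X = 0).

Let x := tw_base y.
Let z := fib s y.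
Let U : set 'rV[R]_(4 + 4) := (@tw_base R @^-1` V)%classic.
Let oU : open U := open_tw_base oV.
Let Uy : U y := Vy.

Let pull_L : cov (pull (row i3 (th x) + z *: row i2 (th x))) ∧ X = 0.
Proof. exact: wedge_kill_combination LX FX. Qed.

Let sth : csmooth_mx V th. Proof. by have [[]] := nct. Qed.
Let ux : th x \in unitmx. Proof. by have [[_ uu]] := nct; move=> _ _; apply: uu. Qed.
Let srow k : csmooth_mx V (fun w => row k (th w)). Proof. exact: csmooth_mx_row. Qed.

Lemma d_cov_fib_pull (r : 'I_4 * 'I_4) (a : 'rV[R]_(4 + 4) -> 'rV[C]_(4 + 4)) :
  csmooth_mx U a -> d_cov (fun w => fib r w *: a w) y =
  cov (dfib R r) ∧ cov (a y) + fib r y *: d_cov a y.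
Proof. by move=> sa; rewrite (d_covZ oU (csmooth_fib r U) sa Uy) d_fun_fib. Qed.

Let dF : d_cov (gF s th) y = d_cov (fun w => pull (row i1 (th (tw_base w)))) y
  + (cov (dfib R s) ∧ cov (pull (row i4 (th x)))
     + z *: d_cov (fun w => pull (row i4 (th (tw_base w)))) y).
Proof.
have s4 := csmooth_mx_pull (srow i4).
rewrite -(d_cov_fib_pull s s4).
rewrite -(d_covD oU (csmooth_mx_pull (srow i1)) (csmooth_mxZ oU (csmooth_fib s U) s4) Uy).
by congr (d_cov _ y); apply/funext => w; rewrite /gF pullD pullZ.
Qed.

Let sF : csmooth_mx U (gF s th).
Proof.
have -> : gF s th = fun w => pull (row i1 (th (tw_base w)))
    + fib s w *: pull (row i4 (th (tw_base w))).
  by apply/funext => w; rewrite /gF pullD pullZ.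
by apply: csmooth_mxD => //; [apply: (csmooth_mx_pull (srow i1))|apply: csmooth_mxZ => //;
  [exact: csmooth_fib|exact: (csmooth_mx_pull (srow i4))]].
Qed.

Let dL : d_cov (gL s t th) y = - (d_cov (fun w => pull (row i3 (th (tw_base w)))) y
  + (cov (dfib R s) ∧ cov (pull (row i2 (th x)))
     + z *: d_cov (fun w => pull (row i2 (th (tw_base w)))) y))
  - (cov (dfib R t) ∧ cov (gF s th y) + fib t y *: d_cov (gF s th) y).
Proof.
have s2 := csmooth_mx_pull (srow i2); have s3 := csmooth_mx_pull (srow i3).
have s2' := csmooth_mxZ oU (csmooth_fib s U) s2.
rewrite -(d_cov_fib_pull s s2) -(d_cov_fib_pull t sF).
rewrite -(d_covD oU s3 s2' Uy) -(d_covN oU (csmooth_mxD oU s3 s2') Uy).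
rewrite -(d_covB oU (csmooth_mxN oU (csmooth_mxD oU s3 s2')) (csmooth_mxZ oU (csmooth_fib t U) sF) Uy).
by congr (d_cov _ y); apply/funext => w; rewrite /gL pullD pullZ.
Qed.

Section Functional.
Variable S : {set 'I_(4 + 4)}.
(** A single coefficient of w /\ X. As a scalar functional that kills L and F it can be fed to
    [lift2] and [structure_mod_ideal]; letting S vary recovers the form. *)
Let Phi (w : ext R (4 + 4)) : C := (w ∧ X) S.

Let PD v w : Phi (v + w) = Phi v + Phi w.
Proof. by rewrite /Phi wedgeDl ffunE. Qed.

Let PZ c w : Phi (c *: w) = c * Phi w.
Proof. by rewrite /Phi wedgeZl ffunE. Qed.

Let PN w : Phi (- w) = - Phi w.
Proof. by rewrite -scaleN1r PZ mulN1r. Qed.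

Let Pkill a v : cov a ∧ X = 0 -> Phi (v ∧ cov a) = 0.
Proof. by move=> aX; rewrite /Phi wedge_assoc aX wedge0r ffunE. Qed.

Let Panti a b : Phi (cov a ∧ cov b) = - Phi (cov b ∧ cov a).
Proof. by rewrite cov_wedge_anti PN. Qed.

Let lift := lift2 th x Phi.

Lemma lift2_d_cov (a : 'rV[R]_4 -> 'rV[C]_4) : csmooth_mx V a ->
  lift (d_cov a x) = Phi (d_cov (fun w => pull (a (tw_base w))) y).
Proof.
move=> sa; rewrite (d_cov_pull oV sa Vy) (d_covE oV sa Vy).
have P0 : Phi 0 = 0 by rewrite -(scale0r 0) PZ mul0r.
have L0 : lift 0 = 0 by rewrite -(scale0r 0) /lift lift2Z // mul0r.
rewrite (big_morph lift (lift2D th x Phi) L0) (big_morph Phi PD P0).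
by apply: eq_bigr => k _; rewrite /lift (lift2_cov ux PD PZ).
Qed.

Let lD v w : lift (v + w) = lift v + lift w := lift2D th x Phi v w.
Let lZ c w : lift (c *: w) = c * lift w := lift2Z th x Phi c w.
Let lC a b : lift (cov a ∧ cov b) = Phi (cov (pull a) ∧ cov (pull b)) :=
  lift2_cov ux PD PZ a b.

Lemma lift2_curvature w : lift w = sd_eval th x z w * Phi
  (cov (pull (row i2 (th x))) ∧ cov (pull (row i4 (th x)))).
Proof. by apply: lift2_sd => // v; apply: Pkill; [exact: pull_L|exact: FX]. Qed.

(** In dF the vertical term is dz /\ K, which is -e_z /\ K modulo E, and the structure equations
    turn the remaining horizontal terms into e_z /\ K. The same cancellation with P takes place in
    dL, whose extra terms dz' /\ F and z' dF vanish. *)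
Lemma Phi_dF_dL : cov (gE s Gam y) ∧ X = 0 ->
  Phi (d_cov (gF s th) y) = 0 /\ Phi (d_cov (gL s t th) y) = 0.
Proof.
move=> EX; have [_ _ tf] := wc.
have kL a : lift (cov a ∧ cov (row i3 (th x) + z *: row i2 (th x))) = 0.
  by rewrite lC; apply: Pkill pull_L.
have kF a : lift (cov a ∧ cov (row i1 (th x) + z *: row i4 (th x))) = 0.
  by rewrite lC; apply: Pkill FX.
have [hL hF] := structure_mod_ideal (psi := lift) (t := fun k => row k (th x)) lD lZ kL kF
  (weyl_null_connection oV nct wc Vy) (fun i => tf i x Vy).
have lDZ a b : csmooth_mx V a -> csmooth_mx V b -> lift (d_cov a x + z *: d_cov b x) =
    Phi (d_cov (fun w => pull (a (tw_base w))) y)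
    + z * Phi (d_cov (fun w => pull (b (tw_base w))) y).
  by move=> sa sb; rewrite lD lZ !lift2_d_cov.
have {}hL := etrans (esym (lDZ _ _ (srow i3) (srow i2))) (etrans hL (lC _ _)).
have {}hF := etrans (esym (lDZ _ _ (srow i1) (srow i4))) (etrans hF (lC _ _)).
have dz b : Phi (cov (dfib R s) ∧ cov b) = - Phi (cov (pull (ez Gam z x)) ∧ cov b).
  apply/eqP; rewrite -addr_eq0 -PD -wedgeDl -covD; apply/eqP.
  by rewrite Panti Pkill // oppr0.
have PF a c b : Phi (a + (c + z *: b)) = Phi a + (Phi c + z * Phi b).
  by rewrite !PD PZ.
have PL a c b f d k : Phi (- (a + (c + z *: b)) - (f + k *: d)) =
    - (Phi a + (Phi c + z * Phi b)) - (Phi f + k * Phi d).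
  by rewrite PD !PN PF PD PZ.
have F0 : Phi (d_cov (gF s th) y) = 0.
  by rewrite dF PF addrCA hF dz addNr.
split; [exact: F0|]; rewrite dL PL F0 mulr0 addr0 (Pkill _ FX) oppr0 addr0.
by rewrite addrCA hL dz addNr oppr0.
Qed.

(** The fibre coordinate r and the connection Ga are independent of those in L and F, so that the
    statement covers dE as well as dE', both reduced modulo the same L and F. *)
Lemma Phi_dE (r : 'I_4 * 'I_4) (Ga : connection R) :
  (forall i j, csmooth_mx V (fun w => Ga w i j)) -> cov (gE r Ga y) ∧ X = 0 ->
  Phi (d_cov (gE r Ga) y) = sd_eval th x z (d_cov (ez Ga (fib r y)) x
     + cov (qz Ga (fib r y) x) ∧ cov (ez Ga (fib r y) x))
   * Phi (cov (pull (row i2 (th x))) ∧ cov (pull (row i4 (th x)))).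
Proof.
move=> sGa EX; rewrite -lift2_curvature.
pose zr := fib r y; rewrite -/zr.
pose h w := Ga w i1 i1 - Ga w i4 i4.
have sh : csmooth_mx V h by apply: csmooth_mxB.
have sb : csmooth_mx V (fun w => - Ga w i3 i2) by apply: csmooth_mxN.
have ph := csmooth_mx_pull sh; have pb := csmooth_mx_pull sb.
have pc := csmooth_mx_pull (sGa i2 i3).
have sz := csmooth_fib r U.
have pzc := csmooth_mxZ oU sz pc; have pzzc := csmooth_mxZ oU sz pzc.
have pzh := csmooth_mxZ oU sz ph; have pbh := csmooth_mxD oU pb pzh.
have pe := csmooth_mxD oU pbh pzzc.
have cst0 : csmooth_mx U (fun _ => dfib R r) := csmooth_mx_cst U (dfib R r).
have dE : d_cov (gE r Ga) y = d_cov (fun w => pull (- Ga (tw_base w) i3 i2)) y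
   + (cov (dfib R r) ∧ cov (pull (h x)) + zr *: d_cov (fun w => pull (h (tw_base w))) y)
   + (cov (dfib R r) ∧ cov (zr *: pull (Ga x i2 i3))
     + zr *: (cov (dfib R r) ∧ cov (pull (Ga x i2 i3))
       + zr *: d_cov (fun w => pull (Ga (tw_base w) i2 i3)) y)).
  rewrite -(d_cov_fib_pull r ph) -(d_cov_fib_pull r pc) -(d_cov_fib_pull r pzc).
  rewrite -(d_covD oU pb pzh Uy) -(d_covD oU pbh pzzc Uy) -[RHS]add0r -(d_cov_cst (dfib R r) y).
  rewrite -(d_covD oU cst0 pe Uy); congr (d_cov _ y); apply/funext => w.
  by rewrite /gE /ez pullD pullD !pullZ expr2 scalerA.
have zc : csmooth_mx V (fun w => zr *: Ga w i2 i3).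
  by apply: csmooth_mxZ => //; apply: csmooth_cst.
have sc (c : C) : csmooth V (fun _ => c) := csmooth_cst V c.
have dez : d_cov (ez Ga zr) x = d_cov (fun w => - Ga w i3 i2) x + zr *: d_cov h x
    + zr ^+ 2 *: d_cov (fun w => Ga w i2 i3) x.
  have szh := csmooth_mxZ oV (sc zr) sh.
  have szc := csmooth_mxZ oV (sc (zr ^+ 2)) (sGa i2 i3).
  rewrite -(d_cov_scale zr oV sh Vy) -(d_cov_scale (zr ^+ 2) oV (sGa i2 i3) Vy).
  by rewrite -(d_covD oV sb szh Vy) -(d_covD oV (csmooth_mxD oV sb szh) szc Vy).
have dz b : Phi (cov (dfib R r) ∧ cov b) = Phi (cov b ∧ cov (pull (ez Ga zr x))).
  apply/eqP; rewrite -subr_eq0 -PN -PD -cov_wedge_anti -wedgeDl -covD; apply/eqP.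
  by rewrite Panti Pkill // oppr0.
have lE a b c d : lift (a + zr *: b + zr ^+ 2 *: c + d) =
    lift a + zr * lift b + zr ^+ 2 * lift c + lift d.
  by rewrite !lD !lZ.
have PE a b c d e1 f1 : Phi (a + (b + zr *: c) + (d + zr *: (e1 + zr *: f1))) =
    Phi a + (Phi b + zr * Phi c) + (Phi d + zr * (Phi e1 + zr * Phi f1)).
  by rewrite !(PD, PZ).
have qE w : Phi (cov (pull (qz Ga zr x)) ∧ cov w) = Phi (cov (pull (h x)) ∧ cov w)
    + (2 * zr) * Phi (cov (pull (Ga x i2 i3)) ∧ cov w).
  by rewrite /qz -/(h x) pullD pullZ covD covZ wedgeDl wedgeZl PD PZ.
rewrite dE dez lE lC PE qE (lift2_d_cov sb) (lift2_d_cov sh) (lift2_d_cov (sGa i2 i3)).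
rewrite !dz covZ wedgeZl PZ.
by generalize_entries Phi; ring.
Qed.

End Functional.

Lemma twistor_core : cov (gE s Gam y) ∧ X = 0 ->
  d_cov (gL s t th) y ∧ X = 0 /\ d_cov (gF s th) y ∧ X = 0.
Proof.
move=> EX; split; apply/ffunP => S; rewrite [RHS]ffunE.
  exact: (proj2 (Phi_dF_dL S EX)).
exact: (proj1 (Phi_dF_dL S EX)).
Qed.

Lemma twistor_core_E r Ga : (forall i j, csmooth_mx V (fun w => Ga w i j)) ->
  cov (gE r Ga y) ∧ X = 0 ->
  d_cov (gE r Ga) y ∧ X = sd_eval th x z (d_cov (ez Ga (fib r y)) x
     + cov (qz Ga (fib r y) x) ∧ cov (ez Ga (fib r y) x))
   *: (cov (pull (row i2 (th x))) ∧ cov (pull (row i4 (th x))) ∧ X).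
Proof.
move=> sGa EX; apply/ffunP => S; rewrite [RHS]ffunE; exact: Phi_dE.
Qed.

End Core.
End TwistorForms.

(** * Orientation reversal and anti-self-duality *)

Section Swap.
Variable R : realType.
Local Notation C := (R[i]).
Local Notation H := (null_metric R).
Implicit Types (V : set 'rV[R]_4) (x : 'rV[R]_4) (th g : 'rV[R]_4 -> 'M[C]_4).

(* Exchanging M and P reverses the orientation, and with it the roles of the
   two families of null planes. *)
Definition sw (k : 'I_4) : 'I_4 := tperm i1 i2 k.
Definition swap_coframe th (x : 'rV[R]_4) : 'M[C]_4 := perm_mx (tperm i1 i2) *m th x.
Definition swap_conn (Gam : connection R) : connection R :=
  fun x i j => Gam x (sw i) (sw j).

Lemma swK : involutive sw. Proof. exact: tpermK. Qed.
Lemma sw1 : sw i1 = i2. Proof. exact: tpermL. Qed.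
Lemma sw2 : sw i2 = i1. Proof. exact: tpermR. Qed.
Lemma sw3 : sw i3 = i3. Proof. by rewrite /sw tpermD. Qed.
Lemma sw4 : sw i4 = i4. Proof. by rewrite /sw tpermD. Qed.
Definition swE := (sw1, sw2, sw3, sw4).

Lemma sw_reindex (T : nmodType) (F : 'I_4 -> T) : \sum_k F (sw k) = \sum_k F k.
Proof. by rewrite [RHS](reindex_inj (inv_inj swK)). Qed.

Lemma swap_coframeK th : swap_coframe (swap_coframe th) = th.
Proof.
apply/funext => x; rewrite /swap_coframe mulmxA -perm_mxM tperm2 perm_mx1.
by rewrite mul1mx.
Qed.

Lemma swap_connK Gam : swap_conn (swap_conn Gam) = Gam.
Proof. by apply/funext => x; apply/funext => i; apply/funext => j; rewrite /swap_conn !swK. Qed.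

Lemma row_swap th x k : row k (swap_coframe th x) = row (sw k) (th x).
Proof. by apply/rowP => j; rewrite /swap_coframe -row_permE !mxE. Qed.

Lemma row_frame_swap th x k : th x \in unitmx ->
  row k (frame (swap_coframe th) x) = row (sw k) (frame th x).
Proof.
move=> u; have us : swap_coframe th x \in unitmx by rewrite unitmx_mul unitmx_perm.
have PP : perm_mx (tperm i1 i2) *m perm_mx (tperm i1 i2) = 1%:M :> 'M[C]_4.
  by rewrite -perm_mxM tperm2 perm_mx1.
have -> : frame (swap_coframe th) x = perm_mx (tperm i1 i2) *m frame th x.
  have E : swap_coframe th x *m (invmx (th x) *m perm_mx (tperm i1 i2)) = 1%:M.
    by rewrite /swap_coframe mulmxA mulmxK // PP.
  rewrite /frame; have -> : invmx (swap_coframe th x) = invmx (th x) *m perm_mx (tperm i1 i2).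
    by rewrite -[RHS](mulKmx us) E mulmx1.
  by rewrite trmx_mul tr_perm_mx tpermV.
by apply/rowP => j; rewrite -row_permE !mxE.
Qed.

Lemma frame_metric_swap g th x i j : th x \in unitmx ->
  frame_metric g (swap_coframe th) x i j = frame_metric g th x (sw i) (sw j).
Proof.
have E (f : 'M[C]_4) (k l : 'I_4) : (f *m g x *m f^T) k l = (row k f *m g x *m (row l f)^T) 0 0.
  rewrite -row_mul mxE [RHS]mxE; apply: eq_bigr => m _.
  by rewrite [row _ _ _ _]mxE ![_^T _ _]mxE [row _ _ _ _]mxE.
by move=> u; rewrite /frame_metric !E !row_frame_swap.
Qed.

Lemma coframe_swap V th : open V -> coframe V th -> coframe V (swap_coframe th).
Proof.
move=> oV [sth u]; split.
  by apply: csmooth_mxM => //; apply: csmooth_mx_cst.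
by move=> x Vx; rewrite unitmx_mul unitmx_perm u.
Qed.

Lemma null_cotetrad_swap V g vol th : open V -> null_cotetrad V g vol th ->
  null_cotetrad V g (fun x => - vol x) (swap_coframe th).
Proof.
move=> oV [cth gE dE]; split; first exact: coframe_swap.
  have symC (a b : 'rV[C]_4) : sym_prod a b = sym_prod b a by rewrite /sym_prod addrC.
  move=> x Vx; rewrite (gE x Vx) !row_swap sw1 sw2 sw3 sw4.
  by rewrite (symC (row i2 _)).
move=> x Vx; rewrite /swap_coframe det_mulmx det_perm odd_tperm.
by rewrite (_ : (i1 != i2) = true) // expr1 mulN1r dE.
Qed.

Lemma weyl_connection_swap V g A th Gam : open V -> coframe V th ->
  weyl_connection V g A th Gam ->
  weyl_connection V g A (swap_coframe th) (swap_conn Gam).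
Proof.
move=> oV [_ u] [sG met tf]; split.
- by move=> i j; apply: sG.
- move=> i j x Vx; have GE k l := frame_metric_swap g k l (u x Vx).
  have e1 : d_fun (fun y => frame_metric g (swap_coframe th) y i j) x =
      d_fun (fun y => frame_metric g th y (sw i) (sw j)) x.
    apply/rowP => k; rewrite !mxE; apply: (cpartial_eq k oV Vx) => y Vy.
    by rewrite (frame_metric_swap g i j (u y Vy)).
  have e2 a b : \sum_k frame_metric g (swap_coframe th) x a k *: swap_conn Gam x k b =
      \sum_k frame_metric g th x (sw a) k *: Gam x k (sw b).
    by rewrite -[RHS]sw_reindex; apply: eq_bigr => k _; rewrite GE.
  by rewrite e1 (e2 i j) (e2 j i) GE; exact: (met (sw i) (sw j) x Vx).
- move=> i x Vx.
  transitivity (d_cov (fun y => row (sw i) (th y)) x).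
    by apply: (d_cov_eq oV Vx) => y _; rewrite row_swap.
  rewrite tf // -sw_reindex; congr (- _); apply: eq_bigr => j _.
  by rewrite row_swap.
Qed.

Lemma curvature_form_swap Gam h j x :
  curvature_form (swap_conn Gam) h j x = curvature_form Gam (sw h) (sw j) x.
Proof.
by rewrite /curvature_form; congr (_ + _); rewrite -[RHS]sw_reindex.
Qed.

Lemma curv_comp_swap th Gam x h j k l : th x \in unitmx ->
  curv_comp (swap_coframe th) (swap_conn Gam) x h j k l =
  curv_comp th Gam x (sw h) (sw j) (sw k) (sw l).
Proof. by move=> u; rewrite /curv_comp curvature_form_swap !row_frame_swap. Qed.

Lemma null_metric_sw i j : H (sw i) (sw j) = H i j.
Proof.
rewrite !null_metricE; move: i j.
by do 2!apply: forall_I4; rewrite !swE /=; ring.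
Qed.

Lemma ricci_sw (r : tensor4 R) j l :
  ricci H (lower H (fun h j k l => r (sw h) (sw j) (sw k) (sw l))) j l =
  ricci H (lower H r) (sw j) (sw l).
Proof.
rewrite !(ricci_lower _ (null_metric_sym R) (null_metric_unit R)) !mxE.
by rewrite -[RHS]sw_reindex.
Qed.

Lemma lower_sw (r : tensor4 R) i j k l :
  lower H (fun h j k l => r (sw h) (sw j) (sw k) (sw l)) i j k l =
  lower H r (sw i) (sw j) (sw k) (sw l).
Proof.
rewrite /lower -[RHS]sw_reindex; apply: eq_bigr => h _.
by rewrite null_metric_sw.
Qed.

Lemma scalar_curv_sw (r : tensor4 R) :
  scalar_curv H (lower H (fun h j k l => r (sw h) (sw j) (sw k) (sw l))) =
  scalar_curv H (lower H r).
Proof.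
rewrite /scalar_curv -[RHS]sw_reindex; apply: eq_bigr => i _.
rewrite -[RHS]sw_reindex; apply: eq_bigr => j _.
by rewrite ricci_sw null_metric_inv ![(4 *: H) _ _]mxE null_metric_sw.
Qed.

Lemma weyl_tensor_sw (r : tensor4 R) i j k l :
  weyl_tensor H (lower H (fun h j k l => r (sw h) (sw j) (sw k) (sw l))) i j k l =
  weyl_tensor H (lower H r) (sw i) (sw j) (sw k) (sw l).
Proof. by rewrite /weyl_tensor lower_sw scalar_curv_sw !ricci_sw !null_metric_sw. Qed.

Lemma weyl_form_swap V g vol th Gam i j x : open V -> null_cotetrad V g vol th -> V x ->
  weyl_form g (swap_coframe th) (swap_conn Gam) i j x = weyl_form g th Gam (sw i) (sw j) x.
Proof.
move=> oV nct Vx; have [[_ u] _ _] := nct.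
rewrite /weyl_form !curvature_lower (frame_metric_null nct Vx).
rewrite (frame_metric_null (null_cotetrad_swap oV nct) Vx); congr (_ *: _).
have rE : curv_comp (swap_coframe th) (swap_conn Gam) x =
    fun h j k l => curv_comp th Gam x (sw h) (sw j) (sw k) (sw l).
  apply/funext => h; apply/funext => a; apply/funext => b; apply/funext => c.
  by rewrite curv_comp_swap // u.
rewrite rE -[RHS]sw_reindex; apply: eq_bigr => k _.
rewrite -[RHS]sw_reindex; apply: eq_bigr => l _.
by rewrite weyl_tensor_sw !row_swap.
Qed.

(** The exchange sends P /\ K to M /\ K and N /\ M to N /\ P, and the sign of M /\ P changes in the
    remaining generator. *)
Lemma self_dual_form_swap th x (w : ext R 4) :
  self_dual_form (th x) w <-> anti_self_dual_form (swap_coframe th x) w.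
Proof.
rewrite /self_dual_form /anti_self_dual_form !row_swap !swE.
have E (t : 'I_4 -> 'rV[C]_4) (M P : 'I_4) : cov (t i3) ∧ cov (t i4) + cov (t P) ∧ cov (t M) =
    cov (t i3) ∧ cov (t i4) - cov (t M) ∧ cov (t P) :> ext R 4.
  by rewrite (cov_wedge_anti (t P)).
have {}E := E (fun k => row k (th x)) i1 i2.
by split => -[a [b [c ->]]]; exists a, b, c; rewrite E.
Qed.

End Swap.

(** * Anti-self-duality of the Weyl forms at a point *)

Section Pointwise.
Variable R : realType.
Local Notation C := (R[i]).
Local Notation H := (null_metric R).

Lemma asd_expansion (W : 'I_4 -> 'I_4 -> C) (T : 'I_4 -> 'I_4 -> ext R 4) :
  (forall k l, W l k = - W k l) -> (forall k l, T l k = - T k l) ->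
  (forall k, W k k = 0) -> W i2 i4 = 0 -> W i1 i3 = 0 -> W i1 i2 = W i3 i4 ->
  2^-1 *: \sum_k \sum_l W k l *: T k l =
  W i1 i4 *: T i1 i4 + W i1 i2 *: (T i3 i4 + T i1 i2) + W i3 i2 *: T i3 i2.
Proof.
move=> WA TA W0 W24 W13 W12; apply/ffunP => S.
have [v vE] : exists v, forall k l, T k l S = v k l by exists (fun k l => T k l S).
have vA k l : v l k = - v k l by rewrite -!vE TA ffunE.
transitivity (2^-1 * \sum_k \sum_l W k l * v k l).
  rewrite ffunE; congr (_ * _); rewrite sum_ffunE; apply: eq_bigr => k _.
  by rewrite sum_ffunE; apply: eq_bigr => l _; rewrite ffunE vE.
transitivity (W i1 i4 * v i1 i4 + W i1 i2 * (v i3 i4 + v i1 i2) + W i3 i2 * v i3 i2);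
  last by do 6 rewrite ffunE; rewrite !vE.
rewrite sum_I4 !sum_I4 !W0.
rewrite (vA i1 i2) (vA i1 i3) (vA i1 i4) (vA i2 i3) (vA i2 i4) (vA i3 i4).
rewrite (WA i1 i2) (WA i1 i3) (WA i1 i4) (WA i2 i3) (WA i2 i4) (WA i3 i4).
rewrite W24 W13 -W12; generalize_entries v; generalize_entries W.
by field.
Qed.

Lemma eval2_asd (m p n k e f : 'rV[C]_4) (a b c : C) :
  eval2 (a *: (cov m ∧ cov k) + b *: (cov n ∧ cov k + cov m ∧ cov p) + c *: (cov n ∧ cov p)) e f =
  a * eval2 (cov m ∧ cov k) e f + b * (eval2 (cov n ∧ cov k) e f + eval2 (cov m ∧ cov p) e f)
  + c * eval2 (cov n ∧ cov p) e f.
Proof. by rewrite 2!eval2D 3!eval2Z eval2D. Qed.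

(** The coefficients of a 2-form in the coframe are its values on the dual frame, so being
    anti-self-dual means that the three self-dual combinations of W_ij vanish; [weyl_sd_null_eq0]
    then converts this into the quartic. *)
Lemma weyl_asd_pointwise (V : set 'rV[R]_4) (g : 'rV[R]_4 -> 'M[C]_4) (vol : 'rV[R]_4 -> C)
    (th : 'rV[R]_4 -> 'M[C]_4) (Gam : connection R) (x : 'rV[R]_4) : open V -> null_cotetrad V g vol th ->
  levi_civita_connection V g th Gam -> V x ->
  (forall i j, anti_self_dual_form (th x) (weyl_form g th Gam i j x)) <->
  (forall z, sd_part z (curv_z (curv_comp th Gam x) z) = 0).
Proof.
move=> oV nct lc Vx; have [[_ u] _ _] := nct; have ux := u x Vx.
have sym := curv_null_symmetries oV nct lc Vx.
have tr k l := curv_null_trace oV nct lc k l (fun _ _ => erefl) Vx.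
rewrite (weyl_sd_null_eq0 sym tr).
pose W i j := weyl_tensor H (lower H (curv_comp th Gam x)) i j.
pose T k l := cov (row k (th x)) ∧ cov (row l (th x)).
have wE i j : weyl_form g th Gam i j x = 2^-1 *: \sum_k \sum_l W i j k l *: T k l.
  by rewrite /weyl_form curvature_lower (frame_metric_null nct Vx).
have lA i j k l : lower H (curv_comp th Gam x) i j l k = - lower H (curv_comp th Gam x) i j k l.
  by rewrite /lower -sumrN; apply: eq_bigr => h _; rewrite (r_anti sym) mulrN.
have WA i j k l : W i j l k = - W i j k l.
  by rewrite /W /weyl_tensor lA; ring.
have TA k l : T l k = - T k l by rewrite /T cov_wedge_anti.
have ev i j k l : eval2 (weyl_form g th Gam i j x) (row k (frame th x)) (row l (frame th x)) = W i j k l.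
  rewrite wE eval2Z eval2_sum.
  have pick (F : 'I_4 -> C) a : \sum_b F b * (b == a)%:R = F a.
    rewrite (bigD1 a) //= eqxx mulr1 big1 ?addr0 // => b /negPf ->.
    by rewrite mulr0.
  transitivity (2^-1 * (\sum_a (\sum_b W i j a b * (b == l)%:R) * (a == k)%:R
      - \sum_a (\sum_b W i j a b * (b == k)%:R) * (a == l)%:R)).
    congr (_ * _); rewrite -sumrB; apply: eq_bigr => a _.
    rewrite eval2_sum !mulr_suml -sumrB; apply: eq_bigr => b _.
    by rewrite eval2Z eval2_cov !pairing_frame //; ring.
  by rewrite !pick (WA i j k l); field.
split=> asd i j.
  have [a [b [c wabc]]] := asd i j; rewrite -!/(W _ _ _ _) -!ev wabc.
  rewrite !eval2_asd !eval2_cov !pairing_frame //=.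
  by split; ring.
have [W24 W12 W13] := asd i j; rewrite -!/(W _ _ _ _) in W24 W12 W13.
exists (W i j i1 i4), (W i j i1 i2), (W i j i3 i2).
have W0 k : W i j k k = 0 := @eq_oppr0 _ C^o _ (WA i j k k).
rewrite wE; exact: asd_expansion (WA i j) TA W0 W24 W13 W12.
Qed.

End Pointwise.

(** * The field equations as vanishing of the obstruction *)

Section Integrability.
Variables (R : realType) (X : oriented_manifold4 R) (W : weyl_geometry X).
Local Notation C := (R[i]).

(* The two curvature components that obstruct closedness of E and of E'. *)
Definition no_obstruction (th : 'rV[R]_4 -> 'M[C]_4) (Gam : connection R) x : Prop :=
  forall z z', sd_part z (curv_z (curv_comp th Gam x) z) = 0 /\
               sd_part z (curv_z' (curv_comp th Gam x) z') = 0.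

Definition integrable (eta : volume_form W) : Prop :=
  forall c V th Gam, local_null_cotetrad eta c V th ->
    weyl_connection V (metric W c) (wform W c) th Gam ->
    forall x, V x -> no_obstruction th Gam x.

Lemma csmooth_mxS (V U : set 'rV[R]_4) p q (B : 'rV[R]_4 -> 'M[C]_(p, q)) :
  (U `<=` V)%classic -> csmooth_mx V B -> csmooth_mx U B.
Proof. by move=> UV sB i j; exact: csmoothS UV (sB i j). Qed.

Lemma coframeS (V U : set 'rV[R]_4) (th : 'rV[R]_4 -> 'M[C]_4) :
  (U `<=` V)%classic -> coframe V th -> coframe U th.
Proof. by move=> UV [sth u]; split; [exact: csmooth_mxS UV sth|move=> x /UV /u]. Qed.

Lemma weyl_connectionS (V U : set 'rV[R]_4) g A th (Gam : connection R) :
  (U `<=` V)%classic -> weyl_connection V g A th Gam -> weyl_connection U g A th Gam.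
Proof.
move=> UV [sG met tf]; split.
- by move=> i j; exact: csmooth_mxS UV (sG i j).
- by move=> i j x /UV; exact: met.
- by move=> i x /UV; exact: tf.
Qed.

Lemma einstein_weyl_null (V : set 'rV[R]_4) g vol A th (Gam : connection R) x :
  open V -> null_cotetrad V g vol th -> weyl_connection V g A th Gam -> V x ->
  tracefree_ricci (frame_metric g th x) (curvature g th Gam x) = 0 <->
  forall z z', sd_part z (curv_z' (curv_comp th Gam x) z') = 0.
Proof.
move=> oV nct wc Vx; rewrite curvature_lower (frame_metric_null nct Vx).
by rewrite -(tracefree_ricci_null_eq0 (curv_null_symmetries oV nct wc Vx)).
Qed.

(** The Weyl tensor is defined from the Levi-Civita connection and the obstruction from the Weyl
    connection. Shifting by -A or by A passes from one to the other and leaves q unchanged. *)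
Lemma asd_einstein_weyl_integrable (eta : volume_form W) :
  (anti_self_dual eta /\ einstein_weyl W) <-> integrable eta.
Proof.
split=> [[asd ew] c V th Gam lnc wc x Vx z z'|int].
  have [oV Vc nct] := lnc; have [cth _ _] := nct.
  have sA : csmooth_mx V (wform W c) := csmooth_mxS Vc (wform_smooth W c).
  split; last first.
    exact: (proj1 (einstein_weyl_null oV nct wc Vx) (ew c V th Gam (And3 oV Vc cth) wc x Vx)).
  have lc : levi_civita_connection V (metric W c) th
      (conn_shift th (fun y => - wform W c y) Gam).
    have E : (fun y => wform W c y - wform W c y) = fun=> 0 by apply/funext => y; rewrite subrr.
    by rewrite /levi_civita_connection -E; exact: (weyl_connection_shift oV nct wc (csmooth_mxN oV sA)).
  have := proj1 (weyl_asd_pointwise oV nct lc Vx) (fun i j => asd c V th _ lnc lc i j x Vx) z.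
  exact: (etrans (esym (sd_curv_z_shift oV nct wc (csmooth_mxN oV sA) z Vx))).
split.
  move=> c V th Gam lnc lc i j x Vx; have [oV Vc nct] := lnc.
  have sA : csmooth_mx V (wform W c) := csmooth_mxS Vc (wform_smooth W c).
  have wc : weyl_connection V (metric W c) (wform W c) th (conn_shift th (wform W c) Gam).
    have E : (fun y => 0 + wform W c y) = wform W c by apply/funext => y; rewrite add0r.
    by rewrite -[X in weyl_connection _ _ X]E; exact: (weyl_connection_shift oV nct lc sA).
  apply: (proj2 (weyl_asd_pointwise oV nct lc Vx)) => z.
  exact: (etrans (esym (sd_curv_z_shift oV nct lc sA z Vx)) (proj1 (int c V th _ lnc wc x Vx z 0))).
move=> c V th Gam [oV Vc cth] wc x Vx.
(* The given coframe need not be null: near x a null cotetrad is chosen, the connection is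
   transported to it, and the trace-free Ricci tensor is compared by congruence. *)
have [U [th' [oU Ux UV nct']]] := null_cotetrad_exists oV Vx
  (csmooth_mxS Vc (metric_smooth W c)) (fun y Vy => Defs.metric_sym W (Vc y Vy))
  (fun y Vy => metric_nondegenerate W (Vc y Vy)) (csmoothS Vc (vol_smooth eta c))
  (fun y Vy => vol_square eta (Vc y Vy)).
have Uc : (U `<=` img c)%classic := subset_trans UV Vc.
have [cth' _ _] := nct'.
have cthU := coframeS UV cth; have wcU := weyl_connectionS UV wc.
have sg := csmooth_mxS Uc (metric_smooth W c).
have gs y (Uy : U y) := Defs.metric_sym W (Uc y Uy).
have wc' := weyl_connection_change oU cthU cth' sg gs wcU.
rewrite (tracefree_ricci_change oU cthU cth' gs wcU Ux (metric_nondegenerate W (Uc x Ux))).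
have /(einstein_weyl_null oU nct' wc' Ux) -> : forall z z',
    sd_part z (curv_z' (curv_comp th' (conn_change th th' Gam) x) z') = 0.
  by move=> z z'; have [] := int c U th' _ (And3 oU Uc nct') wc' x Ux z z'.
by rewrite mulmx0 mul0mx.
Qed.

Lemma vol_smoothN (eta : volume_form W) c : csmooth (img c) (fun x => - vol eta c x).
Proof. by apply: csmoothN; [exact: img_open|exact: vol_smooth]. Qed.

Lemma vol_squareN (eta : volume_form W) c x : img c x ->
  (- vol eta c x) ^+ 2 = 16%:R * \det (metric W c x).
Proof. by move=> ix; rewrite sqrrN vol_square. Qed.

Lemma vol_changeN (eta : volume_form W) c c' x : overlap c c' x ->
  - vol eta c x = - vol eta c' (transition c c' x) * \det (cjacobian c c' x).
Proof. by move=> ox; rewrite mulNr -vol_change. Qed.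

Definition volume_opp (eta : volume_form W) : volume_form W :=
  VolumeForm (vol_smoothN eta) (@vol_squareN eta) (@vol_changeN eta).

Lemma volume_oppK eta : forall c, vol (volume_opp (volume_opp eta)) c = vol eta c.
Proof. by move=> c; apply/funext => x; rewrite /= opprK. Qed.

Lemma local_null_cotetrad_swap (eta : volume_form W) c V th :
  local_null_cotetrad eta c V th -> local_null_cotetrad (volume_opp eta) c V (swap_coframe th).
Proof. by move=> [oV Vc nct]; split => //; exact: null_cotetrad_swap. Qed.

Lemma local_null_cotetrad_opp_swap (eta : volume_form W) c V th :
  local_null_cotetrad (volume_opp eta) c V th -> local_null_cotetrad eta c V (swap_coframe th).
Proof.
move=> /local_null_cotetrad_swap [oV Vc nct]; split => //.
by move: nct; rewrite volume_oppK.
Qed.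

(** Exchanging M and P turns cotetrads for [eta] into cotetrads for its opposite, and only permutes
    the indices of the Weyl forms. *)
Lemma self_dual_opp (eta : volume_form W) : self_dual eta <-> anti_self_dual (volume_opp eta).
Proof.
split=> [sd|asd] c V th Gam lnc lc i j x Vx; have [oV Vc nct] := lnc; have [cth _ _] := nct.
  have lnc' := local_null_cotetrad_opp_swap lnc; have lc' := weyl_connection_swap oV cth lc.
  have /self_dual_form_swap := sd c V _ _ lnc' lc' (sw i) (sw j) x Vx.
  by rewrite (weyl_form_swap _ _ _ oV nct Vx) !swK swap_coframeK.
have lnc' := local_null_cotetrad_swap lnc; have lc' := weyl_connection_swap oV cth lc.
apply/self_dual_form_swap.
have := asd c V _ _ lnc' lc' (sw i) (sw j) x Vx.
by rewrite (weyl_form_swap _ _ _ oV nct Vx) !swK.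
Qed.

(** The Einstein-Weyl equations make no reference to the volume form, so the anti-self-dual
    criterion can be applied to the opposite orientation. *)
Lemma sd_einstein_weyl_integrable (eta : volume_form W) :
  (self_dual eta /\ einstein_weyl W) <->
  forall c V th Gam, local_null_cotetrad eta c V th ->
    weyl_connection V (metric W c) (wform W c) th Gam ->
    forall x, V x -> no_obstruction (swap_coframe th) (swap_conn Gam) x.
Proof.
rewrite self_dual_opp asd_einstein_weyl_integrable.
split=> int c V th Gam lnc wc x Vx; have [oV _ [cth _ _]] := lnc.
  exact: (int c V _ _ (local_null_cotetrad_swap lnc) (weyl_connection_swap oV cth wc) x Vx).
have := int c V _ _ (local_null_cotetrad_opp_swap lnc) (weyl_connection_swap oV cth wc) x Vx.
by rewrite swap_coframeK swap_connK.
Qed.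

End Integrability.

(** * The twistor ideal *)

Section WedgeLists.
Variables (R : realType) (n : nat).
Local Notation C := (R[i]).
Implicit Types (a b c d e f : 'rV[C]_n) (u v w X : ext R n).

Lemma cov_swap a b w : cov a ∧ (cov b ∧ w) = - (cov b ∧ (cov a ∧ w)).
Proof. by rewrite -!wedge_assoc cov_wedge_anti wedgeNl. Qed.

Lemma cov_sq a w : cov a ∧ (cov a ∧ w) = 0.
Proof. by rewrite -wedge_assoc cov_wedge_cov wedge0l. Qed.

Lemma wedge_assoc4 u v w X : u ∧ v ∧ w ∧ X = u ∧ (v ∧ (w ∧ X)).
Proof. by rewrite !wedge_assoc. Qed.

Lemma cov_swap2 a b c w : cov a ∧ (cov b ∧ (cov c ∧ w)) = cov c ∧ (cov a ∧ (cov b ∧ w)).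
Proof. by rewrite (cov_swap b c) wedgeNr (cov_swap a c) opprK. Qed.

Lemma cov_sq3 a b c : cov c ∧ (cov a ∧ (cov b ∧ cov c)) = 0.
Proof. by rewrite (cov_wedge_anti b) !wedgeNr -cov_swap2 cov_sq !(wedge0r, oppr0). Qed.

Lemma wedge6_reorder a b c d e f w :
  cov a ∧ (cov b ∧ (cov c ∧ (cov d ∧ (cov e ∧ (cov f ∧ w))))) =
  cov e ∧ (cov f ∧ (cov c ∧ (cov d ∧ (cov a ∧ (cov b ∧ w))))).
Proof.
rewrite (cov_swap2 c d e) (cov_swap2 c d f) (cov_swap2 a b e) (cov_swap2 a b f).
by rewrite (cov_swap2 a b c) (cov_swap2 a b d).
Qed.

Definition wedge_list (s : seq 'rV[C]_n) : ext R n :=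
  foldr (fun a w => cov a ∧ w) (ext1 R n) s.

Lemma wedge_list4 a b c d :
  wedge_list [:: a; b; c; d] = cov a ∧ (cov b ∧ (cov c ∧ cov d)).
Proof. by rewrite /= wedge_ext1. Qed.

Lemma wedge_list4_kill3 u a b c d : u ∧ cov c ∧ cov a ∧ cov b = 0 ->
  u ∧ wedge_list [:: a; b; c; d] = 0.
Proof. by move=> E; rewrite wedge_list4 cov_swap2 -!wedge_assoc E wedge0l. Qed.

Lemma wedge_list4_kill4 u a b c d : u ∧ cov d ∧ cov a ∧ cov b = 0 ->
  u ∧ wedge_list [:: a; b; c; d] = 0.
Proof.
move=> E; rewrite wedge_list4 (cov_wedge_anti c) !wedgeNr cov_swap2 -!wedge_assoc.
by rewrite E wedge0l oppr0.
Qed.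

Lemma wedge_list4_swap u a b c d : u ∧ wedge_list [:: a; b; d; c] = 0 ->
  u ∧ wedge_list [:: a; b; c; d] = 0.
Proof. by rewrite !wedge_list4 (cov_wedge_anti c) !wedgeNr => ->; rewrite oppr0. Qed.

Lemma iota_wedge_list (v : 'rV[C]_n) s : all (fun b => pairing b v == 0) s ->
  iota_v v (wedge_list s) = 0.
Proof.
elim: s => [_|b s IH /= /andP [/eqP bv /IH E]]; first exact: iota_v_ext1.
by rewrite iota_v_cov -/(pairing b v) bv scale0r E wedge0r subr0.
Qed.

(** A vector annihilating s but not a contracts the product to a nonzero multiple of that of s.
    Independence thus follows from vectors that pair with the covectors triangularly. *)
Lemma wedge_list_cons_neq0 (v : 'rV[C]_n) a s : pairing a v != 0 ->
  all (fun b => pairing b v == 0) s -> wedge_list s != 0 -> wedge_list (a :: s) != 0.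
Proof.
move=> av sv; apply: contra => /eqP /= /(congr1 (iota_v v)).
rewrite iota_v_cov -/(pairing a v) (iota_wedge_list sv) wedge0r subr0 iota_v0.
by move/eqP; rewrite scaler_eq0 (negPf av).
Qed.

Lemma pairing_delta a (j : 'I_n) : pairing a (delta_mx 0 j) = a 0 j.
Proof.
rewrite /pairing (bigD1 j) //= mxE !eqxx mulr1 big1 ?addr0 // => k /negPf kj.
by rewrite mxE kj andbF mulr0.
Qed.

Lemma closed_ideal4 (U : set 'rV[R]_n) (a b c d : 'rV[R]_n -> 'rV[C]_n) :
  closed_ideal U (tnth [tuple a; b; c; d]) <-> forall y, U y ->
  let X := wedge_list [:: a y; b y; c y; d y] in
  [/\ d_cov a y ∧ X = 0, d_cov b y ∧ X = 0, d_cov c y ∧ X = 0 & d_cov d y ∧ X = 0].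
Proof.
have XE y : \big[@wedge R n/ext1 R n]_(l < 4) cov (tnth [tuple a; b; c; d] l y) =
    wedge_list [:: a y; b y; c y; d y].
  by rewrite !big_ord_recl big_ord0 !(tnth_nth a).
have tE k : tnth [tuple a; b; c; d] k = nth a [:: a; b; c; d] k by rewrite (tnth_nth a).
split=> [cl y Uy X|cl k y Uy].
  have {}cl (k : 'I_4) : d_cov (nth a [:: a; b; c; d] k) y ∧ X = 0 by rewrite -tE; have := cl k y Uy; rewrite XE.
  by split; [exact: cl i1|exact: cl i2|exact: cl i3|exact: cl i4].
rewrite XE tE; have [c1 c2 c3 c4] := cl y Uy; move: k.
by apply: forall_I4; [exact: c1|exact: c2|exact: c3|exact: c4].
Qed.

End WedgeLists.

Section TwistorIdeal.
Variable R : realType.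
Local Notation C := (R[i]).

Lemma pairing_row_mx (a c : 'rV[C]_4) (b d : 'rV[C]_4) :
  pairing (row_mx a b) (row_mx c d) = pairing a c + pairing b d.
Proof.
rewrite /pairing big_split_ord; congr (_ + _); apply: eq_bigr => k _ /=.
  by rewrite !row_mxEl.
by rewrite !row_mxEr.
Qed.

(** All values of z and z' occur over each x, so that conditions on the bundle give identities of
    polynomials. *)
Lemma twistor_point (x : 'rV[R]_4) (z z' : C) :
  exists y, [/\ tw_base y = x, fib (i1, i2) y = z & fib (i3, i4) y = z'].
Proof.
exists (row_mx x (\row_k [:: complex.Re z; complex.Im z; complex.Re z'; complex.Im z']`_k)).
by split; rewrite /tw_base /fib ?row_mxKl ?row_mxKr // !mxE /=; [case: z|case: z'].
Qed.

Variables (V : set 'rV[R]_4) (g : 'rV[R]_4 -> 'M[C]_4) (vol : 'rV[R]_4 -> C).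
Variables (A : 'rV[R]_4 -> 'rV[C]_4) (th : 'rV[R]_4 -> 'M[C]_4) (Gam : connection R).
Hypotheses (oV : open V) (nct : null_cotetrad V g vol th).
Hypothesis wc : weyl_connection V g A th Gam.
Variables (s t : 'I_4 * 'I_4) (y : 'rV[R]_(4 + 4)).
(** Distinctness of the four real fibre coordinates makes dz and dz' independent. *)
Hypotheses (st : uniq [:: s.1; s.2; t.1; t.2]) (Vy : V (tw_base y)).

Let x := tw_base y.
Let r := curv_comp th Gam x.
Let z := fib s y.
Let z' := fib t y.
Let L := gL s t th.
Let F := gF s th.
Let E := gE s Gam.
Let E' := gE t (swap_conn Gam).

Let ux : th x \in unitmx. Proof. by have [[_ u] _ _] := nct; apply: u. Qed.

Lemma twistor_obstruction : sd_eval th x z (d_cov (ez Gam z) x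
  + cov (qz Gam z x) ∧ cov (ez Gam z x)) = sd_part z (curv_z r z).
Proof. by rewrite /sd_part !(curv_z_eval z _ _ oV nct wc Vy). Qed.

(** The form E' is the form E of the exchanged connection, so the curvature formula is applied in
    the exchanged cotetrad and the frame indices are then exchanged back. *)
Lemma twistor_obstruction' : sd_eval th x z (d_cov (ez (swap_conn Gam) z') x
  + cov (qz (swap_conn Gam) z' x) ∧ cov (ez (swap_conn Gam) z' x)) =
  sd_part z (curv_z' r z').
Proof.
have [cth _ _] := nct.
have nct' := null_cotetrad_swap oV nct; have wc' := weyl_connection_swap oV cth wc.
have e k l : eval2 (d_cov (ez (swap_conn Gam) z') x
    + cov (qz (swap_conn Gam) z' x) ∧ cov (ez (swap_conn Gam) z' x))
    (row k (frame th x)) (row l (frame th x)) = curv_z' r z' k l.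
  have := curv_z_eval z' (sw k) (sw l) oV nct' wc' Vy.
  rewrite !row_frame_swap // !swK => <-.
  by rewrite /curv_z /curv_z' !curv_comp_swap // !swE !swK.
by rewrite /sd_eval /sd_part !e.
Qed.

Let sGam i j : csmooth_mx V (fun w => Gam w i j). Proof. by case: wc => sG _ _; exact: sG. Qed.

Let PK (X : ext R (4 + 4)) := cov (pull (row i2 (th x))) ∧ cov (pull (row i4 (th x))) ∧ X.

Let dE_mod X : cov (L y) ∧ X = 0 -> cov (F y) ∧ X = 0 -> cov (E y) ∧ X = 0 ->
  d_cov E y ∧ X = sd_part z (curv_z r z) *: PK X.
Proof.
move=> LX FX EX; rewrite -twistor_obstruction.
exact: (twistor_core_E oV nct Vy LX FX sGam EX).
Qed.

Let dE'_mod X : cov (L y) ∧ X = 0 -> cov (F y) ∧ X = 0 -> cov (E' y) ∧ X = 0 ->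
  d_cov E' y ∧ X = sd_part z (curv_z' r z') *: PK X.
Proof.
move=> LX FX EX; rewrite -twistor_obstruction'.
exact: (twistor_core_E oV nct Vy LX FX (fun i j => sGam (sw i) (sw j)) EX).
Qed.

Definition twistor_closed_forms : Prop :=
  let l := cov (L y) in let f := cov (F y) in let e := cov (E y) in let e' := cov (E' y) in
  [/\ d_cov L y ∧ e ∧ l ∧ f = 0, d_cov F y ∧ e ∧ l ∧ f = 0,
      d_cov E y ∧ e ∧ l ∧ f = 0 & d_cov E' y ∧ e' ∧ l ∧ f = 0].

Lemma twistor_closed_formsP : sd_part z (curv_z r z) = 0 -> sd_part z (curv_z' r z') = 0 ->
  twistor_closed_forms.
Proof.
move=> q0 q0'; rewrite /twistor_closed_forms.
pose X := cov (E y) ∧ (cov (L y) ∧ cov (F y)).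
pose X' := cov (E' y) ∧ (cov (L y) ∧ cov (F y)).
have kL a : cov (L y) ∧ (cov a ∧ (cov (L y) ∧ cov (F y))) = 0.
  by rewrite cov_swap cov_sq wedge0r oppr0.
have kF a : cov (F y) ∧ (cov a ∧ (cov (L y) ∧ cov (F y))) = 0 := cov_sq3 _ _ _.
have EX : cov (E y) ∧ X = 0 := cov_sq _ _.
have EX' : cov (E' y) ∧ X' = 0 := cov_sq _ _.
have [dL dF] := twistor_core oV nct wc Vy (kL (E y)) (kF (E y)) EX.
split.
- exact: etrans (wedge_assoc4 _ _ _ _) dL.
- exact: etrans (wedge_assoc4 _ _ _ _) dF.
- apply: (etrans (wedge_assoc4 _ _ _ _)).
  by apply: (etrans (dE_mod (kL (E y)) (kF (E y)) EX)); rewrite q0 scale0r.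
- apply: (etrans (wedge_assoc4 _ _ _ _)).
  by apply: (etrans (dE'_mod (kL (E' y)) (kF (E' y)) EX')); rewrite q0' scale0r.
Qed.

Let X3 := wedge_list [:: L y; F y; E y; E' y].

Definition twistor_closed_ideal : Prop :=
  [/\ d_cov L y ∧ X3 = 0, d_cov F y ∧ X3 = 0, d_cov E y ∧ X3 = 0 & d_cov E' y ∧ X3 = 0].

(** Each threefold product is, up to sign, a factor of the fourfold one. *)
Lemma twistor_closed_forms_ideal : twistor_closed_forms -> twistor_closed_ideal.
Proof.
case=> c1 c2 c3 c4; split.
- exact: wedge_list4_kill3 c1.
- exact: wedge_list4_kill3 c2.
- exact: wedge_list4_kill3 c3.
- exact: wedge_list4_kill4 c4.
Qed.

Let fv (j : 'I_4) : 'rV[C]_(4 + 4) := row_mx 0 (delta_mx 0 j).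
Let bv (k : 'I_4) : 'rV[C]_(4 + 4) := row_mx (row k (frame th x)) 0.

Lemma pairing_pull_fiber a j : pairing (pull a) (fv j) = 0.
Proof. by rewrite pairing_row_mx pairing0 addr0 /pairing big1 // => k _; rewrite mxE mulr0. Qed.

Lemma pairing_pull_base k l : pairing (pull (row k (th x))) (bv l) = (k == l)%:R.
Proof. by rewrite pairing_row_mx pairing0 addr0 pairing_frame. Qed.

Lemma pairing_dfib p j : pairing (dfib R p) (fv j) = (j == p.1)%:R + (0 +i* 1) * (j == p.2)%:R.
Proof. by rewrite pairing_row_mx pairing0 add0r pairing_delta !mxE. Qed.

(** Six independent covectors. The fibre directions detect E and E', on which the horizontal forms
    vanish; then n, m, p, k successively detect L, F, P, K. *)
Lemma twistor_volume_neq0 : PK X3 != 0.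
Proof.
pose P := pull (row i2 (th x)); pose K := pull (row i4 (th x)).
have -> : PK X3 = wedge_list [:: E y; E' y; L y; F y; P; K].
  exact: etrans (wedge_assoc _ _ _) (wedge6_reorder _ _ _ _ _ _ _).
have [s12 [s1t1 s1t2] [s2t1 s2t2] t12] : [/\ s.1 != s.2, s.1 != t.1 /\ s.1 != t.2,
    s.2 != t.1 /\ s.2 != t.2 & t.1 != t.2].
  move: st; rewrite /= !inE !negb_or.
  by case/andP => /and3P [? ? ?] /andP [/andP [? ?]] /andP [? _]; split.
have Lf j : pairing (L y) (fv j) = 0.
  rewrite /L /gL /gF pairingD !pairingN pairingZ !pairing_pull_fiber.
  by rewrite mulr0 subr0 oppr0.
have Ff j : pairing (F y) (fv j) = 0 by rewrite pairing_pull_fiber.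
have Pf j : pairing P (fv j) = 0 by rewrite pairing_pull_fiber.
have Kf j : pairing K (fv j) = 0 by rewrite pairing_pull_fiber.
have Ef j : pairing (E y) (fv j) = (j == s.1)%:R + (0 +i* 1) * (j == s.2)%:R.
  by rewrite pairingD pairing_pull_fiber addr0 pairing_dfib.
have E'f j : pairing (E' y) (fv j) = (j == t.1)%:R + (0 +i* 1) * (j == t.2)%:R.
  by rewrite pairingD pairing_pull_fiber addr0 pairing_dfib.
have Fb k : pairing (F y) (bv k) = (i1 == k)%:R + z * (i4 == k)%:R.
  by rewrite /F /gF pullD pullZ pairingD pairingZ !pairing_pull_base.
have Lb k : pairing (L y) (bv k) = - ((i3 == k)%:R + z * (i2 == k)%:R)
    - z' * ((i1 == k)%:R + z * (i4 == k)%:R).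
  rewrite /L /gL pairingD !pairingN pairingZ -/(F y) Fb pullD pullZ pairingD pairingZ.
  by rewrite !pairing_pull_base.
have Pb k : pairing P (bv k) = (i2 == k)%:R := pairing_pull_base _ _.
have Kb k : pairing K (bv k) = (i4 == k)%:R := pairing_pull_base _ _.
have o1 : 1 != 0 :> C := oner_neq0 _.
apply: (wedge_list_cons_neq0 (v := fv s.1)).
- by rewrite Ef eqxx (negPf s12) mulr0 addr0.
- by rewrite /= E'f (negPf s1t1) (negPf s1t2) mulr0 addr0 Lf Ff Pf Kf eqxx.
apply: (wedge_list_cons_neq0 (v := fv t.1)).
- by rewrite E'f eqxx (negPf t12) mulr0 addr0.
- by rewrite /= Lf Ff Pf Kf eqxx.
apply: (wedge_list_cons_neq0 (v := bv i3)).
- by rewrite Lb /= !(mulr0, addr0) subr0 oppr_eq0.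
- by rewrite /= Fb Pb Kb /= mulr0 addr0 eqxx.
apply: (wedge_list_cons_neq0 (v := bv i1)).
- by rewrite Fb /= mulr0 addr0.
- by rewrite /= Pb Kb /= eqxx.
apply: (wedge_list_cons_neq0 (v := bv i2)).
- by rewrite Pb.
- by rewrite /= Kb /= eqxx.
apply: (wedge_list_cons_neq0 (v := bv i4)) => //.
- by rewrite Kb.
- exact: ext1_neq0.
Qed.

(** The closedness of E and E' says that q and q' times one and the same nonzero 6-form vanish. *)
Lemma twistor_closed_idealP : twistor_closed_ideal ->
  sd_part z (curv_z r z) = 0 /\ sd_part z (curv_z' r z') = 0.
Proof.
have XE : X3 = cov (L y) ∧ (cov (F y) ∧ (cov (E y) ∧ cov (E' y))).
  exact: wedge_list4.
have LX : cov (L y) ∧ X3 = 0 by rewrite XE cov_sq.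
have FX : cov (F y) ∧ X3 = 0 by rewrite XE cov_swap cov_sq wedge0r oppr0.
have EX : cov (E y) ∧ X3 = 0.
  by rewrite XE cov_swap (cov_swap (E y)) cov_sq !(wedge0r, oppr0).
have E'X : cov (E' y) ∧ X3 = 0.
  by rewrite XE cov_swap cov_sq3 wedge0r oppr0.
have c0 (c : C) : c *: PK X3 = 0 -> c = 0.
  by move/eqP; rewrite scaler_eq0 (negPf twistor_volume_neq0) orbF => /eqP.
case=> _ _ h h'; split; apply: c0.
  exact: etrans (esym (dE_mod LX FX EX)) h.
exact: etrans (esym (dE'_mod LX FX E'X)) h'.
Qed.

End TwistorIdeal.

(** * The canonical forms as instances of the parametrised ones *)

Section TwistorAtlas.
Variables (R : realType) (Gam : connection R) (th : 'rV[R]_4 -> 'M[R[i]]_4).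

Lemma tw_EE : tw_E Gam = gE (i1, i2) Gam.
Proof.
apply/funext => y; rewrite /tw_E /gE /ez 2!pullD pullN !pullZ pullB !addrA.
by [].
Qed.

(** In part (b) the connection is already exchanged once, and E takes the place of the primed
    form. *)
Lemma tw_EE' : tw_E Gam = gE (i1, i2) (swap_conn (swap_conn Gam)).
Proof. by rewrite swap_connK tw_EE. Qed.

Lemma tw_E'E : tw_E' Gam = gE (i3, i4) (swap_conn Gam).
Proof.
apply/funext => y; rewrite /tw_E' /gE /ez /swap_conn !swE 2!pullD pullN !pullZ pullB !addrA.
by [].
Qed.

Lemma tw_FE : tw_F th = gF (i1, i2) th.
Proof. by apply/funext => y; rewrite /tw_F /gF pullD pullZ. Qed.

Lemma tw_F'E : tw_F' th = gF (i3, i4) (swap_coframe th).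
Proof. by apply/funext => y; rewrite /tw_F' /gF !row_swap !swE pullD pullZ. Qed.

Lemma tw_LE : tw_L th = gL (i1, i2) (i3, i4) th.
Proof.
apply/funext => y; rewrite /tw_L /gL /gF !pullD !pullZ.
rewrite -/(tw_M th y) -/(tw_P th y) -/(tw_N th y) -/(tw_K th y) -[fib (i1, i2) y]/(tw_z y) -[fib (i3, i4) y]/(tw_z' y).
move: (tw_M th y) (tw_P th y) (tw_N th y) (tw_K th y) (tw_z y) (tw_z' y) => M P N K z z'.
by apply/rowP => m; rewrite !mxE; ring.
Qed.

Lemma tw_LE' : tw_L th = gL (i3, i4) (i1, i2) (swap_coframe th).
Proof.
apply/funext => y; rewrite /tw_L /gL /gF !row_swap !swE !pullD !pullZ.
rewrite -/(tw_M th y) -/(tw_P th y) -/(tw_N th y) -/(tw_K th y) -[fib (i1, i2) y]/(tw_z y) -[fib (i3, i4) y]/(tw_z' y).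
move: (tw_M th y) (tw_P th y) (tw_N th y) (tw_K th y) (tw_z y) (tw_z' y) => M P N K z z'.
by apply/rowP => m; rewrite !mxE; ring.
Qed.

End TwistorAtlas.

(** A circle: no obstruction gives the displayed conditions, these give the closed ideal, and the
    closed ideal excludes the obstruction. *)
Lemma twistor_equivalences (R : realType) (V : set 'rV[R]_4) (g : 'rV[R]_4 -> 'M[R[i]]_4)
    (vol : 'rV[R]_4 -> R[i]) (A : 'rV[R]_4 -> 'rV[R[i]]_4) (th : 'rV[R]_4 -> 'M[R[i]]_4)
    (Gam : connection R) (s t : 'I_4 * 'I_4) :
  open V -> null_cotetrad V g vol th -> weyl_connection V g A th Gam ->
  uniq [:: s.1; s.2; t.1; t.2] ->
  (forall (x : 'rV[R]_4) z z', exists y, [/\ tw_base y = x, fib s y = z & fib t y = z']) ->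
  ((forall x, V x -> no_obstruction th Gam x) <->
   (forall y, V (tw_base y) -> twistor_closed_forms th Gam s t y)) /\
  ((forall x, V x -> no_obstruction th Gam x) <->
   (forall y, V (tw_base y) -> twistor_closed_ideal th Gam s t y)).
Proof.
move=> oV nct wc st pt.
have forms : (forall x, V x -> no_obstruction th Gam x) ->
    forall y, V (tw_base y) -> twistor_closed_forms th Gam s t y.
  move=> obs y Vy; have [q q'] := obs _ Vy (fib s y) (fib t y).
  exact: (twistor_closed_formsP oV nct wc Vy q q').
have ideal : (forall y, V (tw_base y) -> twistor_closed_forms th Gam s t y) ->
    forall y, V (tw_base y) -> twistor_closed_ideal th Gam s t y.
  by move=> cf y Vy; apply: twistor_closed_forms_ideal; exact: cf.
have obs : (forall y, V (tw_base y) -> twistor_closed_ideal th Gam s t y) ->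
    forall x, V x -> no_obstruction th Gam x.
  move=> ci x Vx z z'; have [y [yx yz yz']] := pt x z z'.
  have Vy : V (tw_base y) by rewrite yx.
  have := twistor_closed_idealP oV nct wc st Vy (ci y Vy).
  by rewrite yx yz yz' => -[q q']; split.
split; split=> //.
- by move/ideal/obs.
- by move/forms/ideal.
Qed.

Lemma twistor_point' (R : realType) (x : 'rV[R]_4) (z z' : R[i]) :
  exists y, [/\ tw_base y = x, fib (i3, i4) y = z & fib (i1, i2) y = z'].
Proof. by have [y [? ? ?]] := twistor_point x z' z; exists y. Qed.

Theorem corollary6p1 (R : realType) (X : oriented_manifold4 R)
    (W : weyl_geometry X) (eta : volume_form W) :
  (((anti_self_dual eta /\ einstein_weyl W) <->
    on_twistor_bundle eta (fun U th Gam =>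
      closed_ideal U
        (tnth [tuple tw_L th; tw_F th; tw_E Gam; tw_E' Gam])))
   /\
   ((anti_self_dual eta /\ einstein_weyl W) <->
    on_twistor_bundle eta (fun U th Gam => forall y, U y ->
      let L := cov (tw_L th y) in let F := cov (tw_F th y) in
      let E := cov (tw_E Gam y) in let E' := cov (tw_E' Gam y) in
      [/\ d_cov (tw_L th) y ∧ E ∧ L ∧ F = 0,
          d_cov (tw_F th) y ∧ E ∧ L ∧ F = 0,
          d_cov (tw_E Gam) y ∧ E ∧ L ∧ F = 0
        & d_cov (tw_E' Gam) y ∧ E' ∧ L ∧ F = 0])))
  /\
  (((self_dual eta /\ einstein_weyl W) <->
    on_twistor_bundle eta (fun U th Gam => forall y, U y ->
      let L := cov (tw_L th y) in let F' := cov (tw_F' th y) in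
      let E := cov (tw_E Gam y) in let E' := cov (tw_E' Gam y) in
      [/\ d_cov (tw_L th) y ∧ E' ∧ L ∧ F' = 0,
          d_cov (tw_F' th) y ∧ E' ∧ L ∧ F' = 0,
          d_cov (tw_E' Gam) y ∧ E' ∧ L ∧ F' = 0
        & d_cov (tw_E Gam) y ∧ E ∧ L ∧ F' = 0]))
   /\
   ((self_dual eta /\ einstein_weyl W) <->
    on_twistor_bundle eta (fun U th Gam =>
      closed_ideal U
        (tnth [tuple tw_L th; tw_F' th; tw_E Gam; tw_E' Gam])))).
Proof.
split.
  rewrite asd_einstein_weyl_integrable.
  split; split=> H c V th Gam lnc wc; have [oV _ nct] := lnc;
    have [e2 e1] := twistor_equivalences (s := (i1, i2)) (t := (i3, i4)) oV nct wc isT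
      (@twistor_point R).
  - apply/closed_ideal4; rewrite tw_LE tw_FE tw_EE tw_E'E.
    exact: (proj1 e1 (H c V th Gam lnc wc)).
  - apply: (proj2 e1); have /closed_ideal4 := H c V th Gam lnc wc.
    by rewrite tw_LE tw_FE tw_EE tw_E'E; apply.
  - rewrite tw_LE tw_FE tw_EE tw_E'E; exact: (proj1 e2 (H c V th Gam lnc wc)).
  - apply: (proj2 e2); have := H c V th Gam lnc wc.
    by rewrite tw_LE tw_FE tw_EE tw_E'E; apply.
rewrite sd_einstein_weyl_integrable.
split; split=> H c V th Gam lnc wc; have [oV _ nct] := lnc; have [cth _ _] := nct;
  have [e2 e1] := twistor_equivalences (s := (i3, i4)) (t := (i1, i2)) oV
    (null_cotetrad_swap oV nct) (weyl_connection_swap oV cth wc) isT (@twistor_point' R).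
- rewrite tw_LE' tw_F'E tw_E'E tw_EE'.
  move=> y Vy; have [h1 h2 h3 h4] := proj1 e2 (H c V th Gam lnc wc) y Vy.
  by split; [exact: h1|exact: h2|exact: h3|exact: h4].
- apply: (proj2 e2); have := H c V th Gam lnc wc.
  by rewrite tw_LE' tw_F'E tw_E'E tw_EE'; apply.
(* The exchanged instance lists E' before E, hence the transposition of the last two factors. *)
- apply/closed_ideal4 => y Vy; have [h1 h2 h3 h4] := proj1 e1 (H c V th Gam lnc wc) y Vy.
  rewrite tw_LE' tw_F'E tw_E'E tw_EE'.
  split; apply: wedge_list4_swap; [exact: h1|exact: h2|exact: h4|exact: h3].
- apply: (proj2 e1) => y Vy; have /closed_ideal4 := H c V th Gam lnc wc.
  rewrite tw_LE' tw_F'E tw_E'E tw_EE' => /(_ y Vy) [h1 h2 h3 h4].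
  split; apply: wedge_list4_swap; [exact: h1|exact: h2|exact: h4|exact: h3].
Qed.
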